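(* Let $L\ge1$ and let $K$ be an index set. For each $N\in\mathbb N$ let $\mathbf A_{N,1}=(A_{N,1}^{(k)})_{k\in K},\ldots,\mathbf A_{N,L}=(A_{N,L}^{(k)})_{k\in K}$ be independent families of random matrices in $\mathcal M_N(L^\infty)$, each of which is permutation invariant. Assume that either (i) the families are uniformly bounded in operator norm, or (ii) for any $\ell\in\{1,\ldots,L\}$, any $m\ge1$ and any graph monomials $g_1,\ldots,g_m$ with equal input and output (all edges carrying the first label $\ell$), $$\mathbb E\Big[\prod_{i=1}^m\mathrm{Tr}\big(g_i(\mathbf A_{N,\ell})\big)\Big]=O\big(N^{\sum_{i=1}^m\mathfrak f(g_i)/2}\big)\qquad(N\to\infty).$$ Let $\big(\Gamma_\ell^{(k)}\big)_{\ell,k}$, $1\le\ell\le L$, $k\in K$, be (for each $N$) a family of $N\times N$ random matrices with uniformly bounded entries, independent of $(\mathbf A_{N,1},\ldots,\mathbf A_{N,L})$, and set $\tilde{\mathbf A}_{N,\ell}=\big(A_{N,\ell}^{(k)}\circ\Gamma_\ell^{(k)}\big)_{k\in K}$, where $\circ$ is the entrywise product, and $\tilde{\mathbf A}_N=\tilde{\mathbf A}_{N,1}\cup\cdots\cup\tilde{\mathbf A}_{N,L}$. Let $n\ge2$ and $\ell_1,\ldots,\ell_n\in\{1,\ldots,L\}$ with $\ell_1\ne\ell_2\ne\cdots\ne\ell_n$ (consecutive indices distinct), and for monomials $P_{N,1},\ldots,P_{N,n}$ put $$\varepsilon_N:=\Delta\Big[\big(P_{N,1}(\tilde{\mathbf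 A}_{N,\ell_1})-\Delta P_{N,1}(\tilde{\mathbf A}_{N,\ell_1})\big)\cdots\big(P_{N,n}(\tilde{\mathbf A}_{N,\ell_n})-\Delta P_{N,n}(\tilde{\mathbf A}_{N,\ell_n})\big)\Big].$$ Then $\varepsilon_N$ converges to zero in Schatten $p$-norm for all $p\ge1$, namely for every $p\ge1$ $$\mathbb E\Big[\tfrac1N\mathrm{Tr}\big[(\varepsilon_N\varepsilon_N^* )^p\big]\Big]\underset{N\to\infty}{\longrightarrow}0,$$ in each of the following two situations: (a) (asymptotic freeness with amalgamation over $\mathcal D_N$) $P_{N,1},\ldots,P_{N,n}\in\mathcal D_N\langle X_k:k\in K\rangle$ are monomials whose degrees and the norms of whose coefficients are bounded uniformly in $N$; (b) (asymptotic freeness with amalgamation in $(\tilde{\mathcal A}_N,\tilde{\mathcal B}_N,\Delta)$) $P_{N,1},\ldots,P_{N,n}\in\tilde{\mathcal B}_N\langle X_k:k\in K\rangle$ are explicitly given by $P_{N,i}=g_{0,i}(\tilde{\mathbf A}_N)X_{k_i(1)}g_{1,i}(\tilde{\mathbf A}_N)\cdots X_{k_i(d_i)}g_{d_i,i}(\tilde{\mathbf A}_N)$, where each $g_{j,i}$ is a cactus-type monomial, and the $d_i$, $k_i(\cdot)\in K$ and $g_{j,i}$ do not depend on $N$.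
   Context: $\Delta$ is the diagonal map $\Delta A=(\delta_{i,j}A(i,j))_{i,j=1}^N$ on $N\times N$ matrices. $\mathcal M_N(L^\infty)$ is the algebra of $N\times N$ matrices of bounded random variables. $\mathcal D_N$ is the algebra of (deterministic) diagonal $N\times N$ matrices. $\tilde{\mathcal A}_N$ is the smallest unital subalgebra of $\mathcal M_N(L^\infty)$ containing the matrices of $\tilde{\mathbf A}_N$ and closed under $\Delta$, and $\tilde{\mathcal B}_N=\Delta(\tilde{\mathcal A}_N)$. For an algebra $\mathcal B$ of diagonal matrices, $\mathcal B\langle X_k:k\in K\rangle$ is the algebra generated by freely noncommuting indeterminates $(X_k)_{k\in K}$ and $\mathcal B$; a monomial $P=b_0X_{k_1}b_1\cdots X_{k_d}b_d$ has degree $d$ and coefficients $b_0,\ldots,b_d\in\mathcal B$; norms of coefficients are operator norms. $P(\tilde{\mathbf A}_{N,\ell})$ denotes substitution of $X_k=A_{N,\ell}^{(k)}\circ\Gamma_\ell^{(k)}$. A graph monomial $g$ is a finite connected directed graph $G=(V,E,v_{in},v_{out})$ (multiple edges and loops allowed) with two roots $v_{in},v_{out}\in V$ (input and output, possibly equal), and edge labels $\ell:E\to\{1,\ldots,L\}$, $k:E\to K$. Its evaluation in $\mathbf A_N=\mathbf A_{N,1}\cup\cdots\cup\mathbf A_{N,L}$ is the $N\times N$ matrix $$g(\mathbf A_N)(i,j)=\sum_{\substack{\phi:V\to[N]\\ \phi(v_{in})=j,\ \phi(v_{out})=i}}\ \prod_{e=(v,w)\in E}A_{N,\ell(e)}^{(k(e))}(\phi(w),\phi(v)),\qquad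 [N]=\{1,\ldots,N\},$$ and similarly for $g(\tilde{\mathbf A}_N)$. When all edges carry the first label $\ell$ it is written $g(\mathbf A_{N,\ell})$. A connected graph is a cactus if every edge belongs to exactly one simple cycle (a loop is a simple cycle; a single vertex is a cactus); an oriented cactus is a cactus each of whose simple cycles is directed. A cactus-type monomial is a graph monomial whose graph is an oriented cactus and whose input and output are equal. Definition of $\mathfrak f$: a cut edge of a finite graph is an edge whose deletion increases the number of connected components (orientation is ignored). A two-edge connected graph is a connected graph without cut edge; a two-edge connected component is a maximal two-edge connected subgraph. $F(G)$ is the forest whose vertices are the two-edge connected components of $G$ and whose edges are the cut edges of $G$, each linking the two components containing its endpoints. $\mathfrak f(G)$ is the number of leaves of $F(G)$, with the convention that a tree of $F(G)$ consisting of a single vertex counts as having two leaves. $\mathfrak f(g)$ is $\mathfrak f$ of the graph underlying $g$. Independence of the families: for each $N$. Uniformly bounded in operator norm: there is $C$ with $\|A_{N,\ell}^{(k)}\|\le C$ almost surely for all $N,\ell,k$; uniformly bounded entries: there is $C'$ with $|\Gamma_\ell^{(k)}(i,j)|\le C'$ almost surely for all $N,\ell,k,i,j$. The matrices $\Gamma_\ell^{(k)}$ are not assumed independent of each other nor permutation invariant. $K$ does not depend on $N$. A family $(A_N^{(k)})_{k\in K}$ is permutation invariant if for every permutation matrix $S$ of size $N$, $(A_N^{(k)})_{k\in K}$ and $(SA_N^{(k)}S^{-1})_{k\in K}$ have the same joint distribution.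
   Formalization: Condition (ii) is required for graph monomials in the matrices of A_{N,ℓ} and their adjoints; in (a), unless (i) holds, the letters X_k used in the P_{N,i} must lie in a finite subset of K not depending on N. The literal statement fails without these. *)

(* Defs.v *)
From HB Require Import structures.
From mathcomp Require Import all_boot all_order all_fingroup all_algebra.
From mathcomp Require Import spectral complex.
From mathcomp Require Import all_classical all_reals all_analysis.
Set Implicit Arguments.
Unset Strict Implicit.
Unset Printing Implicit Defensive.
Import Order.TTheory GRing.Theory Num.Theory.
Import numFieldNormedType.Exports.
Import ComplexField.Normc(normc).

(** * Finite directed multigraphs *)

Record multigraph : Type := Multigraph {
  vertex : finType;
  edge : finType;
  source : edge -> vertex;
  target : edge -> vertex
}.

(* Subgraphs are pairs (W, S) of a vertex set and an edge set; orientation is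
   ignored in every notion of this block. *)
Definition adjacent (G : multigraph) (S : {set edge G}) : rel (vertex G) :=
  fun v w => [exists e in S,
    ((source e == v) && (target e == w)) || ((source e == w) && (target e == v))].

Definition subgraph (G : multigraph) (W : {set vertex G}) (S : {set edge G})
    : bool :=
  [forall e in S, (source e \in W) && (target e \in W)].

(* For a subgraph (W, S), the set W is closed under [adjacent S], so that
   [n_comp] counts the connected components of (W, S). *)
Definition num_components (G : multigraph) (W : {set vertex G})
    (S : {set edge G}) : nat :=
  n_comp (adjacent S) W.

Definition connected (G : multigraph) (W : {set vertex G}) (S : {set edge G})
    : bool :=
  num_components W S == 1%N.

Definition is_cut_edge (G : multigraph) (W : {set vertex G}) (S : {set edge G})
    (e : edge G) : bool :=
  (e \in S) && (num_components W S < num_components W (S :\ e))%N.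

Definition two_edge_connected (G : multigraph)
    (U : {set vertex G} * {set edge G}) : bool :=
  [&& subgraph U.1 U.2, connected U.1 U.2
    & [forall e, ~~ is_cut_edge U.1 U.2 e]].

Definition is_two_edge_component (G : multigraph)
    (U : {set vertex G} * {set edge G}) : bool :=
  two_edge_connected U &&
  [forall U' : {set vertex G} * {set edge G},
    [&& two_edge_connected U', U.1 \subset U'.1 & U.2 \subset U'.2]
      ==> (U' == U)].

(* Degree, in the forest F(G), of the two-edge connected component [U]. *)
Definition forest_degree (G : multigraph)
    (U : {set vertex G} * {set edge G}) : nat :=
  #|[set e : edge G | is_cut_edge [set: vertex G] [set: edge G] e &&
       ((source e \in U.1) || (target e \in U.1))]|.

(* In a forest, a vertex of degree 0 is a whole tree, which counts as two
   leaves, and the other leaves are the vertices of degree 1. *)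
Definition forest_leaves (G : multigraph) : nat :=
  (\sum_(U : {set vertex G} * {set edge G} | is_two_edge_component U)
     (if forest_degree U == 0 then 2 else forest_degree U == 1 : nat))%N.

(* Simple cycles are given by cyclic sequences of steps: (e, true) travels
   along the edge e from source to target, (e, false) from target to source. *)
Definition step_from (G : multigraph) (s : edge G * bool) : vertex G :=
  if s.2 then source s.1 else target s.1.

Definition step_to (G : multigraph) (s : edge G * bool) : vertex G :=
  if s.2 then target s.1 else source s.1.

Definition simple_cycle (G : multigraph) (c : seq (edge G * bool)) : bool :=
  [&& c != [::], uniq (map fst c), uniq (map (@step_from G) c)
    & path.cycle (fun s t => step_to s == step_from t) c].

Definition cycle_edges (G : multigraph) (c : seq (edge G * bool))
    : {set edge G} :=
  [set e in map fst c].

Definition directed_cycle (G : multigraph) (c : seq (edge G * bool)) : bool :=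
  all (fun s => s.2) c || all (fun s => ~~ s.2) c.

(* Simple cycles are identified when they have the same edges. *)
Definition cactus (G : multigraph) : Prop :=
  connected [set: vertex G] [set: edge G] /\
  forall e : edge G, exists! S : {set edge G},
    e \in S /\ exists2 c, simple_cycle c & cycle_edges c = S.

Definition oriented_cactus (G : multigraph) : Prop :=
  cactus G /\
  forall c : seq (edge G * bool), simple_cycle c -> directed_cycle c.

(** * Graph monomials and their evaluation *)

Record graph_monomial (J : Type) : Type := GraphMonomial {
  graph : multigraph;
  graph_connected : connected [set: vertex graph] [set: edge graph];
  input : vertex graph;
  output : vertex graph;
  label : edge graph -> J
}.

Local Open Scope classical_set_scope.
Local Open Scope ring_scope.
Local Open Scope complex_scope.
Local Open Scope sesquilinear_scope.

Definition graph_eval (R : realType) (N : nat) (J : Type)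
    (A : J -> 'M[R[i]]_N) (g : graph_monomial J) : 'M[R[i]]_N :=
  \matrix_(i, j)
    \sum_(phi : {ffun vertex (graph g) -> 'I_N} |
          (phi (input g) == j) && (phi (output g) == i))
      \prod_(e : edge (graph g))
        A (label e) (phi (target e)) (phi (source e)).

Definition cactus_type (J : Type) (g : graph_monomial J) : Prop :=
  oriented_cactus (graph g) /\ input g = output g.

(** * Matrices *)

Definition Delta (F : pzRingType) (N : nat) (A : 'M[F]_N) : 'M[F]_N :=
  \matrix_(i, j) (A i j *+ (i == j)).

Definition hadamard (F : pzRingType) (N : nat) (A B : 'M[F]_N) : 'M[F]_N :=
  \matrix_(i, j) (A i j * B i j).

Definition norm2 (R : realType) (N : nat) (x : 'cV[R[i]]_N) : R :=
  Num.sqrt (\sum_i normc (x i 0) ^+ 2).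

Definition opnorm (R : realType) (N : nat) (A : 'M[R[i]]_N) : R :=
  sup [set norm2 (A *m x) | x in [set x | norm2 x <= 1]].

(* Spectral functional calculus: [A ^ p] for [A] positive semidefinite and
   [p] real. *)
Definition psd_pow (R : realType) (N : nat) (A : 'M[R[i]]_N) (p : R)
    : 'M[R[i]]_N :=
  invmx (spectralmx A)
    *m diag_mx (map_mx (fun z : R[i] => (complex.Re z `^ p)%:C)
                  (spectral_diag A))
    *m spectralmx A.

(* b_0 X_{k_1} b_1 ... X_{k_d} b_d *)
Record monomial (B K : Type) : Type := Monomial {
  degree : nat;
  letter : 'I_degree -> K;
  coef : 'I_degree.+1 -> B
}.

Arguments letter {B K} m _.
Arguments coef {B K} m _.

Definition monomial_eval (R : realType) (N : nat) (B K : Type)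
    (ev : B -> 'M[R[i]]_N) (X : K -> 'M[R[i]]_N) (P : monomial B K)
    : 'M[R[i]]_N :=
  ev (coef P ord0) *m
  \big[mulmx/1%:M]_(j < degree P)
     (X (letter P j) *m ev (coef P (lift ord0 j))).

Definition centered_product (R : realType) (N n : nat)
    (M : 'I_n -> 'M[R[i]]_N) : 'M[R[i]]_N :=
  Delta (\big[mulmx/1%:M]_(i < n) (M i - Delta (M i))).

(** * Random matrices *)

(* Complex expectation; meant for integrable variables. *)
Definition cexpectation (d : measure_display) (T : measurableType d)
    (R : realType) (P : probability T R) (X : T -> R[i]) : R[i] :=
  fine ('E_P[fun w => complex.Re (X w)])%E
    +i* fine ('E_P[fun w => complex.Im (X w)])%E.

Definition random_mx (d : measure_display) (T : measurableType d)
    (R : realType) (N : nat) (A : T -> 'M[R[i]]_N) : Prop :=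
  forall i j,
    measurable_fun [set: T] (fun w => complex.Re (A w i j)) /\
    measurable_fun [set: T] (fun w => complex.Im (A w i j)).

Definition Linfty_mx (d : measure_display) (T : measurableType d)
    (R : realType) (P : probability T R) (N : nat) (A : T -> 'M[R[i]]_N)
    : Prop :=
  random_mx A /\
  forall i j, exists c : R, {ae P, forall w, normc (A w i j) <= c}.

(* The product sigma-algebra on families of complex matrices: it is generated
   by the real and imaginary parts of the entries. *)
Definition family_measurable (R : realType) (N : nat) (J : Type)
    : set (set (J -> 'M[R[i]]_N)) :=
  <<s [set E : set (J -> 'M[R[i]]_N) |
        exists k i j, exists2 B : set R, measurable B &
          E = [set M | B (complex.Re (M k i j))] \/
          E = [set M | B (complex.Im (M k i j))]] >>.

Definition same_law (d : measure_display) (T : measurableType d)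
    (R : realType) (P : probability T R) (N : nat) (J : Type)
    (X Y : T -> J -> 'M[R[i]]_N) : Prop :=
  forall E, family_measurable E -> P (X @^-1` E) = P (Y @^-1` E).

(* Taking some of the events equal to [setT] gives the product rule for every
   subfamily. *)
Definition independent_families (d : measure_display) (T : measurableType d)
    (R : realType) (P : probability T R) (N L : nat) (J : Type)
    (X : 'I_L -> T -> J -> 'M[R[i]]_N) : Prop :=
  forall E : 'I_L -> set (J -> 'M[R[i]]_N),
    (forall l, family_measurable (E l)) ->
    P (\bigcap_l (X l @^-1` E l)) = (\prod_(l < L) P (X l @^-1` E l))%E.

Definition independent2 (d : measure_display) (T : measurableType d)
    (R : realType) (P : probability T R) (N : nat) (J J' : Type)
    (X : T -> J -> 'M[R[i]]_N) (Y : T -> J' -> 'M[R[i]]_N) : Prop :=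
  forall E F, family_measurable E -> family_measurable F ->
    P (X @^-1` E `&` Y @^-1` F) = (P (X @^-1` E) * P (Y @^-1` F))%E.

Definition permutation_invariant (d : measure_display) (T : measurableType d)
    (R : realType) (P : probability T R) (N : nat) (J : Type)
    (X : J -> T -> 'M[R[i]]_N) : Prop :=
  forall s : 'S_N,
    same_law P (fun w k => X k w)
      (fun w k => perm_mx s *m X k w *m invmx (perm_mx s)).

Definition bounded_opnorm (d : nat -> measure_display)
    (T : forall N, measurableType (d N)) (R : realType)
    (P : forall N, probability (T N) R) (L : nat) (K : Type)
    (A : forall N, 'I_L -> K -> T N -> 'M[R[i]]_N) : Prop :=
  exists C : R, forall N l k, {ae P N, forall w, opnorm (A N l k w) <= C}.

Definition bounded_entries (d : nat -> measure_display)
    (T : forall N, measurableType (d N)) (R : realType)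
    (P : forall N, probability (T N) R) (L : nat) (K : Type)
    (A : forall N, 'I_L -> K -> T N -> 'M[R[i]]_N) : Prop :=
  exists C : R, forall N l k i j,
    {ae P N, forall w, normc (A N l k w i j) <= C}.

(* The family together with its adjoints: (k, true) is the adjoint of k. *)
Definition with_adjoints (R : realType) (N : nat) (K : Type)
    (A : K -> 'M[R[i]]_N) (k : K * bool) : 'M[R[i]]_N :=
  if k.2 then (A k.1)^t* else A k.1.

(* The entries are complex, so the graphs are taken in the matrices and their
   adjoints; for families that are real or stable under adjoints this is the
   same as taking them in the matrices alone (an adjoint edge is a reversed
   edge, resp. an edge with another label). Without the adjoints nothing would
   control conjugates: if [zeta] is uniform on the unit circle and J is the
   all-ones matrix, then E[prod_i Tr(g_i(r_N zeta J))] vanishes, whatever the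
   size of r_N, as soon as some g_i has an edge. *)
Definition graph_moments_bounded (d : nat -> measure_display)
    (T : forall N, measurableType (d N)) (R : realType)
    (P : forall N, probability (T N) R) (L : nat) (K : Type)
    (A : forall N, 'I_L -> K -> T N -> 'M[R[i]]_N) : Prop :=
  forall (l : 'I_L) (m : nat) (g : 'I_m -> graph_monomial (K * bool)),
    (1 <= m)%N -> (forall i, input (g i) = output (g i)) ->
    ((fun N : nat => normc (cexpectation (P N) (fun w => \prod_(i < m)
        \tr (graph_eval (with_adjoints (fun k => A N l k w)) (g i)))) : R^o)
     =O_\oo
     (fun N : nat =>
        N%:R `^ ((\sum_(i < m) forest_leaves (graph (g i)))%N%:R / 2) : R^o)).

Definition entrywise_product (d : nat -> measure_display)
    (T : forall N, measurableType (d N)) (R : realType) (L : nat) (K : Type)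
    (A Gamma : forall N, 'I_L -> K -> T N -> 'M[R[i]]_N) (N : nat) (l : 'I_L)
    (k : K) (w : T N) : 'M[R[i]]_N :=
  hadamard (A N l k w) (Gamma N l k w).

Definition schatten_cvg0 (d : nat -> measure_display)
    (T : forall N, measurableType (d N)) (R : realType)
    (P : forall N, probability (T N) R)
    (eps : forall N, T N -> 'M[R[i]]_N) : Prop :=
  forall p : R, 1 <= p ->
    'E_(P N)[fun w => (N%:R^-1 *
        complex.Re (\tr (psd_pow (eps N w *m (eps N w)^t*) p)))%R]%E
      @[N --> \oo] --> 0%E.

(* Main.v *)
Require Import Defs.
From HB Require Import structures.
From mathcomp Require Import all_boot all_order all_fingroup all_algebra.
From mathcomp Require Import spectral complex.
From mathcomp Require Import all_classical all_reals all_analysis.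
From mathcomp Require Import measurable_realfun zify ring lra.
Set Implicit Arguments.
Unset Strict Implicit.
Unset Printing Implicit Defensive.
Import Order.TTheory GRing.Theory Num.Theory.
Import numFieldNormedType.Exports.
Import ComplexField.Normc(normc).
Local Notation adjacent := Defs.adjacent.
Local Notation connected := Defs.connected.

(** The proof is a moment computation.  Since [eps_N] is diagonal, the trace of
    the [p]-th power of [eps_N eps_N^*] is [sum_i |eps_N(i,i)|^(2p)], which is at
    most [sum_i |eps_N(i,i)|^2 + sum_i |eps_N(i,i)|^(2m)] for every integer
    [m >= p].  So it is enough that, for each integer [m >= 1], the expectation
    of the unnormalised trace of [(eps_N eps_N^* )^m] stays bounded: the factor
    [1/N] then does the rest ([schatten_from_moments]).

    Such a trace is a sum, over the maps [phi] from the vertices of a fixed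
    finite graph to [{1..N}], of a bounded coefficient times a product of entries
    of the matrices, one per edge.  The predicate [expands] records an expansion
    of this kind together with what is known of the graph drawn by [phi] when
    the coefficient of [phi] does not vanish.  Two facts are carried along.
    That graph is connected and stays so when one edge is deleted: letters
    are paths between two terminals that are joined in the end, and cacti are
    made of cycles.  And each factor [P_i - Delta P_i] contributes a path whose
    edges have the colour [l_i] and whose ends differ, while the outer [Delta]
    makes the last of these ends equal to the first: there is a closed walk
    through distinct consecutive points, whose steps stay in components of
    distinct consecutive colours ([expands_centered], [expands_power]).

    There are [O(N^k)] maps [phi] with an image of size [k]
    ([image_weight_sum]), the [Gamma] factors split off by independence, and the
    trace is bounded as soon as the mean of the product of entries of the [A] is
    [O(N^-k)] along such a map ([proper_bound], [circuit_trace_bound]).  By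
    independence this mean is a product over the [L] colours.  By permutation
    invariance each factor is the average over all injective maps of the same
    shape, hence is [N^-k] times a sum over all injective maps, and, by induction
    on the number of vertices, times a sum over all maps ([injective_bound]).
    Under either growth hypothesis that sum is [O(N^(W/2))], where [W] is the
    total mass of any vertex weight that covers the graph of the given colour
    ([cover], [graph_bound]): a cover has at least the mass of the leaves of the
    forest of two-edge connected components ([forest_leaves_le_cover]); and, for
    bounded operator norms, joining the vertices to a cone point according to
    the weight gives a bridgeless graph, to which the bound of Mingo and
    Speicher on graph sums applies ([rooted_graph_bound], [graph_sum_bound]).

    It remains to cover the [L] colours at a small total cost
    ([coloured_cover]).  Link every vertex to the component of each colour that
    it belongs to.  Each of the [L k] links is worth 2 units; a link that is not
    a bridge pays 1 to each end, and a bridge pays 2 to its end far from a chosen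
    cycle.  Every node then receives at least 2.  What the components receive
    covers the colours, and costs at most [2 L k - 2 k] since the vertices
    receive at least [2 k].  The cycle exists because of
    the closed walk.  Multiplying the [L] factors gives [N^(-L k) N^((L - 1) k) = N^-k]. *)

(** * Weights on the links of a graph *)

Local Open Scope nat_scope.

Lemma connect_homo (X Y : finType) (r : rel X) (r' : rel Y) (h : X -> Y) :
  (forall x y, r x y -> connect r' (h x) (h y)) ->
  forall x y, connect r x y -> connect r' (h x) (h y).
Proof.
move=> hr x y /connectP[p]; elim: p x => [|z p ih] x /=; first by move=> _ ->.
move=> /andP[xz pz] yE; exact: connect_trans (hr _ _ xz) (ih _ pz yE).
Qed.

Lemma connect_stable (X : finType) (r : rel X) (Z : X -> Prop) :
  (forall x y, r x y -> Z x -> Z y) ->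
  forall x y, connect r x y -> Z x -> Z y.
Proof.
move=> hZ x y /connectP[p]; elim: p x => [|z p ih] x /=; first by move=> _ ->.
by move=> /andP[xz pz] yE /(hZ _ _ xz); apply: ih.
Qed.

Section EdgeWeights.
Variables (X : finType) (h : rel X).

Definition unlink (r : rel X) (x y : X) : rel X :=
  [rel a b | r a b && ~~ ((a == x) && (b == y) || (a == y) && (b == x))].

Lemma unlinkC r x y : unlink r x y =2 unlink r y x.
Proof. by move=> a b; rewrite /unlink/= [in LHS]orbC. Qed.

Lemma unlink_sub r x y : subrel (unlink r x y) r.
Proof. by move=> a b /andP[]. Qed.

Lemma unlink_neq (r : rel X) x y a b : r a b -> a != y -> b != y -> unlink r x y a b.
Proof. by rewrite /unlink/= => -> /negbTE -> /negbTE ->; rewrite !andbF. Qed.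

Lemma unlink_sym r x y : symmetric r -> symmetric (unlink r x y).
Proof. by move=> rs a b; rewrite /unlink/= rs; do 4 case: (_ == _). Qed.

Lemma connect_sub1 (r r' : rel X) : subrel r r' -> subrel (connect r) (connect r').
Proof. by move=> rr'; apply: connect_sub => x y /rr'; apply: connect1. Qed.

(** The first link of a path from [x] to [z] without repeated vertices is not used again by that path. *)
Lemma first_step (r : rel X) (x z : X) : connect r x z -> x != z ->
  exists2 y, r x y & connect (unlink r x y) y z.
Proof.
move=> /connectP[p0 p0P zE]; case/shortenP: p0P zE => p pP pU _ zE xz.
case: p pP pU zE => [|y p] /=; first by move=> _ _ e; rewrite e eqxx in xz.
move=> /andP[xy yp] /andP[xNp /andP[yNp pU]] zE; exists y => //.
apply/connectP; exists p => //.
move: xNp; rewrite inE negb_or => /andP[xNy xNp] {zE pU yNp xy}.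
suff avoid q b : x != b -> x \notin q -> path r b q -> path (unlink r x y) b q.
  exact: avoid.
elim: q b => //= a q ih b xNb; rewrite inE negb_or => /andP[xNa xNq] /andP[ba aq].
rewrite ih// andbT /unlink/= ba/= negb_or.
by rewrite eq_sym (negbTE xNb)/= [a == x]eq_sym (negbTE xNa) andbF.
Qed.

Variable x0 : X.

Definition reach x y := connect (unlink h x y) x x0.
(** What [x] receives from its link to [y].  A link pays 2 units in all:
    1 to each end when it is not a bridge, and 2 to the end away from [x0] when
    it is one. *)
Definition edge_weight x y : nat := ~~ reach x y + reach y x.

Lemma edge_weight_opp x y : edge_weight x y + edge_weight y x = 2.
Proof. by rewrite /edge_weight; case: reach; case: reach. Qed.

(** A point other than [x0] has a first link towards [x0]; if that link is a
    bridge it pays 2, and otherwise there is another way to [x0], whose first link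
    is not a bridge either.  The base point lies on a cycle and has two such links. *)
Lemma edge_weight_sum (y1 y2 x : X) :
  y1 != y2 -> h x0 y1 -> h x0 y2 -> reach y1 x0 -> reach y2 x0 ->
  connect h x x0 -> 2 <= \sum_(y | h x y) edge_weight x y.
Proof.
move=> y12 h1 h2 r1 r2 xx0.
have two a b : a != b -> h x a -> h x b -> reach a x -> reach b x ->
    2 <= \sum_(y | h x y) edge_weight x y.
  move=> ab xa xb ra rb.
  have pos c : reach c x -> 0 < edge_weight x c by rewrite /edge_weight => ->; rewrite addn1.
  rewrite (bigD1 a)//= (bigD1 b) ?xb 1?eq_sym//=.
  exact: leq_add (pos a ra) (leq_trans (pos b rb) (leq_addr _ _)).
have [xE|xN] := eqVneq x x0; first by subst x; apply: (two y1 y2).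
have [y xy yc] := first_step xx0 xN.
have ry : reach y x by rewrite /reach (eq_connect (unlinkC _ _ _)).
have [rx|nrx] := boolP (reach x y); last first.
  by rewrite (bigD1 y)//= {1}/edge_weight nrx ry; exact: leq_addr.
have [z xz zc] := first_step rx xN.
have xz' := unlink_sub xz.
apply: (two y z) => //.
  by apply: contraTneq xz => <-; rewrite /unlink/= !eqxx/= andbF.
rewrite /reach (eq_connect (unlinkC _ _ _)).
by apply: connect_sub1 zc => a b; rewrite /unlink/= => /andP[/andP[-> _]].
Qed.

End EdgeWeights.

(** A shortest closed stretch of the walk is a simple cycle, because immediate
    returns are excluded; its two links at the starting point are not bridges. *)
Lemma nonbacktracking_cycle (X : finType) (r : rel X) (x : nat -> X) (m : nat) :
  symmetric r -> (0 < m) ->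
  (forall i, i < m -> r (x i) (x i.+1)) ->
  (forall i, i < m -> x i != x i.+1) ->
  (forall i, i.+1 < m -> x i != x i.+2) ->
  x m = x 0 ->
  exists x0 y1 y2, [/\ y1 != y2, r x0 y1, r x0 y2, reach r x0 y1 x0 & reach r x0 y2 x0].
Proof.
move=> rs m0 hr ne1 ne2 xm.
pose Q k := has (fun i => (i + k < m.+1) && (x i == x (i + k))) (iota 0 m.+1) && (0 < k).
have exQ : exists k, Q k.
  exists m; rewrite /Q m0 andbT; apply/hasP; exists 0; rewrite ?mem_iota//.
  by rewrite add0n ltnSn xm eqxx.
have [k /andP[/hasP[i _ /andP[ikm /eqP xik]] k0] kmin] := ex_minnP exQ.
have dist a b : a < b -> b < a + k -> b < m.+1 -> x a != x b.
  move=> ab bk bm; apply/negP => /eqP xab.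
  have /kmin : Q (b - a).
    rewrite /Q subn_gt0 ab andbT; apply/hasP; exists a.
      by rewrite mem_iota; lia.
    by rewrite subnKC ?(ltnW ab)// bm xab eqxx.
  by lia.
have k3 : 2 < k.
  case: k k0 ikm xik {kmin dist} => [|[|[|k]]]// _ im.
    by rewrite addn1 => e; move: (ne1 i); rewrite e eqxx => /(_ ltac:(lia)).
  by rewrite addn2 => e; move: (ne2 i); rewrite e eqxx => /(_ ltac:(lia)).
(* By minimality, x i, ..., x (i + k - 1) are distinct and x (i + k) = x i. *)
have walk (f : nat -> X) n (s : rel X) :
    (forall j, j < n -> s (f j) (f j.+1)) -> connect s (f 0) (f n).
  elim: n => // n ih hs; apply: (connect_trans (ih _)).
    by move=> j jn; apply: hs; lia.
  by apply: connect1; apply: hs.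
exists (x i), (x i.+1), (x (i + k).-1); split.
- by apply: dist; lia.
- by apply: hr; lia.
- have := hr (i + k).-1; rewrite prednK; last lia.
  by rewrite -xik rs => ->//; lia.
- rewrite /reach {2}xik.
  have -> : i + k = i.+1 + k.-1 by lia.
  have := @walk (fun j => x (i.+1 + j)) k.-1 (unlink r (x i.+1) (x i)).
  rewrite /= addn0; apply => j jk.
  rewrite addnS /unlink/= hr/=; last by lia.
  have d1 : x i != x (i.+1 + j) by apply: dist; lia.
  have d2 : (x i.+1 == x (i.+1 + j)) = (j == 0).
    case: j jk d1 => [|j] jk d1; first by rewrite addn0 !eqxx.
    by apply/negbTE/dist; lia.
  rewrite ![_ == x i]eq_sym (negbTE d1)/= orbF eq_sym d2.
  case: j {d1 d2} jk => //= jk; rewrite ?andbT ?andTb; apply: dist; lia.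
- rewrite /reach.
  rewrite (sym_connect_sym _); last exact: unlink_sym.
  have := @walk (fun j => x (i + j)) k.-1 (unlink r (x (i + k).-1) (x i)).
  rewrite /= addn0. have -> : (i + k).-1 = i + k.-1 by lia.
  apply => j jk.
  rewrite addnS /unlink/= hr/=; last by lia.
  have d1 : (x i == x (i + j).+1) = false by apply/negbTE; apply: dist; lia.
  have d2 : (x (i + j) == x (i + k.-1)) = false by apply/negbTE; apply: dist; lia.
  rewrite d2/= [_ == x i]eq_sym.
  case: j jk {d1 d2} => [|j] jk.
    rewrite addn0 eqxx/=; apply: dist; lia.
  by rewrite (_ : (x i == x (i + j.+1)) = false)//; apply/negbTE; apply: dist; lia.
Qed.

(** * Covers of coloured graphs *)

Section Graph.
Variable G : multigraph.
Implicit Types (S : {set edge G}) (x y z : vertex G) (e : edge G).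

Lemma adjacent_sym S : symmetric (adjacent S).
Proof. by move=> x y; apply: eq_existsb => e; rewrite orbC. Qed.

Lemma adjacent_csym S : connect_sym (adjacent S).
Proof. exact: sym_connect_sym (adjacent_sym S). Qed.

Lemma adjacentP S x y :
  reflect (exists2 e, e \in S & source e = x /\ target e = y \/ source e = y /\ target e = x)
          (adjacent S x y).
Proof.
apply: (iffP existsP) => [[e /andP[eS E]]|[e eS E]]; exists e => //.
  by case/orP: E => /andP[/eqP ? /eqP ?]; [left|right].
by rewrite eS; case: E => [[-> ->]|[-> ->]]; rewrite !eqxx ?orbT.
Qed.

Lemma adjacent_edge S e : e \in S -> adjacent S (source e) (target e).
Proof. by move=> eS; apply/adjacentP; exists e => //; left. Qed.

Lemma adjacentS S S' : S \subset S' -> subrel (adjacent S) (adjacent S').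
Proof.
by move=> /fintype.subsetP SS' x y /adjacentP[e /SS' eS E]; apply/adjacentP; exists e.
Qed.

Lemma connectS S S' : S \subset S' -> subrel (connect (adjacent S)) (connect (adjacent S')).
Proof. by move=> /adjacentS; apply: connect_sub1. Qed.

(** Every part of the graph that one edge separates from the rest carries some
    weight, and every connected component has weight at least 2.  These are
    the masses of a leaf and of a single-vertex tree in the count of leaves of
    the forest of two-edge connected components. *)
Definition cover S (w : vertex G -> nat) : Prop :=
  (forall e x, exists2 y, connect (adjacent (S :\ e)) x y & 0 < w y) /\
  (forall x, 2 <= \sum_(y | connect (adjacent S) x y) w y).

End Graph.

Definition image_graph (G : multigraph) (V : finType) (k : vertex G -> V) : multigraph :=
  @Multigraph V (edge G) (k \o @source G) (k \o @target G).

Lemma connect_image (G : multigraph) (V : finType) (k : vertex G -> V)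
    (S : {set edge G}) x y :
  connect (adjacent S) x y -> connect (@adjacent (image_graph k) S) (k x) (k y).
Proof.
apply: connect_homo => {}x {}y /adjacentP[e eS E]; apply: connect1.
by apply/adjacentP; exists e => //; case: E => [[<- <-]|[<- <-]]; [left|right].
Qed.

Lemma cover_image (G : multigraph) (V : finType) (k : vertex G -> V)
    (S : {set edge G}) w :
  (forall y, exists x, k x = y) -> cover S w ->
  @cover (image_graph k) S (fun y => \sum_(x | k x == y) w x).
Proof.
move=> ksurj [w1 w2]; split=> [e y|y]; have [x <-] := ksurj y.
  have [z xz wz] := w1 e x; exists (k z); first exact: connect_image.
  by rewrite (bigD1 z)//= ltn_addr.
apply: leq_trans (w2 x) _.
rewrite [leqRHS](exchange_big_dep predT)//=.
rewrite big_mkcond; apply: leq_sum => z _.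
case: ifP => // xz.
by rewrite (bigD1 (k z))/= ?leq_addr// eqxx andbT connect_image.
Qed.

Section Colours.
Variables (G : multigraph) (L : nat) (c : edge G -> 'I_L).

Definition colour (l : 'I_L) : {set edge G} := [set e | c e == l].

Hypothesis Gconn : forall x y : vertex G, connect (adjacent [set: edge G]) x y.
Hypothesis Gbridge : forall e : edge G,
  connect (adjacent ([set: edge G] :\ e)) (source e) (target e).
Variables (n : nat) (v : nat -> vertex G) (col : nat -> 'I_L).
Hypothesis n2 : 2 <= n.
Hypothesis vn : v n = v 0.
Hypothesis vne : forall i, i < n -> v i != v i.+1.
Hypothesis vcol : forall i, i < n -> connect (adjacent (colour (col i))) (v i) (v i.+1).
Hypothesis colne : forall i, i.+1 < n -> col i != col i.+1.

Let croot l := fingraph.root (adjacent (colour l)).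

(** Links between the vertices and the monochromatic components that contain
    them; a component is given by its colour and its root. *)
Definition component_graph : rel (vertex G + 'I_L * vertex G) := fun a b =>
  match a, b with
  | inl x, inr lr => lr.2 == croot lr.1 x
  | inr lr, inl x => lr.2 == croot lr.1 x
  | _, _ => false
  end.
Local Notation h := component_graph.

Lemma component_graph_sym : symmetric h.
Proof. by case=> [x|[l r]] [y|[l' r']]. Qed.
Let hs := component_graph_sym.

Let node l x : vertex G + 'I_L * vertex G := inr (l, croot l x).

Lemma node_step e x y : adjacent (colour (c e)) x y -> node (c e) x = node (c e) y.
Proof.
move=> xy; congr (inr (_, _)); apply/(fingraph.rootP (@adjacent_csym _ _)); exact: connect1.
Qed.

Lemma component_connect : forall x y, connect h (inl x) (inl y).
Proof.
move=> x y; apply: (connect_homo (h := inl)) (Gconn x y) => {}x {}y.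
move=> /adjacentP[e _ E].
have xy : adjacent (colour (c e)) x y by apply/adjacentP; exists e; rewrite ?inE.
apply: (@connect_trans _ _ (node (c e) x)); apply: connect1; first by rewrite /= eqxx.
by rewrite (node_step xy) /= eqxx.
Qed.

(** The given closed walk lifts to a walk through vertices and components in
    alternation: it never turns back, since consecutive vertices are distinct and so
    are consecutive colours. *)
Lemma component_cycle : exists x0 y1 y2,
  [/\ y1 != y2, h x0 y1, h x0 y2, reach h x0 y1 x0 & reach h x0 y2 x0].
Proof.
pose x j := if odd j then node (col j./2) (v j./2) else inl (v j./2).
have xE i : i < n -> croot (col i) (v i) = croot (col i) (v i.+1).
  by move=> ii; apply/(fingraph.rootP (@adjacent_csym _ _)); apply: vcol.
apply: (@nonbacktracking_cycle _ h x n.*2 hs); first by lia.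
- move=> i ii; rewrite /x /= uphalf_half; case: (odd i) (odd_double_half i) => /= iE.
    by rewrite xE/= ?eqxx//; lia.
  by rewrite add0n eqxx.
- by move=> i ii; rewrite /x /= uphalf_half; case: (odd i).
- move=> i ii; rewrite /x/= negbK; case: (odd i) (odd_double_half i) => /= iE.
    rewrite /node (inj_eq (@inr_inj _ _)) xpair_eqE negb_and colne//; lia.
  by rewrite (inj_eq (@inl_inj _ _)) vne//; lia.
- by rewrite /x odd_double/= doubleK vn.
Qed.

(** The weight of a vertex in colour [l] is what its component of colour [l]
    receives from their link.  Each node of [component_graph] receives at least 2,
    and the links pay 2 each, so the components receive at most [2 L - 2] per vertex.
    If an edge [e] could split a component into a part of weight zero and the rest, all the
    links from that part to the component would be bridges; but the whole graph
    has no bridge, so the part is joined to the rest off [e], and such a path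
    bypasses one of these links. *)
Lemma coloured_cover : exists w : 'I_L -> vertex G -> nat,
  (forall l, cover (colour l) (w l)) /\
  \sum_l \sum_x w l x <= 2 * (L.-1 * #|vertex G|).
Proof.
have [x0 [y1 [y2 [y12 h1 h2 r1 r2]]]] := component_cycle.
have cx0 x : connect h (inl x) x0.
  case: x0 h1 {h2 r1 r2} => [z|[l r]] h1; first exact: component_connect.
  case: y1 h1 {y12} => // z /= h1.
  apply: connect_trans (component_connect x z) _; exact: connect1.
have key := fun y => @edge_weight_sum _ h x0 y1 y2 y y12 h1 h2 r1 r2.
pose w l x := edge_weight h x0 (node l x) (inl x).
exists w; split; last first.
  have : #|vertex G| * 2 <= \sum_x \sum_l edge_weight h x0 (inl x) (node l x).
    rewrite -sum_nat_const; apply: leq_sum => x _.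
    apply: leq_trans (key (inl x) (cx0 x)) _.
    rewrite big_sumType/= big_pred0// add0n.
    rewrite (reindex_onto (fun l => (l, croot l x)) fst)/=; last first.
      by move=> [l r] /=/eqP ->.
    by under eq_bigl do rewrite !eqxx.
  have : \sum_x \sum_l edge_weight h x0 (inl x) (node l x) + \sum_l \sum_x w l x
      = #|vertex G| * (L * 2).
    rewrite [X in _ + X]exchange_big -big_split/= -sum_nat_const; apply: eq_bigr => x _.
    rewrite -big_split/= (eq_bigr (fun=> 2)) => [|l _]; last exact: edge_weight_opp.
    by rewrite sum_nat_const card_ord.
  have : 0 < L by apply: leq_trans (ltn_ord (col 0)).
  move: (\sum_x _) (\sum_l _) (#|_|) => a b V L0 ab aV.
  have VL : V * (L * 2) = 2 * (L.-1 * V) + V * 2 by rewrite -{1}(prednK L0); lia.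
  lia.
move=> l.
have sum2 x : 2 <= \sum_(y | connect (adjacent (colour l)) x y) w l y.
  have c0 : connect h (node l x) x0.
    apply: connect_trans (cx0 x); apply: connect1; by rewrite /= eqxx.
  apply: leq_trans (key _ c0) _.
  rewrite big_sumType/= [X in _ + X]big_pred0// addn0.
  have linkE y : component_graph (node l x) (inl y) = connect (adjacent (colour l)) x y.
    by rewrite -(fingraph.root_connect (@adjacent_csym _ _)).
  apply: eq_leq; apply: eq_big => [y|y yx]; first exact: linkE.
  have xy : connect (adjacent (colour l)) x y by rewrite -linkE; exact: yx.
  rewrite /w (_ : node l y = node l x)//; congr (inr (_, _)).
  by apply/esym/(fingraph.rootP (@adjacent_csym _ _)).
split=> // e x.
apply: contrapT => nw.
have w0 y : connect (adjacent (colour l :\ e)) x y -> w l y = 0.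
  by move=> xy; apply/eqP; rewrite -leqn0 leqNgt; apply/negP => wy; apply: nw; exists y.
pose N := node l x.
(* If the weights vanish near x, the links of these vertices to N are bridges. *)
have cut y : connect (adjacent (colour l :\ e)) x y ->
    node l y = N /\ ~~ connect (unlink h (inl y) N) (inl y) N.
  move=> xy.
  have yN : node l y = N.
    congr (inr (_, _)); apply/esym/(fingraph.rootP (@adjacent_csym _ _)).
    exact: connectS (finset.subsetDl _ _) _ _ xy.
  split => //; apply/negP => yNc.
  have := w0 _ xy; rewrite /w /edge_weight yN.
  rewrite /reach (eq_connect (unlinkC _ _ _)).
  suff -> : connect (unlink h (inl y) N) (inl y) x0 = connect (unlink h (inl y) N) N x0.
    by case: connect.
  apply: (same_connect _ yNc); apply: sym_connect_sym; apply: unlink_sym; exact: hs.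
(* Vertices reachable from the part of x by paths that do not go through N. *)
pose Z z := exists2 y, connect (adjacent (colour l :\ e)) x y &
                      connect (unlink h (inl y) N) (inl y) (inl z).
have Zstep z z' : adjacent ([set: edge G] :\ e) z z' -> Z z -> Z z'.
  move=> /adjacentP[e' e'e zz'] [y xy yz].
  have [yN ycut] := cut _ xy.
  have adj : adjacent (colour (c e')) z z' by apply/adjacentP; exists e'; rewrite ?inE.
  have [C|C] := eqVneq (node (c e') z) N.
    have [zy|zy] := eqVneq z y.
      exists z'; last exact: connect0.
      apply: connect_trans xy _; rewrite -zy; apply: connect1.
      apply/adjacentP; exists e' => //.
      by move: e'e; rewrite !inE andbT => -> /=; case: C => ->.
    case/negP: ycut; apply: connect_trans yz _; apply: connect1.
    rewrite /unlink -C /= eqxx/= (inj_eq (@inl_inj _ _)) (negbTE zy)/=.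
    by [].
  exists y => //; apply: connect_trans yz _.
  apply: (@connect_trans _ _ (node (c e') z)); apply: connect1.
    by apply: unlink_neq => //=.
  by rewrite (node_step adj) in C *; apply: unlink_neq => //=.
have Zend u u' : connect (adjacent (colour l :\ e)) x u ->
    connect (adjacent ([set: edge G] :\ e)) u u' ->
    node l u' = N -> connect (adjacent (colour l :\ e)) x u'.
  move=> xu uu' u'N.
  have [y xy yu'] : Z u' by apply: connect_stable Zstep _ _ uu' _; exists u.
  have [->//|yu] := eqVneq u' y.
  have [_ /negP[]] := cut _ xy.
  apply: connect_trans yu' _; apply: connect1.
  by rewrite -u'N /unlink /= eqxx/= (inj_eq (@inl_inj _ _)) (negbTE yu).
have clos y y' : adjacent (colour l) y y' ->
    connect (adjacent (colour l :\ e)) x y -> connect (adjacent (colour l :\ e)) x y'.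
  move=> /adjacentP[e' e'l yy'] xy.
  have [yN ycut] := cut _ xy.
  have adj : adjacent (colour (c e')) y y' by apply/adjacentP; exists e'; rewrite ?inE.
  have cl : c e' = l by apply/eqP; rewrite inE in e'l.
  have [ee|ee] := eqVneq e' e; last first.
    apply: connect_trans xy _; apply: connect1; apply/adjacentP; exists e' => //.
    by rewrite in_setD1 ee.
  apply: (Zend y) => //; last by rewrite -yN -cl -(node_step adj).
  case: yy' => [[<- <-]|[<- <-]]; rewrite ee; first exact: Gbridge.
  rewrite (@adjacent_csym _ _); exact: Gbridge.
have := sum2 x; rewrite big1// => y xy; apply: w0.
by apply: connect_stable clos _ _ xy (connect0 _ _).
Qed.

End Colours.

(** * Leaves of the forest of two-edge connected components *)

Section Leaves.
Variable G : multigraph.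
Implicit Types (S : {set edge G}) (W : {set vertex G}) (x y z : vertex G) (e : edge G).
Local Notation T := [set: edge G].

Lemma subgraph_closed W S : subgraph W S -> fingraph.closed (adjacent S) W.
Proof.
move=> /forall_inP sub; apply: (intro_closed (@adjacent_csym G S)) => x y.
by move=> /adjacentP[e /sub/andP[se te] [[<- <-]|[<- <-]]].
Qed.

Lemma num_components_gt0 W S x : subgraph W S -> x \in W -> 0 < num_components W S.
Proof.
move=> sub xW; apply/card_gt0P; exists (fingraph.root (adjacent S) x).
rewrite !inE (roots_root (@adjacent_csym G S))/=.
by rewrite -(closed_connect (subgraph_closed sub) (connect_root _ _)).
Qed.

Lemma connectedP W S : subgraph W S ->
  reflect ((exists x, x \in W) /\ {in W &, forall x y, connect (adjacent S) x y})
          (connected W S).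
Proof.
move=> sub; have cl := subgraph_closed sub.
apply: (iffP idP) => [/eqP/mem_card1[r rE]|[[x xW] xc]].
  have rW x : x \in W -> fingraph.root (adjacent S) x = r.
    move=> xW; apply/eqP; rewrite -[_ == _]/(_ \in pred1 r) -rE !inE.
    by rewrite (roots_root (@adjacent_csym G S))/= -(closed_connect cl (connect_root _ _)).
  split; last by move=> x y xW yW; apply/(fingraph.rootP (@adjacent_csym G S)); rewrite !rW.
  by exists r; move: (rE r); rewrite !inE eqxx => /andP[].
rewrite /connected /num_components.
rewrite (eq_n_comp_r (a' := connect (adjacent S) x)) ?n_comp_connect//.
  exact: adjacent_csym.
move=> y; apply/idP/idP => [yW|xy]; first exact: xc.
by rewrite -(closed_connect cl xy).
Qed.

Lemma subgraphS W S S' : S' \subset S -> subgraph W S -> subgraph W S'.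
Proof.
move=> /fintype.subsetP SS /forall_inP sub; apply/forall_inP => e /SS; exact: sub.
Qed.

Lemma subgraphT S : subgraph [set: vertex G] S.
Proof. by apply/forall_inP => e _; rewrite !inE. Qed.

Lemma cut_edgeE W S e : subgraph W S -> connected W S ->
  is_cut_edge W S e = (e \in S) && ~~ connected W (S :\ e).
Proof.
move=> sub cW; have [[x xW] _] := connectedP sub cW.
have := num_components_gt0 (subgraphS (finset.subsetDl S [set e]) sub) xW.
rewrite /is_cut_edge (eqP cW) /connected; case: num_components => // -[|k]//.
Qed.

(** A path either avoids [e] or can be shortened so as to cross it once. *)
Lemma connect_remove S e y z :
  connect (adjacent S) y z ->
  [\/ connect (adjacent (S :\ e)) y z,
      connect (adjacent (S :\ e)) y (source e) /\ connect (adjacent (S :\ e)) (target e) z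
    | connect (adjacent (S :\ e)) y (target e) /\ connect (adjacent (S :\ e)) (source e) z].
Proof.
move=> yz.
pose Z u := [\/ connect (adjacent (S :\ e)) y u,
  connect (adjacent (S :\ e)) y (source e) /\ connect (adjacent (S :\ e)) (target e) u
| connect (adjacent (S :\ e)) y (target e) /\ connect (adjacent (S :\ e)) (source e) u].
apply: (@connect_stable _ _ Z _ _ _ yz); last by apply: Or31; exact: connect0.
move=> u u' /adjacentP[e' e'S uu'].
have [ee|ne] := eqVneq e' e; last first.
  have st : connect (adjacent (S :\ e)) u u'.
    by apply: connect1; apply/adjacentP; exists e'; rewrite ?in_setD1 ?ne.
  case=> [a|[a b]|[a b]]; [apply: Or31|apply: Or32; split=> //|apply: Or33; split=> //];
    exact: connect_trans st.
subst e'; case: uu' => [[<- <-]|[<- <-]] [a|[a b]|[a b]].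
all: try by apply: Or31.
all: try by apply: Or32; split=> //; apply: connect0.
all: try by apply: Or33; split=> //; apply: connect0.
Qed.

(** The classes of this relation are the two-edge connected components. *)
Definition unbroken x y : bool :=
  connect (adjacent T) x y && [forall e, connect (adjacent (T :\ e)) x y].
Definition noncut : {set edge G} :=
  [set e | connect (adjacent (T :\ e)) (source e) (target e)].

Lemma unbroken_connect x y e : unbroken x y -> connect (adjacent (T :\ e)) x y.
Proof. by case/andP => _ /forallP. Qed.
Lemma unbroken_refl x : unbroken x x.
Proof. by apply/andP; split; [exact: connect0|apply/forallP => e; exact: connect0]. Qed.
Lemma unbroken_sym x y : unbroken x y = unbroken y x.
Proof.
congr (_ && _); first exact: (@adjacent_csym G).
by apply: eq_forallb => e; rewrite (@adjacent_csym G _).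
Qed.
Lemma unbroken_trans : transitive unbroken.
Proof.
move=> y x z /andP[xy0 /forallP xy] /andP[yz0 /forallP yz]; apply/andP; split.
  exact: connect_trans yz0.
by apply/forallP => e; exact: connect_trans (yz e).
Qed.

Lemma noncut_unbroken e : e \in noncut -> unbroken (source e) (target e).
Proof.
rewrite inE => enc; apply/andP; split; first by apply/connect1/adjacent_edge; rewrite inE.
apply/forallP => e'; have [->//|ne] := eqVneq e' e.
by apply: connect1; apply: adjacent_edge; rewrite !inE eq_sym ne.
Qed.

(** In a minimal set of edges that joins [y] to [z], each edge is needed.  A bridge
    of the graph in this set would separate [y] from [z]. *)
Lemma unbroken_noncut (D : {set edge G}) y z : unbroken y z ->
  connect (adjacent (T :\: D)) y z -> connect (adjacent (noncut :\: D)) y z.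
Proof.
move=> yz yzD.
have P0 : connect (adjacent (T :\: D)) y z && [disjoint T :\: D & D].
  by rewrite yzD -finset.setI_eq0; apply/eqP/setP => e; rewrite !inE andbT andNb.
have [S /minsetP[/andP[Syz SD] Smin] _] := @minset_exists _
   (fun S => connect (adjacent S) y z && [disjoint S & D]) _ P0.
apply: (connectS _ Syz); apply/fintype.subsetP => e eS; rewrite !inE.
rewrite (disjointFr SD eS)/=.
have Sub : S :\ e \subset T :\ e by rewrite finset.setSD// finset.subsetT.
have up := connectS Sub.
have nc : ~~ connect (adjacent (S :\ e)) y z.
  apply/negP => c; have := Smin (S :\ e); rewrite c (disjointWl (finset.subsetDl _ _) SD).
  rewrite finset.subsetDl => /(_ isT isT)/setP/(_ e).
  by rewrite !inE eqxx eS.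
have zy := unbroken_connect e yz.
have [c|[/up a /up b]|[/up a /up b]] := connect_remove e Syz; first by rewrite c in nc.
  rewrite (@adjacent_csym G) in a; rewrite (@adjacent_csym G) in b.
  exact: connect_trans (connect_trans a zy) b.
rewrite (@adjacent_csym G); rewrite (@adjacent_csym G) in a; rewrite (@adjacent_csym G) in b.
exact: connect_trans (connect_trans a zy) b.
Qed.

Definition block x : {set vertex G} * {set edge G} :=
  ([set y | unbroken x y], [set e | unbroken x (source e) && unbroken x (target e)]).

Lemma block_connect (D : {set edge G}) x y z : unbroken x y -> unbroken x z ->
  connect (adjacent (T :\: D)) y z -> connect (adjacent ((block x).2 :\: D)) y z.
Proof.
move=> xy xz yzD.
pose Z u := unbroken x u /\ connect (adjacent ((block x).2 :\: D)) y u.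
suff [] : Z z by [].
apply: (@connect_stable _ (adjacent (noncut :\: D)) Z _ y); last first.
- by split => //; exact: connect0.
- by apply: unbroken_noncut => //; rewrite unbroken_sym in xy; exact: unbroken_trans xz.
move=> u u' /adjacentP[e]; rewrite finset.in_setD => /andP[ee /noncut_unbroken eu] uu' [xu yu].
have xs : unbroken x (source e).
  case: uu' => [[-> _]//|[_ h]]; apply: unbroken_trans xu _.
  by rewrite -h unbroken_sym.
have xt := unbroken_trans xs eu.
split; first by case: uu' => [[_ <-]|[<- _]].
apply: connect_trans yu _; apply: connect1; apply/adjacentP; exists e => //.
by rewrite !inE ee xs xt.
Qed.

(** By [unbroken_noncut], two points of a class are joined inside the class, and
    still are when an edge is deleted. *)
Lemma block_two_edge_connected x : two_edge_connected (block x).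
Proof.
have sub : subgraph (block x).1 (block x).2.
  by apply/forall_inP => e; rewrite !inE.
have con0 : connected (block x).1 (block x).2.
  apply/connectedP => //; split; first by exists x; rewrite inE unbroken_refl.
  move=> y z; rewrite !inE => xy xz; rewrite -[(block x).2]finset.setD0.
  apply: block_connect => //; rewrite finset.setD0.
  by rewrite unbroken_sym in xy; have /andP[] := unbroken_trans xy xz.
apply/and3P; split => //; apply/forallP => e.
rewrite cut_edgeE// negb_and negbK orbC.
apply/orP; left; apply/connectedP.
  by apply: subgraphS sub; exact: finset.subsetDl.
split; first by exists x; rewrite inE unbroken_refl.
move=> y z; rewrite !inE => xy xz; apply: block_connect => //.
by rewrite unbroken_sym in xy; apply: unbroken_connect; exact: unbroken_trans xz.
Qed.

(** Two points of a two-edge connected subgraph cannot be separated by deleting an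
    edge, so the subgraph lies in the class of any of its points: the classes
    are the maximal ones. *)
Lemma two_edge_connected_block (U : {set vertex G} * {set edge G}) x :
  two_edge_connected U -> x \in U.1 ->
  (U.1 \subset (block x).1) && (U.2 \subset (block x).2).
Proof.
move=> /and3P[sub con /forallP cut] xU.
have [_ con1] := connectedP sub con.
have ub y z : y \in U.1 -> z \in U.1 -> unbroken y z.
  move=> yU zU; apply/andP; split.
    by apply: connectS (con1 _ _ yU zU); exact: finset.subsetT.
  apply/forallP => e; have [eU|eU] := boolP (e \in U.2).
    have := cut e; rewrite cut_edgeE// eU/= negbK => /connectedP[].
      by apply: subgraphS sub; exact: finset.subsetDl.
    move=> _ /(_ _ _ yU zU); apply: connectS; exact: finset.setSD (finset.subsetT _).
  apply: connectS (con1 _ _ yU zU); apply/fintype.subsetP => e' e'U.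
  by rewrite !inE andbT; apply: contraNneq eU => <-.
apply/andP; split; apply/fintype.subsetP; first by move=> y yU; rewrite inE ub.
by move=> e eU; have /andP[sU tU] := forall_inP sub _ eU; rewrite inE !ub.
Qed.

Lemma two_edge_component_block U x : is_two_edge_component U -> x \in U.1 -> U = block x.
Proof.
move=> /andP[tU /forallP/(_ (block x))/implyP max] xU; apply/esym/eqP/max.
by rewrite block_two_edge_connected; exact: two_edge_connected_block.
Qed.

Lemma two_edge_component_neq0 U : is_two_edge_component U -> exists x, x \in U.1.
Proof. by move=> /andP[/and3P[sub /(connectedP sub)[]]]. Qed.

Hypothesis Gconn : connected [set: vertex G] T.

Lemma noncutE e : is_cut_edge [set: vertex G] T e = (e \notin noncut).
Proof.
rewrite cut_edgeE ?subgraphT// !inE/=; congr negb; apply/idP/idP.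
  by move=> /connectedP[|_]; [exact: subgraphT|apply; rewrite inE].
move=> eN; apply/connectedP; first exact: subgraphT.
have [ex con] := connectedP (subgraphT _) Gconn; split => // x y xT yT.
have := con _ _ xT yT; apply: connect_sub => {xT yT}x {}y /adjacentP[e' _ xy].
have [ee|ne] := eqVneq e' e; last first.
  by apply: connect1; apply/adjacentP; exists e'; rewrite ?inE ?ne.
subst e'; case: xy => [[<- <-]//|[<- <-]]; by rewrite (@adjacent_csym G).
Qed.

(** A leaf of the forest is separated from the rest by its unique bridge, hence
    contains a vertex of positive weight.  A component without any bridge
    is the whole graph, whose weight is at least 2. *)
Lemma forest_leaves_le_cover w : cover T w -> forest_leaves G <= \sum_x w x.
Proof.
move=> [w1 w2].
have [_ con] := connectedP (subgraphT _) Gconn.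
(* A vertex lies in at most one component, so it is enough to bound each term. *)
apply: (@leq_trans (\sum_(U | is_two_edge_component U) \sum_(x in U.1) w x)); last first.
  rewrite (exchange_big_dep predT)//=; apply: leq_sum => x _.
  rewrite (eq_bigl (fun U => is_two_edge_component U && (x \in U.1) && (U == block x))).
    by rewrite -big_filter_cond/=; case: (boolP (is_two_edge_component (block x) && (x \in (block x).1))) => h; [
      rewrite big_filter_cond (big_pred1 (block x)) // => U; apply/andP/eqP => [[_ /eqP]//|->]; rewrite h eqxx |
      rewrite big_filter_cond big_pred0// => U; apply/negP => /andP[UU /eqP UE]; rewrite -UE UU in h].
  move=> U; apply/andP/andP => [[UU xU]|[/andP[]]]//.
  by rewrite UU xU (two_edge_component_block UU xU).
apply: leq_sum => U UU.
have [x xU] := two_edge_component_neq0 UU.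
have UE := two_edge_component_block UU xU.
pose B := [set e : edge G | is_cut_edge [set: vertex G] T e &&
       ((source e \in U.1) || (target e \in U.1))].
have stay e y z : e \notin B -> source e = y /\ target e = z \/ source e = z /\ target e = y ->
    y \in U.1 -> z \in U.1.
  rewrite inE noncutE negb_and negbK => eB yz yU.
  have eN : e \in noncut.
    by case/orP: eB => //; rewrite negb_or; case: yz => [[-> _]|[_ ->]]; rewrite yU ?andbF.
  have st := noncut_unbroken eN; move: yU; rewrite UE !inE => xy.
  apply: unbroken_trans xy _.
  by case: yz => [[<- <-]//|[<- <-]]; rewrite unbroken_sym.
rewrite /forest_degree -/B.
have [/eqP|] := eqVneq #|B| 0.
  rewrite cards_eq0 => /eqP B0.
  apply: leq_trans (w2 x) _; rewrite [leqRHS]big_mkcond/= [leqLHS]big_mkcond/=.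
  apply: leq_sum => y _; rewrite con ?inE//.
  suff -> : y \in U.1 by [].
  apply: (@connect_stable _ (adjacent T) (fun y => y \in U.1) _ x); last 2 first.
  - by rewrite con ?inE.
  - by [].
  by move=> u u' /adjacentP[e _]; apply: stay; rewrite B0 inE.
move=> _; have [/eqP/cards1P[e BE]|//] := eqVneq #|B| 1.
have [a aU] : exists a, (a \in U.1) && ((a == source e) || (a == target e)).
  have : e \in B by rewrite BE inE.
  by rewrite inE => /andP[_ /orP[h|h]]; [exists (source e)|exists (target e)]; rewrite h eqxx ?orbT.
have {aU}[aU _] := andP aU.
have [y ay wy] := w1 e a.
suff yU : y \in U.1 by rewrite (bigD1 y)//= ltn_addr.
apply: (@connect_stable _ (adjacent (T :\ e)) (fun y => y \in U.1) _ a) => //.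
move=> u u' /adjacentP[e']; rewrite !inE andbT => ee; apply: stay.
by rewrite BE inE.
Qed.

End Leaves.

(** * Orderly enumerations of the edges of a bridgeless graph *)

Section Orderly.
Variables (G : multigraph) (r : vertex G).
Implicit Types (e : edge G) (x y : vertex G) (s p : seq (edge G)).

Definition touches x e := (source e == x) || (target e == x).
(** The root counts as touched from the start: its index is the only one that is never
    summed out. *)
Definition touched s x := (x == r) || has (touches x) s.

(** Read as an operator that acts after those of [s] and before those of [s'], the edge
    [e] has an input and an output, and none of its ends is summed freely. *)
Definition in_order s e s' :=
  [&& touched s (source e) || touched s (target e),
      touched s' (source e) || touched s' (target e),
      touched s (source e) || touched s' (source e) &
      touched s (target e) || touched s' (target e)].

Fixpoint orderly pre s post :=
  if s is e :: s' then in_order pre e (s' ++ post) && orderly (rcons pre e) s' post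
  else true.

Lemma touched_sub s s' : {subset s <= s'} -> subpred (touched s) (touched s').
Proof.
move=> ss x /orP[h|/hasP[e /ss es ex]]; apply/orP; [by left|right].
by apply/hasP; exists e.
Qed.

Lemma orderly_cat pre s t post :
  orderly pre (s ++ t) post = orderly pre s (t ++ post) && orderly (pre ++ s) t post.
Proof.
elim: s pre => [|e s ih] pre /=; first by rewrite cats0.
by rewrite ih -catA cat_rcons andbA.
Qed.

Lemma orderly_sub pre pre' s post post' :
  {subset pre <= pre'} -> {subset post <= post'} ->
  orderly pre s post -> orderly pre' s post'.
Proof.
elim: s pre pre' => //= e s ih pre pre' sub sub' /andP[/and4P[h1 h2 h3 h4] h5].
have sub2 : {subset s ++ post <= s ++ post'}.
  by move=> x; rewrite !mem_cat => /orP[->//|/sub' ->]; rewrite orbT.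
have m1 := touched_sub sub; have m2 := touched_sub sub2.
apply/andP; split; last first.
  by apply: ih h5 => // x; rewrite !mem_rcons !inE => /orP[->//|/sub ->]; rewrite orbT.
apply/and4P; split.
- by case/orP: h1 => /m1 ->; rewrite ?orbT.
- by case/orP: h2 => /m2 ->; rewrite ?orbT.
- by case/orP: h3 => [/m1|/m2] ->; rewrite ?orbT.
- by case/orP: h4 => [/m1|/m2] ->; rewrite ?orbT.
Qed.

(** Unlike a path of the adjacency relation, it names its edges. *)
Fixpoint chain s x y : Prop :=
  if s is e :: s' then
    exists2 z, source e = x /\ target e = z \/ source e = z /\ target e = x & chain s' z y
  else x = y.

Lemma chain_rev s x y : chain s x y -> chain (rev s) y x.
Proof.
have cc s1 s2 a b c : chain s1 a b -> chain s2 b c -> chain (s1 ++ s2) a c.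
  elim: s1 a => [|e s1 ih] a /=; first by move=> ->.
  by move=> [z az zb] bc; exists z => //; apply: ih.
elim: s x => [|e s ih] x /=; first by move=> ->.
move=> [z xz /ih zy]; rewrite rev_cons -cats1; apply: (cc _ _ _ z) => //=.
by exists x => //; case: xz; [right|left].
Qed.

Lemma chain_touched s x y t : chain s x y -> touched t y -> touched (s ++ t) x.
Proof.
case: s => [|e s] /=; first by move=> ->.
move=> [z xz _] _; apply/orP; right; rewrite /= /touches.
by case: xz => [[-> _]|[_ ->]]; rewrite eqxx ?orbT.
Qed.

(** Along a path, each edge shares one end with the previous edge and the
    other one with the next. *)
Lemma orderly_chain pre s post x y :
  chain s x y -> touched pre x -> touched post y -> orderly pre s post.
Proof.
elim: s pre x => //= e s ih pre x [z xz zy] px py.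
have tz := chain_touched zy py.
have tz' : touched (rcons pre e) z.
  apply/orP; right; rewrite has_rcons /touches.
  by case: xz => [[_ ->]|[-> _]]; rewrite eqxx ?orbT.
by rewrite (ih _ z)// andbT /in_order; case: xz => [[-> ->]|[-> ->]]; rewrite px tz ?orbT.
Qed.

(** A place where a path between [x] and [y] can be inserted: right after the first
    edge that touches one of them, whichever comes first.  By the order condition,
    that edge is not the last one to touch its vertex. *)
Lemma orderly_slot s x y : orderly [::] s [::] -> touched s x -> touched s y ->
  exists s1 s2, s = s1 ++ s2 /\
    (touched s1 x && touched s2 y \/ touched s1 y && touched s2 x).
Proof.
move=> os sx sy.
have [xr|xr] := eqVneq x r; first by exists [::], s; split=> //; left; rewrite sy /touched xr eqxx.
have [yr|yr] := eqVneq y r; first by exists [::], s; split=> //; right; rewrite sx /touched yr eqxx.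
have last_touch z : z != r -> touched s z ->
    touched (take (find (touches z) s).+1 s) z /\ touched (drop (find (touches z) s).+1 s) z.
  move=> zr; rewrite {1}/touched (negbTE zr)/= => hz.
  have := hz; rewrite has_find => hlt.
  have e0 : edge G by case: (s) hlt.
  have tz : touches z (nth e0 s (find (touches z) s)) by apply: nth_find.
  rewrite (take_nth e0)//; split; first by rewrite /touched has_rcons tz orbT.
  move: os; rewrite -[X in orderly _ X](cat_take_drop (find (touches z) s)) (drop_nth e0)//.
  rewrite orderly_cat/= cats0 => /and3P[_ /and4P[_ _ h3 h4] _].
  have nt : ~~ touched (take (find (touches z) s) s) z.
    rewrite negb_or zr/=; apply/negP => /hasP[e et ez].
    have : find (touches z) s <= index e s by rewrite leqNgt; apply/negP => h; have := before_find e0 h; rewrite nth_index ?ez//; apply: mem_take et.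
    have := et; rewrite -index_mem size_take hlt.
    have <- : index e s = index e (take (find (touches z) s) s).
      by rewrite -[in LHS](cat_take_drop (find (touches z) s) s) index_cat et.
    by rewrite ltnNge => /negP.
  by case/orP: tz => /eqP E; [move: h3|move: h4]; rewrite E (negbTE nt).
have [x1 x2] := last_touch _ xr sx; have [y1 y2] := last_touch _ yr sy.
have sub a b : a <= b -> {subset drop b s <= drop a s}.
  by move=> ab; rewrite -(subnK ab) -drop_drop => e; apply: mem_drop.
have [le|/ltnW le] := leqP (find (touches x) s) (find (touches y) s).
  exists (take (find (touches x) s).+1 s), (drop (find (touches x) s).+1 s).
  split; first by rewrite cat_take_drop.
  by left; rewrite x1 (touched_sub (sub _ _ _) y2).
exists (take (find (touches y) s).+1 s), (drop (find (touches y) s).+1 s).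
split; first by rewrite cat_take_drop.
by right; rewrite y1 (touched_sub (sub _ _ _) x2).
Qed.

Hypothesis Gconn : forall x, connect (adjacent [set: edge G]) r x.
Hypothesis Gbridge : forall e,
  connect (adjacent ([set: edge G] :\ e)) (source e) (target e).

Lemma touches_touched s x e : e \in s -> touches x e -> touched s x.
Proof. by move=> es xe; apply/orP; right; apply/hasP; exists e. Qed.

(** Leave the touched vertices along a new edge.  As this edge is not a bridge,
    one can come back to them without it. *)
Lemma ear s e0 : e0 \notin s -> exists p x y,
  [/\ p != [::], uniq p, {in p, forall e, e \notin s}, chain p x y & touched s x && touched s y].
Proof.
move=> e0s.
have [e es /orP ex] : exists2 e, e \notin s & touched s (source e) || touched s (target e).
  apply: contrapT => no.
  have : touched s (source e0).
    apply: (@connect_stable _ _ (fun x => touched s x) _ _ _ (Gconn (source e0))).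
      move=> x y /adjacentP[e _ xy] sx.
      have [es|es] := boolP (e \in s).
        by apply: (touches_touched es); case: xy => [[_ <-]|[<- _]]; rewrite /touches eqxx ?orbT.
      case: no; exists e => //.
      by case: xy => [[-> _]|[_ ->]]; rewrite sx ?orbT.
    by rewrite /touched eqxx.
  by move=> h; apply: no; exists e0; rewrite ?h.
have [x [y [xy sx yx]]] : exists x y, [/\ source e = x /\ target e = y \/ source e = y /\ target e = x,
    touched s x & connect (adjacent ([set: edge G] :\ e)) x y].
  case: ex => h; [exists (source e), (target e)|exists (target e), (source e)]; split => //.
  - by left.
  - by right.
  - by rewrite adjacent_csym.
(* Paths that avoid e and stop at the first vertex touched by s. *)
pose q := [rel a b | adjacent [set e' | (e' \notin s) && (e' != e)] a b && ~~ touched s a].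
have [z sz yz] : exists2 z, touched s z & connect q y z.
  apply: (@connect_stable _ _ (fun u => exists2 z, touched s z & connect q u z) _ _ _ yx).
    move=> u v /adjacentP[e' e'e uv] [z sz uz].
    have [sv|sv] := boolP (touched s v); first by exists v => //; exact: connect0.
    exists z => //; apply: connect_trans uz; apply: connect1; rewrite /q/= sv andbT.
    apply/adjacentP; exists e'; last by case: uv; [right|left].
    move: e'e; rewrite !inE andbT => ->; rewrite andbT; apply: contra sv => es'.
    by apply: (touches_touched es'); case: uv => [[_ <-]|[<- _]]; rewrite /touches eqxx ?orbT.
  by exists x => //; exact: connect0.
suff [p [up ps pc _]] : exists p, [/\ uniq p, {in p, forall e', (e' \notin s) && (e' != e)},
    chain p y z & True].
  exists (e :: p), x, z; split => //.
  - by rewrite /= up andbT; apply/negP => /ps; rewrite eqxx andbF.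
  - by move=> e'; rewrite inE => /orP[/eqP ->//|/ps/andP[]].
  - by exists y.
  - by rewrite sx sz.
case/connectP: yz => t0 t0P zE; case/shortenP: t0P zE => t tP tU _ ->.
suff [p [up ps pc _]] : exists p, [/\ uniq p, {in p, forall e', (e' \notin s) && (e' != e)},
    chain p y (last y t) & {in p, forall e', (source e' \in y :: t) && (target e' \in y :: t)}].
  by exists p.
elim: t y tP tU {yx xy} => [|a t ih] y /=; first by exists [::].
move=> /andP[/andP[/adjacentP[e' e'P ya] _] tP] /andP[yt tU].
have [p [up ps pc pt]] := ih a tP tU.
exists (e' :: p); split => //=.
- rewrite up andbT; apply/negP => /pt /andP[h1 h2].
  by case: ya => [[h _]|[_ h]]; move: yt; rewrite -h ?h1 ?h2.
- by move=> e2; rewrite inE => /orP[/eqP ->|/ps//]; move: e'P; rewrite inE.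
- by exists a.
- move=> e2; rewrite inE => /orP[/eqP ->|/pt].
    by case: ya => [[-> ->]|[-> ->]]; rewrite !inE !eqxx ?orbT.
  by rewrite ![_ \in y :: _]inE => /andP[-> ->]; rewrite !orbT.
Qed.

(** Ear decomposition: ears are inserted one after the other in the enumeration. *)
Lemma orderly_exists : exists s, [/\ uniq s, forall e, e \in s & orderly [::] s [::]].
Proof.
suff H n : forall s, uniq s -> orderly [::] s [::] -> #|edge G| - size s < n ->
    exists s, [/\ uniq s, forall e, e \in s & orderly [::] s [::]].
  by apply: (H #|edge G|.+1 [::]); rewrite //= subn0.
elim: n => // n ih s us os sn.
have [e /= es|all_in] := pickP (fun e => e \notin s); last first.
  by exists s; split => // e; have /negbFE := all_in e.
have [p [x [y [p0 up ps pc /andP[sx sy]]]]] := ear es.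
have [s1 [s2 [sE h]]] := orderly_slot os sx sy.
have [p' [x' [y' [pp' pc' s1x s2y]]]] : exists p' x' y',
    [/\ perm_eq p p', chain p' x' y', touched s1 x' & touched s2 y'].
  case: h => /andP[h1 h2]; first by exists p, x, y.
  by exists (rev p), y, x; split => //; [rewrite perm_sym perm_rev|exact: chain_rev].
have disj : ~~ has (mem s) p'.
  apply/hasPn => e'; rewrite -(perm_mem pp') => /ps //.
have pm : perm_eq (s1 ++ p' ++ s2) (p' ++ s).
  by rewrite sE perm_catCA.
apply: (ih (s1 ++ p' ++ s2)).
- by rewrite (perm_uniq pm) cat_uniq -(perm_uniq pp') up us andbT /= has_sym.
- have /andP[h1 h2] : orderly [::] s1 s2 && orderly s1 s2 [::].
    by move: os; rewrite sE orderly_cat cats0.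
  rewrite !orderly_cat /= !cats0 (orderly_chain pc') //=.
  apply/andP; split.
    by apply: orderly_sub h1 => // e'; rewrite mem_cat => ->; rewrite orbT.
  apply: orderly_sub h2 => // e'.
  by rewrite !mem_cat => ->.
- have szp : 0 < size p' by rewrite -(perm_size pp'); case: (p) p0.
  have : size (p' ++ s) <= #|edge G|.
    rewrite -(card_uniqP _) ?max_card//.
    by rewrite cat_uniq -(perm_uniq pp') up us andbT /= has_sym.
  rewrite (perm_size pm) size_cat => le.
  move: sn szp le; rewrite ltnS; clear.
  move: #|edge G| (size s) (size p') => a b c; lia.
Qed.

End Orderly.

(** * Graph sums and connected components *)

Local Open Scope ring_scope.
Local Open Scope complex_scope.

Section GraphSum.
Variables (R : comPzRingType) (I : finType) (J : Type).

(** The sum is over all maps, without constraint; edges outside [S] are ignored,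
    so that the vertices stay the same for all colours. *)
Definition graph_sum (G : multigraph) (S : {set edge G}) (A : J -> I -> I -> R)
    (lab : edge G -> J) : R :=
  \sum_(phi : {ffun vertex G -> I})
    \prod_(e in S) A (lab e) (phi (target e)) (phi (source e)).

End GraphSum.

Definition sub_edges (G : multigraph) (S : {set edge G}) : multigraph :=
  @Multigraph (vertex G) {e in S} (fun e => source (val e)) (fun e => target (val e)).

Lemma graph_sum_sub_edges (R : comPzRingType) (I : finType) (J : Type)
    (G : multigraph) (S : {set edge G}) (A : J -> I -> I -> R) lab :
  graph_sum S A lab =
  @graph_sum R I J (sub_edges S) [set: edge (sub_edges S)] A (lab \o val).
Proof.
apply: eq_bigr => phi _; rewrite [LHS]big_sub.
by apply: eq_bigl => e; rewrite inE.
Qed.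

Lemma cover_sub_edges (G : multigraph) (S : {set edge G}) w :
  cover S w -> @cover (sub_edges S) [set: edge (sub_edges S)] w.
Proof.
move=> [w1 w2].
have con (D : {set edge G}) : subrel (connect (adjacent (S :\: D)))
    (connect (@adjacent (sub_edges S) [set e | val e \notin D])).
  apply: connect_sub => x y /adjacentP[e]; rewrite finset.in_setD => /andP[eD eS] xy.
  apply: connect1; apply/adjacentP.
  by exists (exist (fun e => e \in S) e eS : edge (sub_edges S)) => //; rewrite inE.
split=> [e x|x].
  have [y xy wy] := w1 (val e) x; exists y => //.
  move: xy => /con; apply: connectS; apply/fintype.subsetP => e'.
  by rewrite !inE -(inj_eq val_inj) => ->.
apply: leq_trans (w2 x) _.
rewrite [leqLHS]big_mkcond/= [leqRHS]big_mkcond/=; apply: leq_sum => y _.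
case: ifP => // xy; rewrite (_ : connect _ x y)//.
move: xy; rewrite -[S in adjacent S]finset.setD0 => /con; apply: connectS.
exact: finset.subsetT.
Qed.

Section Restrict.
Variables (G : multigraph) (W : {set vertex G}).

Definition inner_edges : {set edge G} :=
  [set e | (source e \in W) && (target e \in W)].

Lemma inner_source (e : {e in inner_edges}) : source (val e) \in W.
Proof. by case: e => e /=; rewrite inE => /andP[]. Qed.
Lemma inner_target (e : {e in inner_edges}) : target (val e) \in W.
Proof. by case: e => e /=; rewrite inE => /andP[]. Qed.

Definition restrict : multigraph :=
  @Multigraph {x in W} {e in inner_edges}
    (fun e => exist (fun x => x \in W) _ (inner_source e))
    (fun e => exist (fun x => x \in W) _ (inner_target e)).

Hypothesis Wc : fingraph.closed (adjacent [set: edge G]) W.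

Lemma inner_closed e : (target e \in W) = (source e \in W).
Proof. by apply/esym/Wc/adjacent_edge; rewrite inE. Qed.

Lemma mem_inner e : (e \in inner_edges) = (source e \in W).
Proof. by rewrite inE inner_closed andbb. Qed.

Lemma restrict_connect (D : {set edge G}) (x : vertex restrict) z :
  connect (adjacent (~: D)) (val x) z ->
  exists2 y : vertex restrict, val y = z &
    connect (@adjacent restrict [set e | val e \notin D]) x y.
Proof.
move=> xz; pose Z u := exists2 y : vertex restrict, val y = u &
    connect (@adjacent restrict [set e | val e \notin D]) x y.
apply: (@connect_stable _ (adjacent (~: D)) Z _ _ _ xz); last by exists x.
move=> u u' /adjacentP[e]; rewrite inE => eD uu' [y yu xy].
have eW : e \in inner_edges.
  have := valP y; rewrite yu mem_inner /= => uW.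
  by case: uu' => [[-> _]|[_ tu]]//; rewrite -inner_closed tu.
pose e0 : edge restrict := exist (fun e => e \in inner_edges) e eW.
have st : connect (@adjacent restrict [set e | val e \notin D]) (source e0) (target e0).
  by apply: connect1; apply: adjacent_edge; rewrite inE.
case: uu' => [[su tu]|[su tu]].
  exists (target e0) => //; apply: connect_trans xy _.
  by rewrite (_ : y = source e0)//; apply: val_inj; rewrite yu -su.
exists (source e0) => //; apply: connect_trans xy _.
rewrite (_ : y = target e0); first by rewrite adjacent_csym.
by apply: val_inj; rewrite yu -tu.
Qed.

Lemma cover_restrict w : cover [set: edge G] w ->
  @cover restrict [set: edge restrict] (w \o val).
Proof.
move=> [w1 w2]; split=> [e x|x].
  have [z xz wz] := w1 (val e) (val x).
  rewrite finset.setTD in xz.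
  have [y yz xy] := restrict_connect xz.
  exists y; last by rewrite /= yz.
  move: xy; apply: connectS; apply/fintype.subsetP => e'.
  by rewrite !inE -(inj_eq val_inj) => ->.
apply: leq_trans (w2 (val x)) _.
rewrite (eq_bigl (fun z => (z \in W) && connect (adjacent [set: edge G]) (val x) z)).
  rewrite big_sub_cond [leqLHS]big_mkcond [leqRHS]big_mkcond/=; apply: leq_sum => z _.
  case: ifP => // xz; rewrite (_ : connect _ x z)//.
  move: xz; rewrite -finset.setC0 => /restrict_connect[y /val_inj ->].
  by apply: connectS; exact: finset.subsetT.
move=> z; rewrite andb_idl// => xz.
by rewrite -(closed_connect Wc xz); exact: valP.
Qed.

End Restrict.

Lemma closed_setC (G : multigraph) (W : {set vertex G}) :
  fingraph.closed (adjacent [set: edge G]) W ->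
  fingraph.closed (adjacent [set: edge G]) (~: W).
Proof. by move=> Wc x y xy; rewrite !inE (Wc x y xy). Qed.

(** A map on the vertices is a pair of maps, on a union of components and on its
    complement. *)
Lemma graph_sum_split (R : comPzRingType) (I : finType) (J : Type)
    (G : multigraph) (W : {set vertex G}) (A : J -> I -> I -> R) lab :
  fingraph.closed (adjacent [set: edge G]) W ->
  graph_sum [set: edge G] A lab =
  @graph_sum R I J (restrict W) [set: edge (restrict W)] A (lab \o val) *
  @graph_sum R I J (restrict (~: W)) [set: edge (restrict (~: W))] A (lab \o val).
Proof.
move=> Wc; have Wc' := closed_setC Wc.
rewrite /graph_sum big_distrlr/= pair_big/=.
have mem_or (x : vertex G) : ((x \in W) + (x \in ~: W))%type.
  by case: (boolP (x \in W)) => h; [left|right; rewrite inE].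
pose glue (p : {ffun {x in W} -> I} * {ffun {x in ~: W} -> I}) : {ffun vertex G -> I} :=
  [ffun x => match mem_or x with
             | inl h => p.1 (exist (fun x => x \in W) x h)
             | inr h => p.2 (exist (fun x => x \in ~: W) x h) end].
pose cut (phi : {ffun vertex G -> I}) :
    {ffun {x in W} -> I} * {ffun {x in ~: W} -> I} :=
  ([ffun x => phi (val x)], [ffun x => phi (val x)]).
have glue1 p (x : {x in W}) : glue p (val x) = p.1 x.
  rewrite ffunE; case: (mem_or _) => h; first by congr (p.1 _); apply: val_inj.
  by exfalso; move: h; rewrite inE (valP x).
have glue2 p (x : {x in ~: W}) : glue p (val x) = p.2 x.
  rewrite ffunE; case: (mem_or _) => h; last by congr (p.2 _); apply: val_inj.
  by exfalso; have := valP x; rewrite inE h.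
have cutK : cancel cut glue.
  move=> phi; apply/ffunP => x; rewrite /glue ffunE.
  by case: (mem_or _) => h; rewrite ffunE.
rewrite (reindex glue); last first.
  exists cut => p _; last exact: cutK.
  by case: p => p1 p2; congr pair; apply/ffunP => x; rewrite ffunE ?(glue1 (p1, p2)) ?(glue2 (p1, p2)).
apply: eq_bigr => p _.
rewrite (bigID (fun e => e \in inner_edges W))/=; congr (_ * _).
  rewrite (eq_bigl (fun e => e \in inner_edges W)); last by move=> e; rewrite inE.
  rewrite [LHS]big_sub; apply: eq_big => [e|e _]; first by rewrite inE.
  by rewrite -(glue1 p) -(glue1 p).
rewrite (eq_bigl (fun e => e \in inner_edges (~: W))); last first.
  by move=> e; rewrite !mem_inner// !inE.
rewrite [LHS]big_sub; apply: eq_big => [e|e _]; first by rewrite inE.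
by rewrite -(glue2 p) -(glue2 p).
Qed.

Lemma trace_graph_eval (R : realType) (J : Type) (N : nat) (A : J -> 'M[R[i]]_N)
    (g : graph_monomial J) : input g = output g ->
  \tr (graph_eval A g) = graph_sum [set: edge (graph g)] A (@label _ g).
Proof.
move=> io; rewrite /mxtrace /graph_sum.
under eq_bigr do rewrite mxE -io.
rewrite (exchange_big_dep predT)//=; apply: eq_bigr => phi _.
rewrite (big_pred1 (phi (input g))); last first.
  by move=> x; rewrite /= andbb eq_sym.
by apply: eq_bigl => e; rewrite inE.
Qed.

Definition closed_monomial (J : Type) := {g : graph_monomial J | input g = output g}.

(** Graph monomials are connected, but the graph of one colour need not be: a
    graph sum is the product of the traces of the monomials of its components.
    Leaves and weights add up over the components. *)
Lemma component_monomials (R : realType) (J : Type) (G : multigraph)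
    (lab : edge G -> J) : exists gs : seq (closed_monomial J),
  [/\ forall w, cover [set: edge G] w ->
        (\sum_(g <- gs) forest_leaves (graph (sval g)) <= \sum_x w x)%N,
      (0 < #|vertex G|)%N -> (0 < size gs)%N &
      forall N (A : J -> 'M[R[i]]_N),
        graph_sum [set: edge G] A lab = \prod_(g <- gs) \tr (graph_eval A (sval g))].
Proof.
have [n] := ubnP #|vertex G|; elim: n G lab => // n ih G lab Gn.
have [x _|V0] := pickP (fun _ : vertex G => true).
  pose W := [set y | connect (adjacent [set: edge G]) x y].
  have Wc : fingraph.closed (adjacent [set: edge G]) W.
    move=> y z yz; rewrite !inE; exact: (same_connect_r (@adjacent_csym G _) (connect1 yz)).
  have xW : x \in W by rewrite inE connect0.
  have Wcon : connected [set: vertex (restrict W)] [set: edge (restrict W)].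
    apply/connectedP; first exact: subgraphT.
    split; first by exists (exist (fun x => x \in W) x xW).
    move=> y z _ _.
    have : connect (adjacent (~: finset.set0)) (val y) (val z).
      have := valP y; have := valP z; rewrite !inE finset.setC0 => xz xy.
      by apply: connect_trans xz; rewrite adjacent_csym.
    move=> /restrict_connect-/(_ Wc)[y' /val_inj ->]; apply: connectS.
    exact: finset.subsetT.
  pose g : graph_monomial J := @GraphMonomial J (restrict W) Wcon
    (exist (fun x => x \in W) x xW) (exist (fun x => x \in W) x xW) (lab \o val).
  have Wc' := closed_setC Wc.
  have [|gs [gsw _ gsE]] := ih (restrict (~: W)) (lab \o val).
    have lt : (#|~: W| < #|vertex G|)%N.
      by rewrite -(cardsC W) -[X in (X < _)%N]add0n ltn_add2r; apply/card_gt0P; exists x.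
    by rewrite /= card_sig; apply: leq_trans lt _.
  exists (exist (fun g => input g = output g) g erefl :: gs); split => //.
    move=> w wc; rewrite big_cons/= (bigID (mem W))/=; apply: leq_add.
      rewrite [leqRHS]big_sub; apply: forest_leaves_le_cover => //.
      exact: cover_restrict.
    apply: leq_trans (gsw _ (cover_restrict Wc' wc)) _.
    rewrite [leqRHS](eq_bigl (mem (~: W))); last by move=> y; rewrite !inE.
    by rewrite [leqRHS]big_sub.
  move=> N A; rewrite big_cons -gsE (graph_sum_split _ _ Wc); congr (_ * _).
  by rewrite trace_graph_eval.
exists [::]; split => //.
- by move=> w _; rewrite big_nil.
- by rewrite eq_card0.
- move=> N A; rewrite big_nil /graph_sum (big_pred1 [ffun x => False_rect _ (notF (esym (V0 x)))]).
    by rewrite big_pred0// => e; have := V0 (source e).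
  by move=> phi /=; apply/esym/eqP/ffunP => x; have := V0 x.
Qed.

(** * Moduli of complex numbers and contractions *)

Section Normc.
Variable R : rcfType.
Implicit Types x y z : R[i].

Lemma normc_ge0 z : 0 <= normc z.
Proof. by case: z => a b; apply: sqrtr_ge0. Qed.

Lemma normcE' z : (normc z)%:C = `|z|.
Proof. by rewrite normc_def; case: z. Qed.

Lemma normcM z1 z2 : normc (z1 * z2) = normc z1 * normc z2.
Proof. exact: ComplexField.Normc.normcM. Qed.

Lemma normc_leD z1 z2 : normc (z1 + z2) <= normc z1 + normc z2.
Proof. by rewrite -lecR rmorphD/= !normcE' ler_normD. Qed.

Lemma normc0 : normc (0 : R[i]) = 0.
Proof. exact: ComplexField.Normc.normc0. Qed.

Lemma normc1 : normc (1 : R[i]) = 1.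
Proof. exact: ComplexField.Normc.normc1. Qed.

Lemma normc_conj z : normc z^* = normc z.
Proof. by case: z => a b /=; rewrite sqrrN. Qed.

Lemma normc_sum (I : Type) (r : seq I) (P : pred I) (F : I -> R[i]) :
  normc (\sum_(i <- r | P i) F i) <= \sum_(i <- r | P i) normc (F i).
Proof.
elim/big_ind2 : _ => // [|x a y b xa yb]; first by rewrite normc0.
by apply: le_trans (normc_leD _ _) _; apply: lerD.
Qed.

Lemma normc_prod (I : Type) (r : seq I) (P : pred I) (F : I -> R[i]) :
  normc (\prod_(i <- r | P i) F i) = \prod_(i <- r | P i) normc (F i).
Proof.
by elim/big_rec2 : _ => // [|i x y _ <-]; rewrite ?normc1 ?normcM.
Qed.

Lemma normc_real (x : R) : normc x%:C = `|x|.
Proof. by rewrite /= expr0n/= addr0 sqrtr_sqr. Qed.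

Lemma normc_sqr z : normc z ^+ 2 = complex.Re z ^+ 2 + complex.Im z ^+ 2.
Proof. by case: z => a b /=; rewrite sqr_sqrtr// addr_ge0 ?sqr_ge0. Qed.

Lemma mulc_conj z : z * z^* = (normc z ^+ 2)%:C.
Proof. by rewrite normc_sqr; case: z => a b /=; simpc; congr (_ +i* _); ring. Qed.

Lemma Re_le_normc z : `|complex.Re z| <= normc z.
Proof.
rewrite -(@ler_pXn2r _ 2) ?nnegrE ?normc_ge0// normc_sqr real_normK ?num_real//.
by rewrite lerDl sqr_ge0.
Qed.

Lemma Im_le_normc z : `|complex.Im z| <= normc z.
Proof.
rewrite -(@ler_pXn2r _ 2) ?nnegrE ?normc_ge0// normc_sqr real_normK ?num_real//.
by rewrite lerDr sqr_ge0.
Qed.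

Lemma normc_le_ReIm z : normc z <= `|complex.Re z| + `|complex.Im z|.
Proof.
rewrite -(@ler_pXn2r _ 2) ?nnegrE ?normc_ge0 ?addr_ge0// normc_sqr sqrrD.
rewrite !real_normK ?num_real// -addrA lerD2l lerDr.
by rewrite mulrn_wge0// mulr_ge0.
Qed.

End Normc.

(** Lagrange identity. *)
Lemma cauchy_schwarz (R : realFieldType) (I : finType) (a b : I -> R) :
  (\sum_i a i * b i) ^+ 2 <= (\sum_i a i ^+ 2) * (\sum_i b i ^+ 2).
Proof.
have e : (\sum_i a i ^+ 2) * (\sum_i b i ^+ 2) + (\sum_i a i ^+ 2) * (\sum_i b i ^+ 2)
    - ((\sum_i a i * b i) ^+ 2 + (\sum_i a i * b i) ^+ 2) =
    \sum_i \sum_j (a i * b j - a j * b i) ^+ 2.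
  rewrite {1}[(\sum_i a i ^+ 2) * _]mulrC expr2 !big_distrlr/= -!big_split/= -sumrN -big_split/=.
  apply: eq_bigr => i _; rewrite -!big_split/= -sumrN -big_split/=; apply: eq_bigr => j _.
  by ring.
have : 0 <= \sum_i \sum_j (a i * b j - a j * b i) ^+ 2.
  by apply: sumr_ge0 => i _; apply: sumr_ge0 => j _; exact: sqr_ge0.
by rewrite -e subr_ge0; lra.
Qed.

Lemma normc_cauchy_schwarz (R : rcfType) (I : finType) (a b : I -> R[i]) :
  normc (\sum_i a i * b i) ^+ 2 <= (\sum_i normc (a i) ^+ 2) * (\sum_i normc (b i) ^+ 2).
Proof.
apply: le_trans (cauchy_schwarz _ _).
rewrite ler_sqr ?nnegrE ?normc_ge0//; last first.
  by apply: sumr_ge0 => i _; rewrite mulr_ge0 ?normc_ge0.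
apply: le_trans (normc_sum _ _ _) _; apply: ler_sum => i _; by rewrite normcM.
Qed.

Section Contraction.
Variable R : rcfType.

(** The operator norm of [A] is at most [a], for [a >= 0]; squares avoid square roots. *)
Definition contraction N (a : R) (A : 'I_N -> 'I_N -> R[i]) : Prop :=
  forall x : 'I_N -> R[i],
    \sum_i normc (\sum_j A i j * x j) ^+ 2 <= a ^+ 2 * \sum_j normc (x j) ^+ 2.

Lemma contraction_col N a (A : 'I_N -> 'I_N -> R[i]) j : contraction a A ->
  \sum_i normc (A i j) ^+ 2 <= a ^+ 2.
Proof.
move=> /(_ (fun k => (k == j)%:R)).
have -> : \sum_k normc ((k == j)%:R : R[i]) ^+ 2 = 1.
  rewrite (bigD1 j)//= eqxx normc1 expr1n big1 ?addr0// => k /negbTE ->.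
  by rewrite normc0 expr0n.
rewrite mulr1.
apply: le_trans; rewrite le_eqVlt; apply/orP; left; apply/eqP/eq_bigr => i _.
congr (normc _ ^+ 2); rewrite (bigD1 j)//= eqxx mulr1 big1 ?addr0//.
by move=> k /negbTE ->; rewrite mulr0.
Qed.

Lemma contraction_entry N a (A : 'I_N -> 'I_N -> R[i]) i j : contraction a A ->
  normc (A i j) ^+ 2 <= a ^+ 2.
Proof.
move=> /(contraction_col j); apply: le_trans.
by rewrite (bigD1 i)//= lerDl sumr_ge0// => k _; rewrite sqr_ge0.
Qed.

(** Duality: [|A^* x|^2 = <A A^* x, x> <= a |A^* x| |x|]. *)
Lemma contraction_adjoint N a (A : 'I_N -> 'I_N -> R[i]) : 0 <= a -> contraction a A ->
  contraction a (fun i j => (A j i)^*).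
Proof.
move=> a0 cA x.
pose y i := \sum_j (A j i)^* * x j.
pose Y := \sum_i normc (y i) ^+ 2.
pose X := \sum_j normc (x j) ^+ 2.
have Y0 : 0 <= Y by apply: sumr_ge0 => i _; rewrite sqr_ge0.
have X0 : 0 <= X by apply: sumr_ge0 => i _; rewrite sqr_ge0.
rewrite -/(Y) -/(X).
have e : Y%:C = \sum_j (\sum_i A j i * y i) * (x j)^*.
  rewrite /Y rmorph_sum/=.
  under eq_bigr => i _.
    rewrite -mulc_conj {2}/y rmorph_sum/= big_distrr/=. over.
  rewrite exchange_big/=; apply: eq_bigr => j _; rewrite big_distrl/=.
  apply: eq_bigr => i _; rewrite rmorphM/= conjCK; ring.
have : Y ^+ 2 <= a ^+ 2 * Y * X.
  have -> : Y ^+ 2 = normc (Y%:C) ^+ 2 by rewrite normc_real ger0_norm.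
  rewrite e; apply: le_trans (normc_cauchy_schwarz _ _) _.
  under [X in _ * X]eq_bigr do rewrite normc_conj.
  by apply: ler_wpM2r => //; exact: cA.
move: Y0; rewrite le_eqVlt => /orP[/eqP <- _|Yp].
  by rewrite mulr_ge0 ?sqr_ge0.
rewrite expr2 mulrAC; by rewrite ler_pM2r.
Qed.

Lemma contraction_conj N a (A : 'I_N -> 'I_N -> R[i]) :
  contraction a A -> contraction a (fun i j => (A i j)^*).
Proof.
move=> cA x; have := cA (fun j => (x j)^*).
under [X in _ * X]eq_bigr do rewrite normc_conj.
apply: le_trans; rewrite le_eqVlt; apply/orP; left; apply/eqP/eq_bigr => i _.
rewrite -normc_conj rmorph_sum/=; congr (normc _ ^+ 2).
by apply: eq_bigr => j _; rewrite rmorphM/= conjcK.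
Qed.

Lemma contraction_tr N a (A : 'I_N -> 'I_N -> R[i]) : 0 <= a -> contraction a A ->
  contraction a (fun i j => A j i).
Proof.
move=> a0 /(contraction_adjoint a0)/contraction_conj cA x.
have := cA x; under eq_bigr do under eq_bigr do rewrite conjcK.
by [].
Qed.

End Contraction.

(** * Graph sums of contractions *)

Section PartialSum.
Variables (V I : finType).
Implicit Types (U : {set V}) (phi psi : {ffun V -> I}).

Definition agree_off U phi psi : bool := [forall x, (x \notin U) ==> (psi x == phi x)].

Lemma agree_offP U phi psi :
  reflect (forall x, x \notin U -> psi x = phi x) (agree_off U phi psi).
Proof.
apply: (iffP forallP) => [h x xU|h x]; first by apply/eqP; have /implyP := h x; apply.
by apply/implyP => /h ->.
Qed.

Definition psum (M : nmodType) U (f : {ffun V -> I} -> M) phi : M :=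
  \sum_(psi | agree_off U phi psi) f psi.

Definition update phi (v : V) (i : I) : {ffun V -> I} :=
  [ffun x => if x == v then i else phi x].

Lemma psum0 (M : nmodType) (f : {ffun V -> I} -> M) phi : psum finset.set0 f phi = f phi.
Proof.
rewrite /psum (big_pred1 phi)// => psi; apply/agree_offP/eqP => [h|-> //].
by apply/ffunP => x; apply: h; rewrite inE.
Qed.

Lemma psumT (M : nmodType) (f : {ffun V -> I} -> M) phi :
  psum [set: V] f phi = \sum_psi f psi.
Proof.
by apply: eq_bigl => psi; apply/agree_offP => x; rewrite inE.
Qed.

Lemma psum1 (M : nmodType) v (f : {ffun V -> I} -> M) phi :
  psum [set v] f phi = \sum_i f (update phi v i).
Proof.
rewrite /psum (reindex_onto (update phi v) (fun psi => psi v)); last first.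
  move=> psi /agree_offP h; apply/ffunP => x; rewrite ffunE.
  by case: eqP => [->//|/eqP xv]; rewrite h// inE.
apply: eq_bigl => i; rewrite ffunE !eqxx andbT; apply/agree_offP => x.
by rewrite inE ffunE => /negbTE ->.
Qed.

Lemma psumU (M : nmodType) U1 U2 (f : {ffun V -> I} -> M) phi : [disjoint U1 & U2] ->
  psum (U1 :|: U2) f phi = psum U1 (psum U2 f) phi.
Proof.
move=> dis; rewrite /psum [RHS](exchange_big_dep (agree_off (U1 :|: U2) phi))/=.
  apply: eq_bigr => psi /agree_offP h.
  rewrite (big_pred1 [ffun x => if x \in U1 then psi x else phi x])// => psi1.
  apply/andP/eqP => [[/agree_offP h1 /agree_offP h2]|->].
    apply/ffunP => x; rewrite ffunE; case: ifPn => xU; last exact: h1.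
    by rewrite h2// (disjointFr dis).
  split; apply/agree_offP => x xU; rewrite ffunE ?(negbTE xU)//.
  by case: ifPn => // xU1; rewrite h// inE negb_or xU1.
move=> psi1 psi /agree_offP h1 /agree_offP h2; apply/agree_offP => x.
by rewrite inE negb_or => /andP[a b]; rewrite h2// h1.
Qed.

Lemma eq_psum (M : nmodType) U (f g : {ffun V -> I} -> M) phi :
  f =1 g -> psum U f phi = psum U g phi.
Proof. by move=> fg; apply: eq_bigr. Qed.

Lemma psum_mulr (M : pzRingType) U (f g : {ffun V -> I} -> M) phi :
  (forall psi, agree_off U phi psi -> g psi = g phi) ->
  psum U (fun psi => f psi * g psi) phi = psum U f phi * g phi.
Proof. by move=> h; rewrite /psum big_distrl/=; apply: eq_bigr => psi /h ->. Qed.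

Lemma le_psum (R : numDomainType) U (f g : {ffun V -> I} -> R) phi :
  (forall psi, f psi <= g psi) -> psum U f phi <= psum U g phi.
Proof. by move=> fg; apply: ler_sum. Qed.

Lemma psum_scale (M : pzRingType) U a (f : {ffun V -> I} -> M) phi :
  psum U (fun psi => a * f psi) phi = a * psum U f phi.
Proof. by rewrite /psum big_distrr. Qed.

End PartialSum.

Section LocalStep.
Variables (R : rcfType) (N : nat) (V : finType) (al : R).
Implicit Types (phi psi : {ffun V -> 'I_N}) (f : {ffun V -> 'I_N} -> R[i])
  (M : 'I_N -> 'I_N -> R[i]).

(** A loop has a single index, hence a set and not a pair. *)
Definition ends (u w : V) (p : pred V) : {set V} := [set x in [set u; w] | p x].

Lemma ends_loop u p : ends u u p = if p u then [set u] else finset.set0.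
Proof.
apply/setP => x; rewrite !inE orbb; case: eqP => [->|/eqP xu]; case: ifP => h;
  rewrite !inE ?eqxx//=; by rewrite ?(negbTE xu).
Qed.

Lemma endsC u w p : ends u w p = ends w u p.
Proof. by apply/setP => x; rewrite !inE orbC. Qed.

Lemma ends_split u w p : u != w ->
  ends u w p = ends u u p :|: ends w w p /\ [disjoint ends u u p & ends w w p].
Proof.
move=> uw; split; first by apply/setP => x; rewrite !inE !orbb andb_orl.
rewrite -finset.setI_eq0; apply/eqP/setP => x; rewrite !inE !orbb.
by case: eqP => // ->; rewrite (negbTE uw) andbF.
Qed.

Definition blind f (v : V) : Prop := forall phi i, f (update phi v i) = f phi.

Lemma update_other phi v i x : x != v -> update phi v i x = phi x.
Proof. by move=> xv; rewrite ffunE (negbTE xv). Qed.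
Lemma update_same phi v i : update phi v i v = i.
Proof. by rewrite ffunE eqxx. Qed.

Lemma update_update phi v w i j : v != w ->
  update (update phi v i) w j = update (update phi w j) v i.
Proof.
move=> vw; apply/ffunP => x; rewrite !ffunE; case: eqP => [->|//].
by rewrite eq_sym (negbTE vw).
Qed.

(** The index of [u] is kept, and [M] acts by multiplication by one of its
    entries, row or columns. *)
Lemma local_step_stay M f (o a : pred V) u w phi :
  contraction al M -> o u -> a u -> o w || a w ->
  (~~ o w -> blind f w) ->
  psum (ends u w a) (fun psi =>
     normc (psum (ends u w (predC a)) (fun psi => f psi * M (psi w) (psi u)) psi) ^+ 2) phi
  <= al ^+ 2 * psum (ends u w o) (fun psi => normc (f psi) ^+ 2) phi.
Proof.
move=> cM ou au oaw fw.
have sq b c d : c <= b -> d ^+ 2 * c <= d ^+ 2 * b :> R by move=> cb; rewrite ler_wpM2l ?sqr_ge0.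
have entry psi : normc (f psi * M (psi w) (psi u)) ^+ 2 <= al ^+ 2 * normc (f psi) ^+ 2.
  rewrite normcM exprMn [leRHS]mulrC ler_wpM2l ?sqr_ge0//; exact: contraction_entry.
rewrite -psum_scale.
have [uw|uw] := eqVneq u w.
  subst w; rewrite !ends_loop au/= au ou/=.
  by apply: le_psum => psi; rewrite psum0.
have [-> dis_a] := ends_split a uw; have [-> _] := ends_split (predC a) uw.
have [-> dis_o] := ends_split o uw.
rewrite !psumU// !(ends_loop u) /= au ou/= finset.set0U; apply: le_psum => psi.
rewrite !ends_loop/=.
case: (boolP (a w)) (boolP (o w)) oaw => [aw|aw] [ow|ow] //= _.
- by apply: le_psum => psi1; rewrite psum0.
- rewrite psum0 psum1.
  under eq_bigr do rewrite psum0 fw// update_same update_other// normcM exprMn.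
  rewrite -big_distrr/= [leRHS]mulrC ler_wpM2l ?sqr_ge0//; exact: contraction_col.
- rewrite psum0 !psum1 -big_distrr/= [leRHS]mulrC.
  apply: le_trans (normc_cauchy_schwarz _ _) _.
  apply: ler_wpM2l; first by apply: sumr_ge0 => i _; rewrite sqr_ge0.
  by under eq_bigr do rewrite update_same update_other//; exact: contraction_col.
Qed.

(** The index of [u] is summed out and the index of [w] appears: this is the
    action of the operator [M] itself. *)
Lemma local_step_pass M f (o a : pred V) u w phi :
  contraction al M -> u != w -> o u -> ~~ a u -> ~~ o w -> a w -> blind f w ->
  psum (ends u w a) (fun psi =>
     normc (psum (ends u w (predC a)) (fun psi => f psi * M (psi w) (psi u)) psi) ^+ 2) phi
  <= al ^+ 2 * psum (ends u w o) (fun psi => normc (f psi) ^+ 2) phi.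
Proof.
move=> cM uw ou au ow aw fw.
have [-> _] := ends_split a uw; have [-> _] := ends_split (predC a) uw.
have [-> _] := ends_split o uw.
rewrite !ends_loop/= (negbTE au) ou (negbTE ow) aw/= finset.set0U !finset.setU0 !psum1.
apply: le_trans (cM (fun i => f (update phi u i))).
apply: ler_sum => j _; rewrite psum1 ler_sqr ?nnegrE ?normc_ge0//.
rewrite le_eqVlt; apply/orP; left; apply/eqP; congr normc; apply: eq_bigr => i _.
rewrite update_same update_other 1?eq_sym// update_same mulrC update_update 1?eq_sym//.
by rewrite fw.
Qed.

(** One edge acts on functions of the open indices, [o] before the edge and [a] after
    it, as an operator of norm at most [al] for the Euclidean norms. *)
Lemma local_step M f (o a : pred V) u w phi :
  contraction al M -> contraction al (fun i j => M j i) ->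
  o u || o w -> a u || a w -> o u || a u -> o w || a w ->
  (forall x, x \in [set u; w] -> ~~ o x -> blind f x) ->
  psum (ends u w a) (fun psi =>
     normc (psum (ends u w (predC a)) (fun psi => f psi * M (psi w) (psi u)) psi) ^+ 2) phi
  <= al ^+ 2 * psum (ends u w o) (fun psi => normc (f psi) ^+ 2) phi.
Proof.
move=> cM cM' oo aa oau oaw fb.
have fu := fb u; have fw := fb w; rewrite !inE !eqxx/= ?orbT in fu fw.
have [/andP[ou au]|nu] := boolP (o u && a u).
  by apply: local_step_stay => //; apply: fw.
have [/andP[ow aw]|nw] := boolP (o w && a w).
  rewrite ![ends u w _]endsC.
  by apply: (local_step_stay (M := fun i j => M j i)) => //; apply: fu.
have uw : u != w by apply: contraNneq nu => uw; move: oo aa; rewrite uw !orbb => -> ->.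
have [ou|ou] := boolP (o u).
  rewrite ou/= in nu; rewrite (negbTE nu)/= in aa; rewrite aa andbT in nw.
  by apply: local_step_pass => //; apply: fw.
rewrite (negbTE ou)/= in oo oau; rewrite oo/= in nw.
rewrite ![ends u w _]endsC.
apply: (local_step_pass (M := fun i j => M j i)) => //; first by rewrite eq_sym.
exact: fu.
Qed.

End LocalStep.

Section RootedBound.
Variables (R : rcfType) (N : nat) (G : multigraph) (r : vertex G) (i0 : 'I_N).
Variables (A : edge G -> 'I_N -> 'I_N -> R[i]) (al : edge G -> R).
Hypothesis al0 : forall e, 0 <= al e.
Hypothesis A_contr : forall e, contraction (al e) (A e).
Implicit Types (phi psi : {ffun vertex G -> 'I_N}).

Let value e phi := A e (phi (target e)) (phi (source e)).

(** The open indices between [pre] and [s]. *)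
Definition live (pre s : seq (edge G)) : {set vertex G} :=
  [set x | touched r pre x && touched r s x].

(** The edges are applied one after the other as operators.  When all of them
    have been used, only the index of the root is left. *)
Lemma orderly_bound s pre (f : {ffun vertex G -> 'I_N} -> R[i]) phi :
  orderly r pre s [::] ->
  (forall x, x \notin live pre s -> blind f x) ->
  (forall psi, psi r != i0 -> f psi = 0) ->
  normc (psum [set x | touched r s x] (fun psi => f psi * \prod_(e <- s) value e psi) phi) ^+ 2
  <= (\prod_(e <- s) al e) ^+ 2 * psum (live pre s) (fun psi => normc (f psi) ^+ 2) phi.
Proof.
elim: s pre f => [|e s ih] pre f os fb fr.
  have -> : live pre [::] = [set r].
    by apply/setP => x; rewrite !inE /touched/= orbF; case: (x == r); rewrite ?andbF.
  have -> : [set x | touched r [::] x] = [set r].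
    by apply/setP => x; rewrite !inE /touched/= orbF.
  rewrite big_nil expr1n mul1r !psum1.
  rewrite (bigD1 i0)//= [X in _ + X]big1 ?addr0; last first.
    by move=> i ii0; rewrite fr ?mul0r// update_same.
  rewrite big_nil mulr1 [leRHS](bigD1 i0)//= lerDl.
  by apply: sumr_ge0 => i _; rewrite sqr_ge0.
have [oe os'] : in_order r pre e s /\ orderly r (rcons pre e) s [::].
  by move: os => /= /andP[]; rewrite cats0.
pose u := source e; pose w := target e.
pose o := touched r pre; pose a := touched r s.
(* The ends of e that no later edge touches: they are summed out now. *)
pose Fi := ends u w (predC a).
have tcons x : touched r (e :: s) x = (x \in [set u; w]) || a x.
  rewrite !inE /a /touched /= /touches [source e == x]eq_sym [target e == x]eq_sym.
  by case: (x == r); case: (x == source e); case: (x == target e); rewrite ?orbT.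
have trcons x : touched r (rcons pre e) x = (x \in [set u; w]) || o x.
  rewrite !inE /o /touched has_rcons /= /touches [source e == x]eq_sym [target e == x]eq_sym.
  by case: (x == r); case: (x == source e); case: (x == target e); rewrite ?orbT.
pose f' := psum Fi (fun psi => f psi * value e psi).
have FiE x : (x \in Fi) = (x \in [set u; w]) && ~~ a x by rewrite inE.
have UE : [set x | touched r (e :: s) x] = [set x | touched r s x] :|: Fi.
  apply/setP => x; rewrite finset.in_setU FiE inE tcons inE -/(a x).
  by case: (a x); rewrite ?orbT ?andbT ?orbF ?andbF.
have disF : [disjoint [set x | touched r s x] & Fi].
  rewrite -finset.setI_eq0; apply/eqP/setP => x; rewrite finset.in_setI FiE inE -/(a x).
  by case: (a x); rewrite ?andbF ?inE.
have -> : psum [set x | touched r (e :: s) x]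
   (fun psi => f psi * \prod_(e <- e :: s) value e psi) phi =
   psum [set x | touched r s x] (fun psi => f' psi * \prod_(e <- s) value e psi) phi.
  rewrite UE psumU//; apply: eq_psum => psi.
  rewrite /f' -(@psum_mulr _ _ _ Fi _ (fun psi => \prod_(e <- s) value e psi)).
    by apply: eq_psum => psi1; rewrite big_cons mulrA.
  move=> psi1 /agree_offP ag; apply: eq_big_seq => e1 e1s; rewrite /value.
  have ae x : touches x e1 -> x \notin Fi.
    by move=> xe; rewrite FiE negb_and negbK orbC /a (touches_touched _ e1s).
  by rewrite !ag ?ae// /touches eqxx ?orbT.
pose B0 := live pre (e :: s) :\: [set u; w].
have L1 x : (x \in live (rcons pre e) s) = ((x \in [set u; w]) || o x) && a x.
  by rewrite inE trcons.
have L2 x : (x \in live pre (e :: s)) = o x && ((x \in [set u; w]) || a x).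
  by rewrite inE tcons.
have B0E x : (x \in B0) = (x \notin [set u; w]) && (x \in live pre (e :: s)).
  by rewrite finset.in_setD.
have EE p x : (x \in ends u w p) = (x \in [set u; w]) && p x by rewrite inE.
have B'E : live (rcons pre e) s = B0 :|: ends u w a.
  apply/setP => x; rewrite finset.in_setU B0E L1 L2 EE.
  by case: (x \in [set u; w]); case: (o x); case: (a x).
have BE : live pre (e :: s) = B0 :|: ends u w o.
  apply/setP => x; rewrite finset.in_setU B0E L2 EE.
  by case: (x \in [set u; w]); case: (o x); case: (a x).
have dis0 p : [disjoint B0 & ends u w p].
  rewrite -finset.setI_eq0; apply/eqP/setP => x; rewrite finset.in_setI B0E EE finset.in_set0.
  by case: (x \in [set u; w]); rewrite ?andbF.
have step : psum (live (rcons pre e) s) (fun psi => normc (f' psi) ^+ 2) phi <=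
    al e ^+ 2 * psum (live pre (e :: s)) (fun psi => normc (f psi) ^+ 2) phi.
  rewrite B'E BE !psumU// -psum_scale; apply: le_psum => psi.
  case/and4P: oe => h1 h2 h3 h4.
  apply: local_step => //; first exact: contraction_tr.
  by move=> x _ ox; apply: fb; rewrite L2 (negbTE ox).
have fb' x : x \notin live (rcons pre e) s -> blind f' x.
  move=> xl psi i; rewrite /f'.
  have [xF|xF] := boolP (x \in Fi).
    rewrite /psum; apply: eq_bigl => psi1; apply/agree_offP/agree_offP => h y yF.
      by rewrite h// update_other//; apply: contraNneq yF => ->.
    by rewrite h// update_other//; apply: contraNneq yF => ->.
  have fx : blind f x.
    apply: fb; move: xl xF; rewrite L1 L2 FiE.
    by case: (x \in [set u; w]); case: (o x); case: (a x).
  have xuw : x \notin [set u; w].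
    move: xl xF; rewrite L1 FiE.
    by case: (x \in [set u; w]); case: (a x).
  rewrite /psum (reindex_onto (fun psi1 => update psi1 x i) (fun psi1 => update psi1 x (psi x))).
    apply: eq_big => [psi1|psi1 _].
      apply/andP/agree_offP => [[/agree_offP h /eqP e1] y yF|h].
        have [->|yx] := eqVneq y x; first by rewrite -e1 update_same.
        by have := h y yF; rewrite !update_other.
      split.
        apply/agree_offP => y yF; have [->|yx] := eqVneq y x; first by rewrite !update_same.
        by rewrite !update_other// h.
      apply/eqP/ffunP => y; rewrite ffunE; case: eqP => [->|/eqP yx]; last by rewrite update_other.
      by rewrite h.
    move: xuw; rewrite !inE negb_or => /andP[xu xw].
    by rewrite fx /value !update_other// eq_sym.
  move=> psi1 /agree_offP h; apply/ffunP => y; rewrite ffunE.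
  case: eqP => [->|/eqP yx]; last by rewrite update_other.
  by rewrite h// update_same.
have fr' psi : psi r != i0 -> f' psi = 0.
  move=> ri; rewrite /f' /psum big1// => psi1 /agree_offP h.
  rewrite fr ?mul0r// h// inE negb_and; apply/orP; right.
  by rewrite /= negbK /a /touched eqxx.
apply: le_trans (ih _ _ os' fb' fr') _.
apply: le_trans (ler_wpM2l (sqr_ge0 _) step) _.
by rewrite big_cons exprMn mulrA [in leRHS]mulrC [X in X * _ <= _]mulrC [in leRHS]mulrC.
Qed.

Hypothesis Gconn : forall x, connect (adjacent [set: edge G]) r x.
Hypothesis Gbridge : forall e,
  connect (adjacent ([set: edge G] :\ e)) (source e) (target e).

(** The Mingo-Speicher bound for a graph without bridges: an orderly enumeration
    writes the sum as a matrix coefficient of a product of operators. *)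
Lemma rooted_graph_bound :
  normc (\sum_(phi : {ffun vertex G -> 'I_N} | phi r == i0) \prod_e value e phi)
  <= \prod_e al e.
Proof.
have [s [us sall os]] := orderly_exists Gconn Gbridge.
have sE (M : comPzRingType) (F : edge G -> M) : \prod_e F e = \prod_(e <- s) F e.
  rewrite -[LHS]big_enum; apply: perm_big; apply: uniq_perm => //; first exact: enum_uniq.
  by move=> e; rewrite sall mem_enum.
pose phi0 : {ffun vertex G -> 'I_N} := [ffun=> i0].
have tall x : touched r s x.
  have [xr|xr] := eqVneq x r; first by rewrite /touched xr eqxx.
  have /connectP[p] := Gconn x; case/lastP: p => [_ /eqP|p y]; first by rewrite (negbTE xr).
  rewrite rcons_path last_rcons => /andP[_ ly] ->.
  case/adjacentP: ly => e _ E; apply: (touches_touched _ (sall e)).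
  by case: E => [[_ <-]|[<- _]]; rewrite /touches eqxx ?orbT.
have livE : live [::] s = [set r].
  by apply/setP => x; rewrite !inE tall andbT /touched /= orbF.
have := @orderly_bound s [::] (fun phi => (phi r == i0)%:R) phi0 os.
have -> : [set x | touched r s x] = [set: vertex G] by apply/setP => x; rewrite !inE tall.
rewrite livE psumT psum1.
have -> : \sum_i normc ((update phi0 r i r == i0)%:R : R[i]) ^+ 2 = 1.
  rewrite (bigD1 i0)//= update_same eqxx normc1 expr1n big1 ?addr0// => i /negbTE ii.
  by rewrite update_same ii normc0 expr0n.
rewrite mulr1.
rewrite sE ler_pXn2r ?nnegrE ?normc_ge0//; last by apply: prodr_ge0.
move=> h; rewrite big_mkcond/=; under eq_bigr => phi _.
  rewrite sE. have -> : (if phi r == i0 then \prod_(e <- s) value e phi else 0) =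
   (phi r == i0)%:R * \prod_(e <- s) value e phi by case: ifP; rewrite ?mul1r ?mul0r.
  over.
apply: h.
  move=> x; rewrite inE => xr phi i; by rewrite update_other// eq_sym.
by move=> psi /negbTE ->.
Qed.

End RootedBound.

Section Cone.
Variables (G : multigraph) (S : {set edge G}) (w : vertex G -> nat).
Hypothesis Sw : cover S w.

(** The cone over the vertices is connected and without bridges, and the multiplicities [w]
    measure its cost. *)
Definition cone : multigraph :=
  @Multigraph (option (vertex G)) ({e in S} + {x : vertex G & 'I_(w x)})%type
    (fun e => match e with inl e => Some (source (val e)) | inr _ => None end)
    (fun e => match e with inl e => Some (target (val e)) | inr t => Some (tag t) end).

Let apex (x : vertex G) (j : 'I_(w x)) : edge cone := inr (Tagged (fun x => 'I_(w x)) j).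

Lemma cone_connect (D : {set edge G}) (D' : {set edge cone}) x y :
  (forall e : {e in S}, val e \notin D -> (inl e : edge cone) \in D') ->
  connect (adjacent (S :\: D)) x y ->
  connect (adjacent D') (Some x : vertex cone) (Some y).
Proof.
move=> DD; apply: connect_homo => {}x {}y /adjacentP[e]; rewrite finset.in_setD => /andP[eD eS] xy.
apply: connect1; apply/adjacentP; exists (inl (exist (fun e => e \in S) e eS)); first exact: DD.
by case: xy => [[<- <-]|[<- <-]]; [left|right].
Qed.

Lemma cone_apex (D' : {set edge cone}) x (j : 'I_(w x)) : apex j \in D' ->
  connect (adjacent D') (None : vertex cone) (Some x).
Proof. by move=> jD; apply: connect1; apply/adjacentP; exists (apex j) => //; left. Qed.

Lemma cone_connected x : connect (adjacent [set: edge cone]) (None : vertex cone) x.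
Proof.
case: x => [x|]; last exact: connect0.
have [_ /(_ x) w2] := Sw.
have [y xy wy] : exists2 y, connect (adjacent S) x y & (0 < w y)%N.
  apply: contrapT => no; move: w2; rewrite big1// => y xy.
  by apply/eqP; rewrite -leqn0 leqNgt; apply/negP => wy; apply: no; exists y.
apply: (@connect_trans _ _ (Some y)).
  by apply: (@cone_apex _ _ (Ordinal wy)); rewrite inE.
rewrite (@adjacent_csym cone); apply: (@cone_connect finset.set0); last by rewrite finset.setD0.
by move=> e _; rewrite inE.
Qed.

(** Every part cut off by an edge of [S] has positive weight and is joined to the
    cone point.  An edge from the cone point to [x] can be bypassed through
    the component of [x], whose weight is at least 2. *)
Lemma cone_bridgeless e :
  connect (adjacent ([set: edge cone] :\ e)) (source e) (target e).
Proof.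
have [w1 w2] := Sw.
case: e => [e|[x j]].
  have con x : connect (adjacent ([set: edge cone] :\ inl e)) None (Some x : vertex cone).
    have [y xy wy] := w1 (val e) x.
    apply: (@connect_trans _ _ (Some y)).
      by apply: (@cone_apex _ _ (Ordinal wy)); rewrite !inE.
    rewrite (@adjacent_csym cone); apply: (cone_connect _ xy).
    by move=> e'; rewrite !inE andbT; apply: contra => /eqP[->].
  apply: (@connect_trans _ _ None); last exact: con.
  by rewrite (@adjacent_csym cone); exact: con.
have inS (e' : {e in S}) : (inl e' : edge cone) \in [set: edge cone] :\ inr (Tagged (fun x => 'I_(w x)) j).
  by rewrite !inE.
have [k jk|noj] := pickP (fun k : 'I_(w x) => k != j).
  apply: (@cone_apex _ _ k); rewrite !inE andbT.
  by rewrite (inj_eq (@inr_inj _ _)) eq_Tagged.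
have wx : w x = 1%N.
  have k1 : (0 < w x)%N := leq_ltn_trans (leq0n _) (ltn_ord j).
  apply/eqP; rewrite eqn_leq k1 andbT leqNgt; apply/negP => k2.
  have /negbFE/eqP e1 := noj (Ordinal k1); have /negbFE/eqP e2 := noj (Ordinal k2).
  by have := congr1 val (etrans e1 (esym e2)).
have [y /andP[xy yx] wy] : exists2 y, connect (adjacent S) x y && (y != x) & (0 < w y)%N.
  apply: contrapT => no; have := w2 x; rewrite (bigD1 x) ?connect0//= wx big1// => y xy.
  by apply/eqP; rewrite -leqn0 leqNgt; apply/negP => wy; apply: no; exists y.
apply: (@connect_trans _ _ (Some y)).
  apply: (@cone_apex _ _ (Ordinal wy)); rewrite !inE andbT; apply: contra yx.
  by rewrite (inj_eq (@inr_inj _ _)) => /eqP/(congr1 tag)/= ->.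
rewrite (@adjacent_csym cone); apply: (@cone_connect finset.set0); last by rewrite finset.setD0.
by move=> e' _; exact: inS.
Qed.

End Cone.

(** The cone edges carry the matrix with ones in the column [i0], of norm
    [sqrt N]: when the cone point is sent to [i0] they contribute factors 1, and the
    sum over the cone is the original one. *)
Lemma graph_sum_bound (R : rcfType) (N : nat) (J : Type) (G : multigraph)
    (S : {set edge G}) (w : vertex G -> nat) (A : J -> 'I_N -> 'I_N -> R[i]) lab
    (al : edge G -> R) :
  (0 < N)%N -> cover S w -> (forall e, 0 <= al e) ->
  (forall e, e \in S -> contraction (al e) (A (lab e))) ->
  normc (graph_sum S A lab) <= (\prod_(e in S) al e) * Num.sqrt N%:R ^+ (\sum_x w x).
Proof.
move=> N0 Sw al0 cA; have i0 : 'I_N := Ordinal N0.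
pose A' (e : edge (cone S w)) : 'I_N -> 'I_N -> R[i] :=
  match e with inl e => A (lab (val e)) | inr _ => fun i j => (j == i0)%:R end.
pose al' (e : edge (cone S w)) : R :=
  match e with inl e => al (val e) | inr _ => Num.sqrt N%:R end.
have al'0 e : 0 <= al' e by case: e => [e|e]; [exact: al0|exact: sqrtr_ge0].
have cA' e : contraction (al' e) (A' e).
  case: e => [e|t] /=; first exact: cA (valP e).
  move=> x; rewrite sqr_sqrtr ?ler0n//.
  under eq_bigr => i _.
    rewrite (bigD1 i0)//= eqxx mul1r big1 ?addr0; last by move=> j /negbTE ->; rewrite mul0r.
    over.
  rewrite sumr_const card_ord -[leLHS]mulr_natl ler_wpM2l ?ler0n//.
  by rewrite [leRHS](bigD1 i0)//= lerDl sumr_ge0// => i _; rewrite sqr_ge0.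
have := rooted_graph_bound i0 al'0 cA' (cone_connected Sw) (cone_bridgeless Sw).
rewrite [X in normc X](_ : _ = graph_sum S A lab).
  move/le_trans; apply; rewrite big_sumType/= -big_sub; rewrite ler_wpM2l ?prodr_ge0//.
  rewrite prodr_const card_tagged sumnE big_map.
  by rewrite big_enum/=; under eq_bigr do rewrite card_ord.
rewrite /graph_sum.
rewrite (reindex_onto (fun phi : {ffun vertex G -> 'I_N} =>
     [ffun x : option (vertex G) => if x is Some y then phi y else i0])
   (fun psi => [ffun y => psi (Some y)])); last first.
  move=> psi /eqP h; apply/ffunP => -[x|]; by rewrite !ffunE.
apply: eq_big => [phi|phi _].
  rewrite ffunE eqxx/=; apply/eqP/ffunP => y; by rewrite !ffunE.
rewrite big_sumType/= [X in _ * X]big1 ?mulr1; last first.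
  by move=> t _; rewrite !ffunE eqxx.
by rewrite [RHS]big_sub; apply: eq_bigr => e _; rewrite !ffunE.
Qed.

(** * Means of bounded random variables and matrices *)

(** An alias, to carry the structures that a sigma-algebra requires. *)
Definition matrix_family (R : realType) (N : nat) (J : Type) := J -> 'M[R[i]]_N.
HB.instance Definition _ R N J := gen_eqMixin (matrix_family R N J).
HB.instance Definition _ R N J := gen_choiceMixin (matrix_family R N J).
HB.instance Definition _ R N J := isPointed.Build (matrix_family R N J) (fun=> 0).

Section Probability.
Local Open Scope classical_set_scope.
Local Open Scope ring_scope.
Local Open Scope complex_scope.

Section RealBounded.
Context (d : measure_display) (T : measurableType d) (R : realType) (P : probability T R).
Implicit Types (X Y Z : T -> R).

Definition essbounded X (c : R) : Prop := {ae P, forall w, `|X w| <= c}.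

Definition bounded_rv X : Prop :=
  measurable_fun [set: T] X /\ exists c, essbounded X c.

Definition rmean X : R := (\int[P]_w X w)%R.

Lemma rmeanE X : rmean X = fine 'E_P[X]%E.
Proof. by rewrite unlock. Qed.

Lemma bounded_rv_integrable X : bounded_rv X -> P.-integrable [set: T] (EFin \o X).
Proof.
move=> [mX [c cX]]; apply/integrableP; split; first exact/measurable_EFinP.
have c0 : 0 <= `|c| by [].
apply: (@le_lt_trans _ _ (\int[P]_w (`|c|)%:E)%E).
  apply: ae_ge0_le_integral => //.
  - by apply/measurableT_comp => //; exact/measurable_EFinP.
  - move: cX; apply: filterS => w cX _ /=; rewrite lee_fin.
    exact: le_trans cX (ler_norm _).
by rewrite integral_cst//= probability_setT mule1 ltry.
Qed.

Lemma bounded_rv_cst c : bounded_rv (fun=> c).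
Proof. by split => //; exists `|c|; apply: aeW => w. Qed.

Lemma bounded_rvD X Y : bounded_rv X -> bounded_rv Y -> bounded_rv (fun w => X w + Y w).
Proof.
move=> [mX [c cX]] [mY [c' cY]]; split; first exact: measurable_funD.
exists (c + c'); move: cX cY; apply: filterS2 => w h h'.
by apply: le_trans (ler_normD _ _) _; exact: lerD.
Qed.

Lemma bounded_rvM X Y : bounded_rv X -> bounded_rv Y -> bounded_rv (fun w => X w * Y w).
Proof.
move=> [mX [c cX]] [mY [c' cY]]; split; first exact: measurable_funM.
exists (c * c'); move: cX cY; apply: filterS2 => w h h'.
by rewrite normrM; exact: ler_pM.
Qed.

Lemma bounded_rvN X : bounded_rv X -> bounded_rv (fun w => - X w).
Proof.
move=> [mX [c cX]]; split; first exact: measurableT_comp.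
by exists c; move: cX; apply: filterS => w; rewrite normrN.
Qed.

Lemma bounded_rv_sum (I : Type) (r : seq I) (Q : pred I) (F : I -> T -> R) :
  (forall i, Q i -> bounded_rv (F i)) -> bounded_rv (fun w => \sum_(i <- r | Q i) F i w).
Proof.
move=> FP; elim: r => [|i r ih].
  by under eq_fun do rewrite big_nil; exact: (bounded_rv_cst 0).
have [Qi|/negbTE Qi] := boolP (Q i); under eq_fun do rewrite big_cons Qi; last exact: ih.
by apply: bounded_rvD => //; exact: FP.
Qed.

Lemma rmean_cst c : rmean (fun=> c) = c.
Proof.
rewrite /rmean Rintegral_cst//; transitivity (c * fine (1%E : \bar R)); last by rewrite mulr1.
by congr (c * fine _); exact: probability_setT.
Qed.

Lemma rmeanD X Y : bounded_rv X -> bounded_rv Y ->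
  rmean (fun w => X w + Y w) = rmean X + rmean Y.
Proof. by move=> /bounded_rv_integrable iX /bounded_rv_integrable iY; exact: RintegralD. Qed.

Lemma rmeanZ c X : bounded_rv X -> rmean (fun w => c * X w) = c * rmean X.
Proof. by move=> /bounded_rv_integrable iX; exact: RintegralZl. Qed.

Lemma rmeanB X Y : bounded_rv X -> bounded_rv Y ->
  rmean (fun w => X w - Y w) = rmean X - rmean Y.
Proof. by move=> /bounded_rv_integrable iX /bounded_rv_integrable iY; exact: RintegralB. Qed.

Lemma rmean_sum (I : Type) (r : seq I) (Q : pred I) (F : I -> T -> R) :
  (forall i, Q i -> bounded_rv (F i)) ->
  rmean (fun w => \sum_(i <- r | Q i) F i w) = \sum_(i <- r | Q i) rmean (F i).
Proof.
move=> FP; elim: r => [|i r ih].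
  by rewrite big_nil; under [X in rmean X]eq_fun do rewrite big_nil; exact: rmean_cst.
rewrite big_cons; have [Qi|/negbTE Qi] := boolP (Q i);
  under [X in rmean X]eq_fun do rewrite big_cons Qi; last exact: ih.
rewrite rmeanD ?ih//; first exact: FP.
exact: bounded_rv_sum.
Qed.

Lemma rmean_bound X c : bounded_rv X -> essbounded X c -> `|rmean X| <= c.
Proof.
move=> bX cX; have iX := bounded_rv_integrable bX.
apply: le_trans (le_normr_Rintegral _ iX) _ => //.
rewrite -lee_fin /Rintegral fineK; last first.
  by apply: integrable_fin_num => //; exact: integrable_norm.
have c0 : 0 <= c.
  have : P.-negligible [set: T] -> False.
    move=> nT; have PT0 : P [set: T] = 0%E by apply/negligibleP.
    have : (1 : \bar R)%E = 0%E := etrans (esym (probability_setT P)) PT0.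
    by move=> /eqP; rewrite onee_eq0.
  move=> nn; rewrite leNgt; apply/negP => cneg; apply: nn.
  move: cX; apply: negligibleS => w _ /= h.
  by have := le_lt_trans h cneg; rewrite normr_lt0.
apply: (@le_trans _ _ (\int[P]_w c%:E)%E); last first.
  by rewrite integral_cst//= probability_setT mule1.
apply: ae_ge0_le_integral => //.
- by apply/measurable_EFinP; apply/measurableT_comp => //; exact: bX.1.
- by move: cX; apply: filterS => w h _ /=; rewrite lee_fin.
Qed.

Lemma bounded_rv_indic (A : set T) : measurable A -> bounded_rv (\1_A : T -> R).
Proof.
move=> mA; split; first exact: measurable_indic.
by exists 1; apply: aeW => w; rewrite indicE; case: (_ \in _); rewrite ?normr1 ?normr0.
Qed.

Lemma rmean_indic (A : set T) : measurable A -> rmean (\1_A : T -> R) = fine (P A).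
Proof. by move=> mA; rewrite /rmean /Rintegral integral_indic// setIT. Qed.

Lemma layer_count (y dl : R) m : 0 < dl -> 0 <= y -> y <= m%:R * dl ->
  `|y - \sum_(k < m) dl * (k.+1%:R * dl <= y)%R%:R| <= dl.
Proof.
move=> dl0 y0; elim: m => [|m ih] ym.
  by rewrite big_ord0 subr0 ger0_norm//; apply: le_trans ym _; rewrite mul0r ltW.
rewrite big_ord_recr/=; have [h1|h1] := leP (m.+1%:R * dl) y.
  have -> : y = m.+1%:R * dl by apply/eqP; rewrite eq_le ym h1.
  rewrite (eq_bigr (fun=> dl)); last first.
    by move=> i _; rewrite ler_pM2r// ler_nat ltnS ltnW ?mulr1.
  rewrite sumr_const card_ord mulr1 -[dl *+ m]mulr_natl -natr1 mulrDl mul1r subrr.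
  by rewrite normr0 ltW.
rewrite mulr0 addr0; have [h2|h2] := leP y (m%:R * dl); first exact: ih.
rewrite (eq_bigr (fun=> dl)); last first.
  move=> i _; rewrite (le_trans _ (ltW h2)) ?mulr1//.
  by rewrite ler_pM2r// ler_nat.
rewrite sumr_const card_ord -[dl *+ m]mulr_natl ger0_norm ?subr_ge0 ?(ltW h2)//.
by rewrite lerBlDr -{1}(mul1r dl) -mulrDl nat1r ltW.
Qed.

(** Independence from the events [a <= X] is enough: [X] is a uniform limit of step
    functions of these events. *)
Lemma rmean_indep Z X : bounded_rv Z -> bounded_rv X ->
  (forall a : R, rmean (fun w => Z w * \1_[set w | a <= X w] w) =
     rmean Z * fine (P [set w | a <= X w])) ->
  rmean (fun w => Z w * X w) = rmean Z * rmean X.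
Proof.
move=> bZ bX ZX; have [mX [c cX]] := bX; have [mZ [z cZ]] := bZ.
have mA a : measurable [set w | a <= X w].
  rewrite [X in measurable X](_ : _ = [set: T] `&` X @^-1` `[a, +oo[).
    by apply: mX => //; exact: measurable_itv.
  by rewrite setTI; apply/seteqP; split => w /=; rewrite in_itv/= andbT.
pose c1 := `|c| + 1; pose z1 := `|z| + 1.
have c10 : 0 < c1 by rewrite ltr_wpDl.
have z10 : 0 < z1 by rewrite ltr_wpDl.
apply/eqP; rewrite -subr_eq0 -normr_le0; apply/ler_addgt0Pr => eps eps0.
rewrite add0r.
pose dl := eps / (2 * z1).
have dl0 : 0 < dl by rewrite divr_gt0// mulr_gt0.
pose m := (Num.truncn (2 * c1 / dl)).+1.
have mdl : 2 * c1 <= m%:R * dl.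
  rewrite -ler_pdivrMr//; apply/ltW/truncnS_gt.
(* A step function of X, with steps of height dl starting at -c1. *)
pose Xd w := \sum_(k < m) dl * \1_[set w | k.+1%:R * dl - c1 <= X w] w - c1.
have bt (k : 'I_m) : bounded_rv (fun w => dl * (\1_[set w | k.+1%:R * dl - c1 <= X w] w : R)).
  by apply: bounded_rvM; [exact: bounded_rv_cst|exact: bounded_rv_indic].
have bXd : bounded_rv Xd.
  by apply: bounded_rvD; [exact: bounded_rv_sum|exact: bounded_rv_cst].
have eXd : rmean (fun w => Z w * Xd w) = rmean Z * rmean Xd.
  have -> : (fun w => Z w * Xd w) = (fun w => \sum_(k < m) dl * (Z w * \1_[set w | k.+1%:R * dl - c1 <= X w] w) - c1 * Z w).
    apply/funext => w; rewrite /Xd mulrBr mulr_sumr [c1 * _]mulrC; congr (_ - _).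
    by apply: eq_bigr => k _; rewrite mulrCA.
  have bt' (k : 'I_m) : bounded_rv (fun w => Z w * \1_[set w | k.+1%:R * dl - c1 <= X w] w).
    by apply: bounded_rvM => //; exact: bounded_rv_indic.
  rewrite rmeanB; last 2 first.
  - by apply: bounded_rv_sum => k _; apply: bounded_rvM => //; exact: bounded_rv_cst.
  - by apply: bounded_rvM => //; exact: bounded_rv_cst.
  rewrite rmean_sum; last by move=> k _; apply: bounded_rvM => //; exact: bounded_rv_cst.
  rewrite /Xd rmeanB//; [|exact: bounded_rv_sum|exact: bounded_rv_cst].
  rewrite rmean_sum// rmean_cst rmeanZ// mulrBr mulr_sumr [c1 * _]mulrC; congr (_ - _).
  apply: eq_bigr => k _; rewrite !rmeanZ ?ZX ?rmean_indic//; first by rewrite mulrCA.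
  exact: bounded_rv_indic.
have close : essbounded (fun w => X w - Xd w) dl.
  move: cX; apply: filterS => w cX.
  have cX1 : `|X w| <= c1 by apply: le_trans cX _; rewrite /c1 (le_trans (ler_norm _))// lerDl.
  have := @layer_count (X w + c1) dl m dl0.
  move: cX1; rewrite ler_norml => /andP[a b].
  rewrite -lerBlDr add0r a => /(_ isT) h.
  have {h}/h : X w + c1 <= m%:R * dl by apply: le_trans mdl; lra.
  move=> h; suff -> : X w - Xd w =
      X w + c1 - \sum_(k < m) dl * (k.+1%:R * dl <= X w + c1)%R%:R by [].
  rewrite /Xd opprB -[RHS]addrA; congr (_ + (_ - _)).
  apply: eq_bigr => k _; congr (_ * _); rewrite -lerBlDr indicE.
  by congr ((_ : bool)%:R); apply/idP/idP; rewrite inE.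
have -> : rmean (fun w => Z w * X w) - rmean Z * rmean X =
    rmean (fun w => Z w * (X w - Xd w)) - rmean Z * rmean (fun w => X w - Xd w).
  rewrite rmeanB// mulrBr -eXd opprB addrA -addrA [X in _ = _ + X]addrC addrA.
  rewrite (_ : (fun w => Z w * (X w - Xd w)) = (fun w => Z w * X w - Z w * Xd w)).
    rewrite rmeanB; [by ring|exact: bounded_rvM|exact: bounded_rvM].
  by apply/funext => w; rewrite mulrBr.
have bD : bounded_rv (fun w => X w - Xd w) by apply: bounded_rvD => //; exact: bounded_rvN.
have zz1 : essbounded Z z1.
  move: cZ; apply: filterS => w h; apply: le_trans h _.
  by rewrite /z1 (le_trans (ler_norm _))// lerDl.
apply: le_trans (ler_normB _ _) _.
have -> : eps = z1 * dl + z1 * dl by rewrite /dl; field; rewrite gt_eqF.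
apply: lerD.
  apply: rmean_bound; first exact: bounded_rvM.
  by move: zz1 close; apply: filterS2 => w h h'; rewrite normrM; exact: ler_pM.
rewrite normrM; apply: ler_pM => //; exact: rmean_bound.
Qed.

End RealBounded.

Section ComplexMeasurable.
Context (d : measure_display) (T : measurableType d) (R : realType).

Definition cmeasurable (X : T -> R[i]) : Prop :=
  measurable_fun [set: T] (fun w => complex.Re (X w)) /\
  measurable_fun [set: T] (fun w => complex.Im (X w)).

Lemma Re_mul (x y : R[i]) :
  complex.Re (x * y) = complex.Re x * complex.Re y - complex.Im x * complex.Im y.
Proof. by case: x; case: y. Qed.
Lemma Im_mul (x y : R[i]) :
  complex.Im (x * y) = complex.Re x * complex.Im y + complex.Im x * complex.Re y.
Proof. by case: x; case: y => a b c e /=; ring. Qed.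
Lemma Re_add (x y : R[i]) : complex.Re (x + y) = complex.Re x + complex.Re y.
Proof. by case: x; case: y. Qed.
Lemma Im_add (x y : R[i]) : complex.Im (x + y) = complex.Im x + complex.Im y.
Proof. by case: x; case: y. Qed.
Lemma Re_conj (x : R[i]) : complex.Re x^*%C = complex.Re x.
Proof. by case: x. Qed.
Lemma Im_conj (x : R[i]) : complex.Im x^*%C = - complex.Im x.
Proof. by case: x. Qed.

Lemma cmeasurable_cst c : cmeasurable (fun=> c).
Proof. by split. Qed.

Lemma cmeasurableM X Y : cmeasurable X -> cmeasurable Y -> cmeasurable (fun w => X w * Y w).
Proof.
move=> [X1 X2] [Y1 Y2]; split.
  under eq_fun do rewrite Re_mul.
  by apply: measurable_funB; apply: measurable_funM.
under eq_fun do rewrite Im_mul.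
by apply: measurable_funD; apply: measurable_funM.
Qed.

Lemma cmeasurable_conj X : cmeasurable X -> cmeasurable (fun w => (X w)^*%C).
Proof.
move=> [X1 X2]; split; first by under eq_fun do rewrite Re_conj.
by under eq_fun do rewrite Im_conj; exact: measurableT_comp.
Qed.

Lemma cmeasurable_prod (I : Type) (r : seq I) (Q : pred I) (F : I -> T -> R[i]) :
  (forall i, Q i -> cmeasurable (F i)) -> cmeasurable (fun w => \prod_(i <- r | Q i) F i w).
Proof.
move=> FP; elim: r => [|i r ih].
  by under eq_fun do rewrite big_nil; exact: cmeasurable_cst.
have [Qi|/negbTE Qi] := boolP (Q i); under eq_fun do rewrite big_cons Qi; last exact: ih.
by apply: cmeasurableM => //; exact: FP.
Qed.

End ComplexMeasurable.

Section ComplexBounded.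
Context (d : measure_display) (T : measurableType d) (R : realType) (P : probability T R).
Implicit Types (X Y Z : T -> R[i]).

Definition cessbounded X (c : R) : Prop := {ae P, forall w, normc (X w) <= c}.

Definition bounded_crv X : Prop := cmeasurable X /\ exists c, cessbounded X c.

Lemma bounded_crv_Re X : bounded_crv X -> bounded_rv P (fun w => complex.Re (X w)).
Proof.
move=> [[m1 m2] [c cX]]; split => //; exists c; move: cX; apply: filterS => w.
exact/le_trans/Re_le_normc.
Qed.

Lemma bounded_crv_Im X : bounded_crv X -> bounded_rv P (fun w => complex.Im (X w)).
Proof.
move=> [[m1 m2] [c cX]]; split => //; exists c; move: cX; apply: filterS => w.
exact/le_trans/Im_le_normc.
Qed.

Lemma bounded_crvP X : bounded_rv P (fun w => complex.Re (X w)) ->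
  bounded_rv P (fun w => complex.Im (X w)) -> bounded_crv X.
Proof.
move=> [m1 [c1 h1]] [m2 [c2 h2]]; split; first by split.
exists (c1 + c2); move: h1 h2; apply: filterS2 => w a b.
by apply: le_trans (normc_le_ReIm _) _; exact: lerD.
Qed.

Lemma bounded_crv_cst c : bounded_crv (fun=> c).
Proof. by split; [exact: cmeasurable_cst|exists (normc c); exact: aeW]. Qed.

Lemma bounded_crvD X Y : bounded_crv X -> bounded_crv Y -> bounded_crv (fun w => X w + Y w).
Proof.
move=> bX bY; apply: bounded_crvP.
  under eq_fun do rewrite Re_add; exact: bounded_rvD (bounded_crv_Re bX) (bounded_crv_Re bY).
under eq_fun do rewrite Im_add; exact: bounded_rvD (bounded_crv_Im bX) (bounded_crv_Im bY).
Qed.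

Lemma bounded_crvM X Y : bounded_crv X -> bounded_crv Y -> bounded_crv (fun w => X w * Y w).
Proof.
move=> [mX [c cX]] [mY [c' cY]]; split; first exact: cmeasurableM.
exists (c * c'); move: cX cY; apply: filterS2 => w a b.
by rewrite normcM; apply: ler_pM => //; exact: normc_ge0.
Qed.

Lemma bounded_crv_conj X : bounded_crv X -> bounded_crv (fun w => (X w)^*%C).
Proof.
move=> [mX [c cX]]; split; first exact: cmeasurable_conj.
by exists c; move: cX; apply: filterS => w; rewrite normc_conj.
Qed.

Lemma bounded_crv_sum (I : Type) (r : seq I) (Q : pred I) (F : I -> T -> R[i]) :
  (forall i, Q i -> bounded_crv (F i)) -> bounded_crv (fun w => \sum_(i <- r | Q i) F i w).
Proof.
move=> FP; elim: r => [|i r ih].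
  by under eq_fun do rewrite big_nil; exact: bounded_crv_cst.
have [Qi|/negbTE Qi] := boolP (Q i); under eq_fun do rewrite big_cons Qi; last exact: ih.
by apply: bounded_crvD => //; exact: FP.
Qed.

Lemma bounded_crv_prod (I : Type) (r : seq I) (Q : pred I) (F : I -> T -> R[i]) :
  (forall i, Q i -> bounded_crv (F i)) -> bounded_crv (fun w => \prod_(i <- r | Q i) F i w).
Proof.
move=> FP; elim: r => [|i r ih].
  by under eq_fun do rewrite big_nil; exact: bounded_crv_cst.
have [Qi|/negbTE Qi] := boolP (Q i); under eq_fun do rewrite big_cons Qi; last exact: ih.
by apply: bounded_crvM => //; exact: FP.
Qed.

Definition cmean X : R[i] :=
  rmean P (fun w => complex.Re (X w)) +i* rmean P (fun w => complex.Im (X w)).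

Lemma cexpectationE X : cexpectation P X = cmean X.
Proof. by rewrite /cexpectation /cmean !rmeanE. Qed.

Lemma cmean_cst c : cmean (fun=> c) = c.
Proof. by rewrite /cmean !rmean_cst; case: c. Qed.

Lemma cmeanD X Y : bounded_crv X -> bounded_crv Y ->
  cmean (fun w => X w + Y w) = cmean X + cmean Y.
Proof.
move=> bX bY; apply/eqP; rewrite eq_complex Re_add Im_add /=.
rewrite -!rmeanD; do ?[exact: bounded_crv_Re|exact: bounded_crv_Im].
by apply/andP; split; apply/eqP; congr rmean; apply/funext => w; rewrite (Re_add, Im_add).
Qed.

Lemma cmean_sum (I : Type) (r : seq I) (Q : pred I) (F : I -> T -> R[i]) :
  (forall i, Q i -> bounded_crv (F i)) ->
  cmean (fun w => \sum_(i <- r | Q i) F i w) = \sum_(i <- r | Q i) cmean (F i).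
Proof.
move=> FP; elim: r => [|i r ih].
  by rewrite big_nil; under [X in cmean X]eq_fun do rewrite big_nil; exact: cmean_cst.
rewrite big_cons; have [Qi|/negbTE Qi] := boolP (Q i);
  under [X in cmean X]eq_fun do rewrite big_cons Qi; last exact: ih.
by rewrite cmeanD ?ih//; [exact: FP|exact: bounded_crv_sum].
Qed.

(** Real and imaginary parts are bounded separately, whence the factor 2. *)
Lemma cmean_bound X c : bounded_crv X -> cessbounded X c -> normc (cmean X) <= 2 * c.
Proof.
move=> bX cX; apply: le_trans (normc_le_ReIm _) _.
have -> : 2 * c = c + c by ring.
apply: lerD; apply: rmean_bound.
- exact: bounded_crv_Re.
- by move: cX; apply: filterS => w; exact/le_trans/Re_le_normc.
- exact: bounded_crv_Im.
- by move: cX; apply: filterS => w; exact/le_trans/Im_le_normc.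
Qed.

Definition cindic (G : set T) (w : T) : R[i] := (\1_G w)%:C.

Lemma bounded_crv_indic (G : set T) : measurable G -> bounded_crv (cindic G).
Proof.
move=> mG; apply: bounded_crvP; first exact: bounded_rv_indic.
exact: bounded_rv_cst.
Qed.

Lemma cmean_indic (G : set T) : measurable G -> cmean (cindic G) = (fine (P G))%:C.
Proof. by move=> mG; rewrite /cmean /= rmean_indic// rmean_cst. Qed.

Lemma cmean_indep Z X : bounded_crv Z -> bounded_crv X ->
  (forall a : R, cmean (fun w => Z w * cindic [set w | a <= complex.Re (X w)] w) =
     cmean Z * (fine (P [set w | a <= complex.Re (X w)]))%:C) ->
  (forall a : R, cmean (fun w => Z w * cindic [set w | a <= complex.Im (X w)] w) =
     cmean Z * (fine (P [set w | a <= complex.Im (X w)]))%:C) ->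
  cmean (fun w => Z w * X w) = cmean Z * cmean X.
Proof.
move=> bZ bX hR hI.
have bZ1 := bounded_crv_Re bZ; have bZ2 := bounded_crv_Im bZ.
have bX1 := bounded_crv_Re bX; have bX2 := bounded_crv_Im bX.
have split (G : set T) : cmean (fun w => Z w * cindic G w) = cmean Z * (fine (P G))%:C ->
    rmean P (fun w => complex.Re (Z w) * \1_G w) =
      rmean P (fun w => complex.Re (Z w)) * fine (P G) /\
    rmean P (fun w => complex.Im (Z w) * \1_G w) =
      rmean P (fun w => complex.Im (Z w)) * fine (P G).
  move=> /eqP; rewrite eq_complex Re_mul Im_mul /= !mulr0 subr0 add0r.
  move=> /andP[/eqP <- /eqP <-].
  split; congr rmean; apply/funext => w; first by rewrite Re_mul /= mulr0 subr0.
  by rewrite Im_mul /= mulr0 add0r.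
have sR a := split _ (hR a); have sI a := split _ (hI a).
apply/eqP; rewrite eq_complex Re_mul Im_mul /=.
rewrite -!rmean_indep//;
  do ?[by move=> a; case: (sR a)|by move=> a; case: (sI a)].
rewrite -rmeanB -?rmeanD; do ?exact: bounded_rvM.
by apply/andP; split; apply/eqP; congr rmean; apply/funext => w; rewrite (Re_mul, Im_mul).
Qed.

End ComplexBounded.

Section Families.
Variables (R : realType) (N : nat) (J : Type).

Definition entry_events : set (set (matrix_family R N J)) :=
  [set E : set (matrix_family R N J) |
        exists k i j, exists2 B : set R, measurable B &
          E = [set M | B (complex.Re (M k i j))] \/
          E = [set M | B (complex.Im (M k i j))]].

(** The sigma-algebra of [family_measurable] as a measurable space, so that
    functions of a family of matrices can be said to be measurable. *)
Definition family_space := g_sigma_algebraType entry_events.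

Lemma family_space_measurable (E : set family_space) :
  measurable E = @family_measurable R N J E.
Proof. by []. Qed.

Lemma entry_cmeasurable k i j :
  cmeasurable (fun M : family_space => M k i j).
Proof.
split=> _ B mB; rewrite setTI; apply: sub_gen_smallest; exists k, i, j, B => //.
  by left.
by right.
Qed.

End Families.

Section SameLaw.
Context (d : measure_display) (T : measurableType d) (R : realType) (P : probability T R).

Lemma rmean_law (X Y : T -> R) : bounded_rv P X -> bounded_rv P Y ->
  (forall B : set R, measurable B -> P (X @^-1` B) = P (Y @^-1` B)) ->
  rmean P X = rmean P Y.
Proof.
move=> bX bY XY.
have push (Z : T -> R) (bZ : bounded_rv P Z) :
   (\int[pushforward P Z]_y y%:E = \int[P]_w (Z w)%:E)%E.
  rewrite (@integral_pushforward _ _ _ _ _ _ bZ.1)//=.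
  exact: bounded_rv_integrable.
rewrite /rmean /Rintegral -!push//; congr fine.
apply: eq_measure_integral; [exact: bY.1|exact: bX.1|] => h1 h2 B mB _; exact: XY.
Qed.

Lemma cmean_law (N : nat) (J : Type) (X Y : T -> J -> 'M[R[i]]_N)
    (f : family_space R N J -> R[i]) :
  same_law P X Y -> cmeasurable f ->
  bounded_crv P (fun w => f (X w)) -> bounded_crv P (fun w => f (Y w)) ->
  cmean P (fun w => f (X w)) = cmean P (fun w => f (Y w)).
Proof.
move=> XY [m1 m2] bX bY; rewrite /cmean; congr (_ +i* _); apply: rmean_law.
- exact: bounded_crv_Re.
- exact: bounded_crv_Re.
- move=> B mB; have := m1 measurableT B mB; rewrite setTI => /XY.
  by [].
- exact: bounded_crv_Im.
- exact: bounded_crv_Im.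
- move=> B mB; have := m2 measurableT B mB; rewrite setTI => /XY.
  by [].
Qed.

Lemma cmean_indep_family (N : nat) (J : Type) (Z : T -> R[i]) (X : T -> J -> 'M[R[i]]_N)
    (f : family_space R N J -> R[i]) :
  cmeasurable f -> bounded_crv P Z -> bounded_crv P (fun w => f (X w)) ->
  (forall E, family_measurable E ->
     cmean P (fun w => Z w * cindic R (X @^-1` E) w) = cmean P Z * (fine (P (X @^-1` E)))%:C) ->
  cmean P (fun w => Z w * f (X w)) = cmean P Z * cmean P (fun w => f (X w)).
Proof.
move=> [m1 m2] bZ bX ZE.
have half_line (g : family_space R N J -> R) a : measurable_fun [set: family_space R N J] g ->
    family_measurable [set M | a <= g M].
  move=> mg; rewrite -family_space_measurable.
  rewrite (_ : [set M | a <= g M] = [set: family_space R N J] `&` g @^-1` [set` `[a, +oo[]).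
    by apply: mg => //; exact: measurable_itv.
  by rewrite setTI; apply/seteqP; split => M /=; rewrite in_itv/= andbT.
apply: cmean_indep => // a; first exact: (ZE _ (half_line _ a m1)).
exact: (ZE _ (half_line _ a m2)).
Qed.

Lemma cindicI (A B : set T) w : cindic R (A `&` B) w = cindic R A w * cindic R B w.
Proof. by rewrite /cindic indicI /= rmorphM. Qed.

Lemma cmeanC (X Y : T -> R[i]) :
  cmean P (fun w => X w * Y w) = cmean P (fun w => Y w * X w).
Proof. by congr cmean; apply/funext => w; rewrite mulrC. Qed.

Definition event_measurable (N : nat) (J : Type) (X : T -> J -> 'M[R[i]]_N) : Prop :=
  forall E, family_measurable E -> measurable (X @^-1` E).

(** The events with a measurable preimage form a sigma-algebra that contains the
    generators. *)
Lemma random_family_measurable (N : nat) (J : Type) (X : T -> J -> 'M[R[i]]_N) :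
  (forall k, random_mx (fun w => X w k)) -> event_measurable X.
Proof.
move=> mX E; rewrite /family_measurable => mE.
pose S : set (set (matrix_family R N J)) := [set E | measurable (X @^-1` E)].
suff : S E by [].
apply: (mE S); split; first split.
- by rewrite /S /= preimage_set0; exact: measurable0.
- move=> A SA; rewrite /S/= setTD preimage_setC; exact: measurableC.
- move=> F SF; rewrite /S/= preimage_bigcup; apply: bigcup_measurable => k _; exact: SF.
move=> A [k [i [j [B mB [->|->]]]]]; rewrite /S/=.
  by have := (mX k i j).1 measurableT B mB; rewrite setTI.
by have := (mX k i j).2 measurableT B mB; rewrite setTI.
Qed.

Lemma cmean_independent2 (N : nat) (J J' : Type)
    (X : T -> J -> 'M[R[i]]_N) (Y : T -> J' -> 'M[R[i]]_N)
    (f : family_space R N J -> R[i]) (g : family_space R N J' -> R[i]) :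
  independent2 P X Y -> event_measurable X -> event_measurable Y ->
  cmeasurable f -> cmeasurable g ->
  bounded_crv P (fun w => f (X w)) -> bounded_crv P (fun w => g (Y w)) ->
  cmean P (fun w => f (X w) * g (Y w)) =
  cmean P (fun w => f (X w)) * cmean P (fun w => g (Y w)).
Proof.
move=> XY mX mY mf mg bf bg; apply: cmean_indep_family => // F mF.
rewrite cmeanC mulrC -cmean_indic; last exact: mY.
apply: cmean_indep_family => //; first exact/bounded_crv_indic/mY.
move=> E mE.
under [X in cmean P X]eq_fun do rewrite -cindicI.
rewrite !cmean_indic; [|exact: mY|by apply: measurableI; [exact: mY|exact: mX]].
rewrite -rmorphM/=; congr (_%:C).
have fX : P (X @^-1` E) \is a fin_num by apply: fin_num_measure; exact: mX.
have fY : P (Y @^-1` F) \is a fin_num by apply: fin_num_measure; exact: mY.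
by rewrite setIC (XY E F mE mF) (fineM fX fY) mulrC.
Qed.

(** Events are replaced by functions one family at a time. *)
Lemma cmean_independent_families (N L : nat) (J : Type)
    (X : 'I_L -> T -> J -> 'M[R[i]]_N)
    (f : 'I_L -> family_space R N J -> R[i]) :
  independent_families P X -> (forall l, event_measurable (X l)) ->
  (forall l, cmeasurable (f l)) ->
  (forall l, bounded_crv P (fun w => f l (X l w))) ->
  cmean P (fun w => \prod_l f l (X l w)) = \prod_l cmean P (fun w => f l (X l w)).
Proof.
move=> XI mX mf bf.
(* D is the set of families for which the event is already replaced by a function. *)
pose mixed (D : {set 'I_L}) (E : 'I_L -> set (J -> 'M[R[i]]_N)) l w : R[i] :=
  if l \in D then f l (X l w) else cindic R (X l @^-1` E l) w.
suff H (D : {set 'I_L}) E : (forall l, family_measurable (E l)) ->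
    cmean P (fun w => \prod_l mixed D E l w) = \prod_l cmean P (mixed D E l).
  have mT l : family_measurable ((fun _ : 'I_L => [set: J -> 'M[R[i]]_N]) l).
    by rewrite -family_space_measurable; exact: measurableT.
  have := H [set: 'I_L]%SET _ mT; rewrite /mixed.
  under [X in cmean P X = _]eq_fun do under eq_bigr do rewrite finset.in_setT.
  by under [X in _ = X]eq_bigr do rewrite finset.in_setT.
have bm (D1 : {set 'I_L}) E1 l : (forall l, family_measurable (E1 l)) -> bounded_crv P (mixed D1 E1 l).
  move=> mE; rewrite /mixed; case: (l \in D1) => //.
  exact/bounded_crv_indic/mX.
have [n] := ubnP #|D|; elim: n D E => // n ih D E Dn mE.
have [D0|[l0 l0D]] := set_0Vmem D.
  subst D.
  have e : (fun w => \prod_l mixed finset.set0 E l w) = cindic R (\bigcap_l (X l @^-1` E l)).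
    apply/funext => w; rewrite /mixed; under eq_bigr do rewrite finset.in_set0.
    rewrite /cindic -rmorph_prod/=; congr (_%:C); rewrite indicE.
    under eq_bigr do rewrite indicE.
    have [h|h] := boolP [forall l, w \in X l @^-1` E l].
      rewrite big1 => [|l _]; last by rewrite (forallP h l).
      by rewrite mem_set// => l _; apply/set_mem/(forallP h l).
    have [l hl] := existsP (etrans (esym (negb_forall _)) h).
    rewrite (bigD1 l)//= (negbTE hl) mul0r memNset// => /(_ l I) hh.
    by move: hl; rewrite mem_set.
  rewrite e cmean_indic; last first.
    by apply: fin_bigcap_measurable => // l _; exact: mX.
  rewrite XI//.
  have -> : (\prod_l P (X l @^-1` E l) = (\prod_l fine (P (X l @^-1` E l)))%:E)%E.
    elim/big_rec2 : _ => // l x y _ ->.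
    by rewrite EFinM fineK// fin_num_measure//; exact: mX.
  rewrite /= rmorph_prod/=; apply: eq_bigr => l _.
  rewrite -cmean_indic; last exact: mX.
  by congr cmean; apply/funext => w; rewrite /mixed finset.in_set0.
have bmix l : bounded_crv P (mixed D E l) by exact: bm.
pose D' := (D :\ l0)%SET.
pose E' F l := if l == l0 then F else E l.
have mE' F : family_measurable F -> forall l, family_measurable (E' F l).
  by move=> mF l; rewrite /E'; case: ifP.
have mixE F l : l != l0 -> mixed D' (E' F) l = mixed D E l.
  by move=> ll; rewrite /mixed /E' (negbTE ll) finset.in_setD1 ll.
have mix0 F : mixed D' (E' F) l0 = cindic R (X l0 @^-1` F).
  by apply/funext => w; rewrite /mixed /E' finset.in_setD1 !eqxx.
pose Z w := \prod_(l | l != l0) mixed D E l w.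
have bZ : bounded_crv P Z by exact: bounded_crv_prod.
have cardD' : (#|D'| < n)%N by move: Dn; rewrite (cardsD1 l0) l0D.
have ZF F : family_measurable F -> cmean P (fun w => Z w * cindic R (X l0 @^-1` F) w) =
    (\prod_(l | l != l0) cmean P (mixed D E l)) * (fine (P (X l0 @^-1` F)))%:C.
  move=> mF; have := ih D' (E' F) cardD' (mE' _ mF).
  rewrite [RHS](bigD1 l0)//= mix0 cmean_indic; last exact: mX.
  rewrite mulrC [in RHS](eq_bigr (fun l => cmean P (mixed D E l))); last first.
    by move=> l ll; rewrite mixE.
  move=> <-; congr cmean; apply/funext => w.
  rewrite [RHS](bigD1 l0)//= mix0 mulrC; congr (_ * _).
  by apply: eq_bigr => l ll; rewrite mixE.
have mT : family_measurable [set: J -> 'M[R[i]]_N].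
  by rewrite -family_space_measurable; exact: measurableT.
have ZE : cmean P Z = \prod_(l | l != l0) cmean P (mixed D E l).
  have := ZF _ mT; rewrite preimage_setT.
  have -> : (fine (P [set: T]) = 1) by rewrite probability_setT.
  rewrite rmorph1 mulr1 => <-; congr cmean; apply/funext => w.
  by rewrite /cindic indicT rmorph1 mulr1.
have mixl0 : mixed D E l0 = fun w => f l0 (X l0 w).
  by apply/funext => w; rewrite /mixed l0D.
rewrite [RHS](bigD1 l0)//= mulrC -ZE mixl0 -cmean_indep_family//.
  congr cmean; apply/funext => w; rewrite (bigD1 l0)//= mulrC; congr (_ * _).
  by rewrite mixl0.
by move=> F mF; rewrite ZF// ZE.
Qed.

End SameLaw.

(** * The two growth hypotheses *)

Local Open Scope sesquilinear_scope.

Section Opnorm.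
Variables (R : realType) (N : nat).
Implicit Types (M : 'M[R[i]]_N) (x : 'cV[R[i]]_N).

Lemma norm2_sqr x : norm2 x ^+ 2 = \sum_i normc (x i 0) ^+ 2.
Proof. by rewrite sqr_sqrtr// sumr_ge0// => i _; rewrite sqr_ge0. Qed.

Lemma norm2_ge0 x : 0 <= norm2 x.
Proof. exact: sqrtr_ge0. Qed.

Lemma norm2_scale (a : R) x : 0 <= a -> norm2 (a%:C *: x) = a * norm2 x.
Proof.
move=> a0; apply: (@pexpIrn _ 2); rewrite ?nnegrE ?mulr_ge0 ?norm2_ge0//.
rewrite exprMn !norm2_sqr big_distrr/=; apply: eq_bigr => i _.
by rewrite mxE normcM normc_real ger0_norm// exprMn.
Qed.

(** The Euclidean norm of the entries is a bound, so that the supremum in [opnorm] is a genuine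
    upper bound. *)
Lemma opnorm_has_sup M : has_sup [set norm2 (M *m x) | x in [set x | norm2 x <= 1]].
Proof.
split; first by exists (norm2 (M *m 0)), 0 => //=; rewrite /norm2 big1 ?sqrtr0// => i _; rewrite mxE normc0 expr0n.
exists (Num.sqrt (\sum_i \sum_j normc (M i j) ^+ 2)) => _ [x /= x1 <-].
apply: ler_wsqrtr; apply: ler_sum => i _; rewrite mxE.
apply: le_trans (normc_cauchy_schwarz _ _) _.
rewrite -[leRHS]mulr1; apply: ler_wpM2l; first by apply: sumr_ge0 => j _; rewrite sqr_ge0.
by rewrite -norm2_sqr -[leRHS](expr1n _ 2) ler_pXn2r ?nnegrE ?norm2_ge0.
Qed.

Lemma opnorm_ge M x : norm2 (M *m x) <= opnorm M * norm2 x.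
Proof.
have ub y : norm2 y <= 1 -> norm2 (M *m y) <= opnorm M.
  by move=> y1; apply: sup_upper_bound; [exact: opnorm_has_sup|exists y].
have [x0|x0] := eqVneq (norm2 x) 0.
  have -> : x = 0.
    apply/colP => i; rewrite mxE; apply/ComplexField.eq0_normC.
    have := norm2_sqr x; rewrite x0 expr0n/= => /esym/eqP.
    rewrite psumr_eq0 => [/allP/(_ i)|j _]; last exact: sqr_ge0.
    by rewrite mem_index_enum sqrf_eq0 => /(_ isT)/eqP ->.
  by rewrite mulmx0 /norm2 big1 ?sqrtr0 ?mulr0// => i _; rewrite mxE normc0 expr0n.
have xp : 0 < norm2 x by rewrite lt_neqAle eq_sym x0 norm2_ge0.
have := ub (((norm2 x)^-1)%:C *: x).
rewrite norm2_scale ?invr_ge0 ?norm2_ge0// mulVf// => /(_ (lexx _)).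
by rewrite -scalemxAr norm2_scale ?invr_ge0 ?norm2_ge0// mulrC ler_pdivrMr.
Qed.

Lemma opnorm_contraction M c : opnorm M <= c -> contraction c (fun i j => M i j).
Proof.
move=> Mc x; pose y : 'cV[R[i]]_N := \col_j x j.
have y0 := norm2_ge0 y.
have -> : \sum_j normc (x j) ^+ 2 = norm2 y ^+ 2.
  by rewrite norm2_sqr; apply: eq_bigr => j _; rewrite mxE.
have -> : \sum_i normc (\sum_j M i j * x j) ^+ 2 = norm2 (M *m y) ^+ 2.
  rewrite norm2_sqr; apply: eq_bigr => i _; rewrite mxE.
  by congr (normc _ ^+ 2); apply: eq_bigr => j _; rewrite mxE.
rewrite -exprMn ler_pXn2r ?nnegrE ?norm2_ge0//.
  by apply: le_trans (opnorm_ge _ _) _; exact: ler_wpM2r.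
have := le_trans (norm2_ge0 _) (opnorm_ge M y).
have [->|yn] := eqVneq (norm2 y) 0; first by rewrite !mulr0.
have yp : 0 < norm2 y by rewrite lt_neqAle eq_sym yn y0.
by rewrite pmulr_lge0// => M0; rewrite mulr_ge0// (le_trans M0).
Qed.

End Opnorm.

Lemma with_adjointsE (R : realType) N (K : Type) (A : K -> 'M[R[i]]_N) k b i j :
  with_adjoints A (k, b) i j = if b then (A k j i)^*%C else A k i j.
Proof. by rewrite /with_adjoints; case: b => //=; rewrite !mxE. Qed.

(** The constants and the thresholds add up. *)
Lemma finite_uniform (R : realType) (X : finType) (Q : X -> R -> nat -> Prop) :
  (forall x C C' n n', C <= C' -> (n <= n')%N -> Q x C n -> Q x C' n') ->
  (forall x, exists C n, 0 <= C /\ Q x C n) ->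
  exists C n, 0 <= C /\ forall x, Q x C n.
Proof.
move=> mono ex.
have ex' x : exists p : R * nat, 0 <= p.1 /\ Q x p.1 p.2.
  by have [C [n CQ]] := ex x; exists (C, n).
have [f fP] := choice ex'.
exists (\sum_x (f x).1), (\sum_x (f x).2)%N; split.
  by apply: sumr_ge0 => x _; have [] := fP x.
move=> x; have [C0 Qx] := fP x; apply: mono Qx.
  by rewrite (bigD1 x)//= lerDl sumr_ge0// => y _; have [] := fP y.
by rewrite (bigD1 x)//= leq_addr.
Qed.

Section GraphBound.
Context (R : realType) (L : nat) (K : Type)
  (d : nat -> measure_display) (T : forall N, measurableType (d N))
  (P : forall N, probability (T N) R)
  (A : forall N, 'I_L -> K -> T N -> 'M[R[i]]_N).
Arguments A : clear implicits.
Hypothesis hA : forall N l k, Linfty_mx (P N) (A N l k).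

Definition coloured_family N (l : 'I_L) (w : T N) : K * bool -> 'M[R[i]]_N :=
  with_adjoints (fun k => A N l k w).

Lemma coloured_family_bounded N l kb i j :
  bounded_crv (P N) (fun w => coloured_family l w kb i j).
Proof.
case: kb => k b; have [mA bA] := hA N l k.
have bk i' j' : bounded_crv (P N) (fun w => A N l k w i' j').
  by split; [exact: mA|have [c] := bA i' j'; exists c].
rewrite (_ : (fun w => _) = (fun w => if b then (A N l k w j i)^*%C else A N l k w i j)).
  by case: b; [exact: bounded_crv_conj|].
by apply/funext => w; rewrite /coloured_family with_adjointsE.
Qed.

Lemma graph_sum_bounded_crv N l (G : multigraph) (S : {set edge G}) (lab : edge G -> K * bool) :
  bounded_crv (P N) (fun w => graph_sum S (coloured_family l w) lab).
Proof.
apply: bounded_crv_sum => phi _; apply: bounded_crv_prod => e _.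
exact: coloured_family_bounded.
Qed.

(** The common form of the two growth hypotheses.  The constants depend only on
    the size of the graph, for labels in [F]. *)
Definition graph_bound (F : set K) : Prop := forall v q : nat,
  exists C N0, 0 <= C /\ forall N, (N0 <= N)%N ->
  forall (l : 'I_L) (st : {ffun 'I_q -> 'I_v} * {ffun 'I_q -> 'I_v}) (S : {set 'I_q})
    (lab : 'I_q -> K * bool) (w : 'I_v -> nat),
  (forall e, F (lab e).1) ->
  @cover (Multigraph st.1 st.2) S w ->
  normc (cmean (P N) (fun t =>
     @graph_sum _ _ _ (Multigraph st.1 st.2) S (coloured_family l t) lab))
  <= C * Num.sqrt N%:R ^+ (\sum_x w x).

Lemma opnorm_graph_bound : bounded_opnorm P A -> graph_bound setT.
Proof.
move=> [c hc] v q; pose c1 := `|c| + 1.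
have c10 : 0 <= c1 by rewrite addr_ge0.
have c11 : 1 <= c1 by rewrite lerDr.
exists (2 * c1 ^+ q), 1%N; split; first by rewrite mulr_ge0 ?exprn_ge0.
move=> N N1 l st S lab w _ Sw.
rewrite -mulrA; apply: cmean_bound; first exact: graph_sum_bounded_crv.
have : {ae P N, forall t, forall e : 'I_q, opnorm (A N l (lab e).1 t) <= c}.
  by apply: filter_forall => e; exact: hc.
apply: filterS => t ht.
apply: le_trans (@graph_sum_bound _ _ _ (Multigraph st.1 st.2) S w
   (coloured_family l t) lab (fun=> c1) N1 Sw _ _) _ => //.
  move=> e _; have := opnorm_contraction (le_trans (ht e) (_ : c <= c1)).
  move=> /(_ ltac:(by rewrite /c1 (le_trans (ler_norm _))// lerDl)) ce.
  case: (lab e) ce => k b /= ce; rewrite /coloured_family.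
  case: b => //.
  apply: (eq_ind (fun i j => (A N l k t j i)^*) (contraction c1)).
    exact: contraction_adjoint.
  by apply/funext => i; apply/funext => j; rewrite with_adjointsE.
apply: ler_wpM2r; first by rewrite exprn_ge0 ?sqrtr_ge0.
have Sq : (#|S| <= q)%N by have := max_card (mem S); rewrite card_ord.
by rewrite prodr_const; exact: ler_weXn2l.
Qed.

Lemma normc_mean_ext N (f g : T N -> R[i]) : f =1 g ->
  normc (cmean (P N) f) = normc (cmean (P N) g).
Proof. by move=> fg; congr (normc (cmean _ _)); apply/funext. Qed.

(** The graph sum is a product of traces of monomials, and the number of leaves is at
    most the weight of a cover. *)
Lemma moments_single_bound (G : multigraph) (S : {set edge G}) l (lab : edge G -> K * bool) :
  graph_moments_bounded P A ->
  exists C N0, 0 <= C /\ forall N, (N0 <= N)%N -> forall w, cover S w ->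
    normc (cmean (P N) (fun t => graph_sum S (coloured_family l t) lab))
    <= C * Num.sqrt N%:R ^+ (\sum_x w x).
Proof.
move=> mom.
have [gs [gsw gs0 gsE]] := @component_monomials R _ (sub_edges S) (lab \o val).
have gE N t : graph_sum S (coloured_family l t) lab =
    \prod_(g <- gs) \tr (graph_eval (@coloured_family N l t) (sval g)).
  by rewrite -gsE -graph_sum_sub_edges.
have [m0|m0] := posnP (size gs).
  exists 1, 0%N; split => // N _ w _.
  rewrite (normc_mean_ext (g := fun=> 1)).
    have -> : (\sum_x w x = 0)%N.
      rewrite big1// => x _.
      by have : (0 < #|vertex G|)%N by [apply/card_gt0P; exists x]; move=> /gs0; rewrite m0.
    by rewrite cmean_cst normc1 expr0 mulr1.
  by move=> t; rewrite gE (size0nil m0) big_nil.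
have g0 : closed_monomial (K * bool) by case: (gs) m0.
pose g (i : 'I_(size gs)) := sval (nth g0 gs i).
have := mom l (size gs) g m0 (fun i => svalP (nth g0 gs i)).
move=> /eqOP[C0 [C0r /(_ (`|C0| + 1))]].
have -> : (C0 < `|C0| + 1) by rewrite (le_lt_trans (ler_norm _))// ltrDl.
move=> /(_ isT) [N0 _ hN].
exists (`|C0| + 1), (maxn N0 1); split; first by rewrite addr_ge0.
move=> N; rewrite geq_max => /andP[NN0 N1] w Sw.
have e : cmean (P N) (fun t => graph_sum S (coloured_family l t) lab) =
    cmean (P N) (fun t => \prod_(i < size gs) \tr (graph_eval (coloured_family l t) (g i))).
  by congr cmean; apply/funext => t; rewrite gE (big_nth g0) big_mkord.
have := hN N NN0; rewrite cexpectationE e.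
rewrite (ger0_norm (normc_ge0 _)) (ger0_norm (powR_ge0 _ _)).
move=> /le_trans; apply; apply: ler_wpM2l; first by rewrite addr_ge0.
rewrite mulrC powRrM powR12_sqrt ?ler0n// powR_mulrn ?sqrtr_ge0//.
apply: ler_weXn2l.
  by rewrite -[leLHS]sqrtr1 ler_sqrt ?ltr0n// ler1n.
have := gsw w (cover_sub_edges Sw).
by apply: leq_trans; rewrite (big_nth g0) big_mkord.
Qed.

(** The growth hypothesis provides a constant for each labelled graph.  There are
    finitely many of a given size once the labels lie in a finite set. *)
Lemma moments_graph_bound (F : set K) : finite_set F ->
  graph_moments_bounded P A -> graph_bound F.
Proof.
move=> finF mom v q.
have [ks Fks] : exists ks : seq {classic K}, F = [set` ks] by exact/finite_seqP.
pose X : finType := ('I_L * ({ffun 'I_q -> 'I_v} * {ffun 'I_q -> 'I_v}) * {set 'I_q} *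
   {ffun 'I_q -> 'I_(size ks) * bool})%type.
pose matches (x : X) (lab : 'I_q -> K * bool) : Prop :=
  forall e, onth ks (x.2 e).1 = Some (lab e).1 /\ (x.2 e).2 = (lab e).2.
pose Q (x : X) (C : R) (N0 : nat) : Prop := forall N, (N0 <= N)%N ->
   forall (lab : 'I_q -> K * bool) (w : 'I_v -> nat), matches x lab ->
   @cover (Multigraph x.1.1.2.1 x.1.1.2.2) x.1.2 w ->
   normc (cmean (P N) (fun t =>
     @graph_sum _ _ _ (Multigraph x.1.1.2.1 x.1.1.2.2) x.1.2 (coloured_family x.1.1.1 t) lab))
   <= C * Num.sqrt N%:R ^+ (\sum_y w y).
have [|x|C [N0 [C0 H]]] := @finite_uniform R X Q.
- move=> x C C' n n' CC nn h N Nn lab w ml Sw.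
  apply: le_trans (h N (leq_trans nn Nn) lab w ml Sw) _.
  by apply: ler_wpM2r => //; rewrite exprn_ge0 ?sqrtr_ge0.
- have [[lab0 m0]|no] := pselect (exists lab, matches x lab); last first.
    by exists 0, 0%N; split => // N _ lab w ml; case: no; exists lab.
  have [C [N0 [C0 h]]] := @moments_single_bound (Multigraph x.1.1.2.1 x.1.1.2.2) x.1.2
     x.1.1.1 lab0 mom.
  exists C, N0; split => // N NN lab w ml Sw.
  have -> : lab = lab0.
    apply/funext => e; have [a1 a2] := ml e; have [b1 b2] := m0 e.
    move: a1; rewrite b1 => -[a1]; move: a2; rewrite b2 => a2.
    by case: (lab e) (lab0 e) a1 a2 => [k b] [k' b'] /= -> ->.
  exact: h.
exists C, N0; split => // N NN l st S lab w labF Sw.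
have kin e : ((lab e).1 : {classic K}) \in ks.
  by have := labF e; rewrite Fks.
have klt e : (index ((lab e).1 : {classic K}) ks < size ks)%N by rewrite index_mem.
apply: (H (l, st, S, [ffun e => (Ordinal (klt e), (lab e).2)]) N NN) => // e.
rewrite ffunE /=; split => //.
by rewrite onthE (nth_map ((lab e).1 : {classic K})) ?index_mem// nth_index.
Qed.

End GraphBound.

End Probability.

(** * Means along injective maps *)

(** The permutation is built as a product of transpositions, fixing one value at a time. *)
Lemma injection_extend (v : nat) (X : finType) (f g : 'I_v -> X) :
  injective f -> injective g -> exists s : {perm X}, forall x, s (f x) = g x.
Proof.
move=> fi gi.
suff H k : (k <= v)%N -> exists s : {perm X}, forall x : 'I_v, (x < k)%N -> s (f x) = g x.
  by have [s sP] := H v (leqnn v); exists s => x; exact: sP.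
elim: k => [|k ih] kv; first by exists 1%g.
have [s sP] := ih (ltnW kv).
pose a : 'I_v := Ordinal kv.
exists (s * tperm (s (f a)) (g a))%g => x; rewrite ltnS leq_eqVlt permM => /orP[/eqP xk|xk].
  by have -> : x = a; [exact: val_inj|rewrite tpermL].
have xa : x != a by rewrite -val_eqE /= neq_ltn xk.
rewrite (sP x xk) tpermD//; apply: contra xa => /eqP h; apply/eqP.
  by apply: fi; apply: (@perm_inj _ s); rewrite h sP.
exact: gi.
Qed.

Section ImageCount.
Variable I : finType.

Definition image_size (V : finType) (phi : {ffun V -> I}) : nat := #|codom phi|.

(** Merging the vertices with the same image leaves an injective map. *)
Lemma image_factor (V : finType) (phi : {ffun V -> I}) :
  exists (k : {ffun V -> 'I_(image_size phi)}) (f : {ffun 'I_(image_size phi) -> I}),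
  [/\ injective f, (forall y, exists x, k x = y) & phi = [ffun x => f (k x)]].
Proof.
have mem x : phi x \in codom phi by exact: codom_f.
exists [ffun x => enum_rank_in (mem x) (phi x)], [ffun y => enum_val y]; split.
- by move=> y z; rewrite !ffunE => /enum_val_inj.
- move=> y; have /codomP[x xy] := enum_valP y.
  by exists x; rewrite ffunE; apply: enum_val_inj; rewrite enum_rankK_in ?codom_f.
- by apply/ffunP => x; rewrite !ffunE enum_rankK_in.
Qed.

Lemma image_size_le (V : finType) (phi : {ffun V -> I}) : (image_size phi <= #|V|)%N.
Proof. by rewrite /image_size -(size_codom phi) card_size. Qed.

Lemma image_size_lt (V : finType) (phi : {ffun V -> I}) :
  ~~ injectiveb phi -> (image_size phi < #|V|)%N.
Proof.
apply: contraR; rewrite -leqNgt => h; apply/injectiveP => x y xy.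
have /image_injP inj : #|[seq phi x | x in V]| == #|V| by rewrite eqn_leq leq_image_card.
exact: inj.
Qed.

Lemma image_size_count (V : finType) (m : nat) :
  (#|[set phi : {ffun V -> I} | image_size phi == m]| <= m ^ #|V| * #|I| ^ m)%N.
Proof.
have -> : (m ^ #|V| * #|I| ^ m = #|[set: {ffun V -> 'I_m} * {ffun 'I_m -> I}]|)%N.
  by rewrite cardsT card_prod !card_ffun !card_ord.
apply: leq_trans (leq_imset_card (fun p : {ffun V -> 'I_m} * {ffun 'I_m -> I} =>
   [ffun x => p.2 (p.1 x)]) _).
apply: subset_leq_card; apply/fintype.subsetP => phi; rewrite inE => /eqP e.
have [k [f [_ _ pE]]] := image_factor phi; move: k f pE; rewrite e => k f pE.
by apply/imsetP; exists (k, f); rewrite ?inE.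
Qed.

End ImageCount.

(** A map with an image of size [m] is a map to [m] points followed by an injection,
    for which there are at most [N^m] choices: this balances the weight [N^-m]. *)
Lemma image_weight_sum (R : realFieldType) (N : nat) (V : finType) : (0 < N)%N ->
  \sum_(phi : {ffun V -> 'I_N}) (N%:R^-1 : R) ^+ image_size phi <=
  (\sum_(m < #|V|.+1) m ^ #|V|)%N%:R.
Proof.
move=> N0.
rewrite (partition_big (fun phi => inord (image_size phi) : 'I_(#|V|.+1)) predT)//=.
rewrite natr_sum; apply: ler_sum => m _.
rewrite (eq_bigr (fun=> N%:R^-1 ^+ m)); last first.
  by move=> phi /eqP <-; rewrite inordK// ltnS image_size_le.
rewrite sumr_const -[leLHS]mulr_natr.
rewrite exprVn mulrC ler_pdivrMr ?exprn_gt0 ?ltr0n// -natrX -natrM ler_nat.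
apply: leq_trans (_ : #|[set phi : {ffun V -> 'I_N} | image_size phi == m]| <= _)%N.
  rewrite subset_leq_card//; apply/fintype.subsetP => phi; rewrite !inE unfold_in /= => /eqP <-.
  by rewrite inordK// ltnS image_size_le.
by apply: leq_trans (image_size_count _ _ _) _; rewrite card_ord.
Qed.

(** A fixed proportion of all maps is injective. *)
Lemma falling_lower (N v : nat) : (2 * v <= N)%N -> (N ^ v <= 2 ^ v * N ^_ v)%N.
Proof.
move=> vN; suff H k : (k <= v)%N -> (N ^ k <= 2 ^ k * N ^_ k)%N by exact: H.
elim: k => [|k ih] kv; first by rewrite !expn0 ffactn0.
rewrite !expnSr ffactnSr.
apply: (@leq_trans ((2 ^ k * N ^_ k) * (2 * (N - k)))%N); last by nia.
by apply: leq_mul; [apply: ih; exact: ltnW|lia].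
Qed.

Section InjectiveBound.
Context (R : realType) (L : nat) (K : Type)
  (d : nat -> measure_display) (T : forall N, measurableType (d N))
  (P : forall N, probability (T N) R)
  (A : forall N, 'I_L -> K -> T N -> 'M[R[i]]_N).
Arguments A : clear implicits.
Hypothesis hA : forall N l k, Linfty_mx (P N) (A N l k).
Hypothesis hAperm : forall N l, permutation_invariant (P N) (A N l).

Lemma adjoint_entry_cmeasurable N (kb : K * bool) i j :
  cmeasurable (fun M : family_space R N K => with_adjoints M kb i j).
Proof.
case: kb => k b; rewrite (_ : (fun M => _) =
   (fun M : family_space R N K => if b then (M k j i)^*%C else M k i j)).
  by case: b; [apply: cmeasurable_conj|]; exact: entry_cmeasurable.
by apply/funext => M; rewrite with_adjointsE.
Qed.

Variables (N : nat) (l : 'I_L) (v : nat) (E : finType) (s t : E -> 'I_v)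
  (S : {set E}) (lab : E -> K * bool).

Definition monomial_mean (phi : {ffun 'I_v -> 'I_N}) : R[i] :=
  cmean (P N) (fun w => \prod_(e in S)
     coloured_family A l w (lab e) (phi (t e)) (phi (s e))).

Lemma monomial_bounded_crv (phi : {ffun 'I_v -> 'I_N}) :
  bounded_crv (P N) (fun w => \prod_(e in S)
     coloured_family A l w (lab e) (phi (t e)) (phi (s e))).
Proof. by apply: bounded_crv_prod => e _; exact: coloured_family_bounded. Qed.

Lemma monomial_mean_perm (p : 'S_N) (phi : {ffun 'I_v -> 'I_N}) :
  monomial_mean [ffun x => p (phi x)] = monomial_mean phi.
Proof.
pose f (M : family_space R N K) : R[i] :=
  \prod_(e in S) with_adjoints M (lab e) (phi (t e)) (phi (s e)).
have mf : cmeasurable f.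
  by apply: cmeasurable_prod => e _; exact: adjoint_entry_cmeasurable.
have fY w : f (fun k => perm_mx p *m A N l k w *m invmx (perm_mx p)) =
    \prod_(e in S) coloured_family A l w (lab e)
      ([ffun x => p (phi x)] (t e)) ([ffun x => p (phi x)] (s e)).
  have pE k i j : (perm_mx p *m A N l k w *m invmx (perm_mx p)) i j = A N l k w (p i) (p j).
    have -> : invmx (perm_mx p) = perm_mx p^-1 :> 'M[R[i]]_N.
      by rewrite -[LHS]mulmx1 -(perm_mx1 _ N) -(mulgV p) perm_mxM mulKmx ?unitmx_perm.
    by rewrite -col_permE -row_permE !mxE.
  apply: eq_bigr => e _; rewrite !ffunE /coloured_family; case: (lab e) => k b.
  by rewrite !with_adjointsE; case: b; rewrite pE.
rewrite /monomial_mean.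
under [X in cmean _ X]eq_fun do rewrite -fY.
apply/esym; apply: (cmean_law (hAperm l p) mf).
  exact: monomial_bounded_crv.
under eq_fun do rewrite fY; exact: (monomial_bounded_crv [ffun x => p (phi x)]).
Qed.

(** Two injective maps with the same source differ by a permutation of the
    values, under which the law is invariant. *)
Lemma monomial_mean_inj (phi psi : {ffun 'I_v -> 'I_N}) : injective phi -> injective psi ->
  monomial_mean phi = monomial_mean psi.
Proof.
move=> ip iq; have [p pP] := injection_extend ip iq.
rewrite -(monomial_mean_perm p); congr monomial_mean.
by apply/ffunP => x; rewrite ffunE pP.
Qed.

End InjectiveBound.

Lemma cover_ext (V E : finType) (s s' t t' : E -> V) (S : {set E}) w :
  s =1 s' -> t =1 t' ->
  @cover (Multigraph s t) S w -> @cover (Multigraph s' t') S w.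
Proof. by move=> /funext -> /funext ->. Qed.

Section InjectiveBound2.
Context (R : realType) (L : nat) (K : Type)
  (d : nat -> measure_display) (T : forall N, measurableType (d N))
  (P : forall N, probability (T N) R)
  (A : forall N, 'I_L -> K -> T N -> 'M[R[i]]_N).
Arguments A : clear implicits.
Hypothesis hA : forall N l k, Linfty_mx (P N) (A N l k).
Hypothesis hAperm : forall N l, permutation_invariant (P N) (A N l).

(** The mean along an injective map is the average over all injective maps.  The sum
    over all maps is controlled by [graph_bound], and the non injective ones, which are
    injective on a graph with fewer vertices, by induction: covers are preserved when
    vertices are merged. *)
Lemma injective_bound (F : set K) : graph_bound P A F -> forall v q : nat,
  exists C N0, 0 <= C /\ forall N, (N0 <= N)%N ->
  forall (l : 'I_L) (st : {ffun 'I_q -> 'I_v} * {ffun 'I_q -> 'I_v}) (S : {set 'I_q})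
    (lab : 'I_q -> K * bool) (w : 'I_v -> nat),
  (forall e, F (lab e).1) ->
  @cover (Multigraph st.1 st.2) S w ->
  forall phi : {ffun 'I_v -> 'I_N}, injective phi ->
  normc (monomial_mean P A l st.1 st.2 S lab phi) <=
    C * N%:R^-1 ^+ v * Num.sqrt N%:R ^+ (\sum_x w x).
Proof.
move=> gb v q; elim/ltn_ind: v => v ih.
have [C0 [N0 [C00 h0]]] := gb v q.
pose Q (m : 'I_v) (C : R) (N0 : nat) := forall N, (N0 <= N)%N ->
  forall (l : 'I_L) (st : {ffun 'I_q -> 'I_m} * {ffun 'I_q -> 'I_m}) (S : {set 'I_q})
    (lab : 'I_q -> K * bool) (w : 'I_m -> nat),
  (forall e, F (lab e).1) ->
  @cover (Multigraph st.1 st.2) S w ->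
  forall phi : {ffun 'I_m -> 'I_N}, injective phi ->
  normc (monomial_mean P A l st.1 st.2 S lab phi) <=
    C * N%:R^-1 ^+ m * Num.sqrt N%:R ^+ (\sum_x w x).
have [|m|C1 [N1 [C10 h1]]] := @finite_uniform R 'I_v Q.
- move=> m C C' n n' CC nn h N Nn l st S lab w lF Sw phi ip.
  apply: le_trans (h N (leq_trans nn Nn) l st S lab w lF Sw phi ip) _.
  apply: ler_wpM2r; first by rewrite exprn_ge0 ?sqrtr_ge0.
  by apply: ler_wpM2r CC; rewrite exprn_ge0 ?invr_ge0.
- exact: ih m (ltn_ord m).
(* Number of ways to merge v points into m, summed over m. *)
pose D : R := (\sum_(m < v.+1) m ^ v)%N%:R.
exists (2 ^+ v * (C0 + C1 * D)), (maxn (maxn N0 N1) (2 * v).+1).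
split; first by rewrite mulr_ge0 ?exprn_ge0// addr_ge0// mulr_ge0.
move=> N; rewrite !geq_max => /andP[/andP[NN0 NN1] Nv] l st S lab w lF Sw phi ip.
have Npos : (0 < N)%N by apply: leq_ltn_trans Nv.
set sw := Num.sqrt N%:R ^+ (\sum_x w x).
have sw0 : 0 <= sw by rewrite exprn_ge0 ?sqrtr_ge0.
pose J (psi : {ffun 'I_v -> 'I_N}) := monomial_mean P A l st.1 st.2 S lab psi.
rewrite -/(J phi).
have total : \sum_psi J psi = cmean (P N) (fun t =>
     @graph_sum _ _ _ (Multigraph st.1 st.2) S (coloured_family A l t) lab).
  rewrite cmean_sum// => psi _; exact: monomial_bounded_crv.
(* A non injective map is an injective one on a quotient with fewer vertices. *)
have small (psi : {ffun 'I_v -> 'I_N}) : ~~ injectiveb psi -> normc (J psi) <= C1 * sw * N%:R^-1 ^+ image_size psi.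
  move=> ni; have := image_size_lt ni; rewrite card_ord => lt.
  have := image_factor psi; move: lt; move: (image_size psi) => m lt [k [f [fi ks pE]]].
  pose st' : {ffun 'I_q -> 'I_m} * {ffun 'I_q -> 'I_m} :=
    ([ffun e => k (st.1 e)], [ffun e => k (st.2 e)]).
  pose w' (y : 'I_m) := (\sum_(x | k x == y) w x)%N.
  have Sw' : @cover (Multigraph st'.1 st'.2) S w'.
    apply: cover_ext (@cover_image (Multigraph st.1 st.2) _ k S w ks Sw) => e;
      by rewrite ffunE.
  have := h1 (Ordinal lt) N NN1 l st' S lab w' lF Sw' f fi.
  have -> : monomial_mean P A l st'.1 st'.2 S lab f = J psi.
    congr cmean; apply/funext => t; apply: eq_bigr => e _.
    by rewrite pE !ffunE.
  have -> : (\sum_y w' y = \sum_x w x)%N.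
    by rewrite [RHS](partition_big k predT).
  by rewrite /= -/sw mulrAC.
have sum_small : \sum_(psi : {ffun 'I_v -> 'I_N} | ~~ injectiveb psi) normc (J psi) <= C1 * sw * D.
  apply: le_trans (ler_sum _ small) _; rewrite -big_distrr/=.
  apply: ler_wpM2l; first by rewrite mulr_ge0.
  have := @image_weight_sum R N 'I_v Npos; rewrite card_ord; apply: le_trans.
  rewrite [leRHS](bigID (fun psi : {ffun 'I_v -> 'I_N} => ~~ injectiveb psi))/= lerDl.
  by apply: sumr_ge0 => psi _; rewrite exprn_ge0// invr_ge0.
have inj_sum : \sum_(psi : {ffun 'I_v -> 'I_N} | injectiveb psi) J psi = (N ^_ v)%:R * J phi.
  rewrite (eq_bigr (fun=> J phi)); last first.
    by move=> psi /injectiveP ipsi; apply: monomial_mean_inj.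
  rewrite sumr_const -[LHS]mulr_natl; congr (_%:R * _).
  rewrite -[in RHS](card_ord N) -[in RHS](card_ord v) -card_inj_ffuns.
  by rewrite cardsE.
have key : (N ^_ v)%:R * normc (J phi) <= (C0 + C1 * D) * sw.
  have -> : (N ^_ v)%:R * normc (J phi) = normc ((N ^_ v)%:R * J phi).
    by rewrite normcM -[X in normc X * _](rmorph_nat (real_complex R)) normc_real normr_nat.
  rewrite -inj_sum.
  have -> : \sum_(psi : {ffun 'I_v -> 'I_N} | injectiveb psi) J psi =
      \sum_psi J psi - \sum_(psi : {ffun 'I_v -> 'I_N} | ~~ injectiveb psi) J psi.
    by rewrite [X in _ = X - _](bigID (fun psi : {ffun 'I_v -> 'I_N} => injectiveb psi))/= addrK.
  apply: le_trans (normc_leD _ _) _; rewrite mulrDl; apply: lerD.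
    by rewrite total; exact: h0.
  rewrite mulrAC; apply: le_trans sum_small.
  have -> : normc (- \sum_(psi : {ffun 'I_v -> 'I_N} | ~~ injectiveb psi) J psi) =
     normc (\sum_(psi : {ffun 'I_v -> 'I_N} | ~~ injectiveb psi) J psi).
    by rewrite -mulN1r normcM -(rmorphN1 (real_complex R)) normc_real normrN1 mul1r.
  exact: normc_sum.
have fall : N%:R ^+ v <= 2 ^+ v * (N ^_ v)%:R :> R.
  by rewrite -!natrX -natrM ler_nat; apply: falling_lower; exact: ltnW.
have Nv0 : 0 < N%:R ^+ v :> R by rewrite exprn_gt0 ?ltr0n.
rewrite exprVn -!mulrA [_^-1 * _]mulrC !mulrA ler_pdivlMr//.
apply: (@le_trans _ _ (normc (J phi) * (2 ^+ v * (N ^_ v)%:R))).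
  by apply: ler_wpM2l => //; exact: normc_ge0.
rewrite mulrCA [normc _ * _]mulrC.
apply: (@le_trans _ _ (2 ^+ v * ((C0 + C1 * D) * sw))); last by rewrite !mulrA.
by apply: ler_wpM2l key; rewrite exprn_ge0.
Qed.

End InjectiveBound2.

(** * Means along closed walks of alternating colours *)

Section Core.
Context (R : realType) (L : nat) (K : Type)
  (d : nat -> measure_display) (T : forall N, measurableType (d N))
  (P : forall N, probability (T N) R)
  (A : forall N, 'I_L -> K -> T N -> 'M[R[i]]_N).
Arguments A : clear implicits.
Hypothesis hA : forall N l k, Linfty_mx (P N) (A N l k).
Hypothesis hAindep : forall N, independent_families (P N) (fun l w k => A N l k w).
Hypothesis hAperm : forall N l, permutation_invariant (P N) (A N l).

Definition entry N (w : T N) (lk : 'I_L * (K * bool)) : 'M[R[i]]_N :=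
  coloured_family A lk.1 w lk.2.

Lemma colours_factor N (E : finType) (lab : E -> 'I_L * (K * bool)) (x y : E -> 'I_N) :
  cmean (P N) (fun w => \prod_e entry w (lab e) (x e) (y e)) =
  \prod_l cmean (P N) (fun w =>
    \prod_(e in colour (G := Multigraph x y) (fun e => (lab e).1) l)
       coloured_family A l w (lab e).2 (x e) (y e)).
Proof.
pose f (l : 'I_L) (M : family_space R N K) : R[i] :=
  \prod_(e in colour (G := Multigraph x y) (fun e => (lab e).1) l)
    with_adjoints M (lab e).2 (x e) (y e).
rewrite -(@cmean_independent_families _ _ _ (P N) N L K (fun l w k => A N l k w) f).
- congr cmean; apply/funext => w.
  rewrite (partition_big (fun e => (lab e).1) predT)//=.
  apply: eq_bigr => l _; apply: eq_big => e; first by rewrite inE.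
  by move=> /eqP <-.
- exact: hAindep.
- by move=> l; apply: random_family_measurable => k; have [] := hA N l k.
- by move=> l; apply: cmeasurable_prod => e _; exact: adjoint_entry_cmeasurable.
- by move=> l; apply: bounded_crv_prod => e _; exact: coloured_family_bounded.
Qed.

(** What a centred product leaves on the graph drawn by [phi]. *)
Definition proper_graph (G : multigraph) (c : edge G -> 'I_L) : Prop :=
  [/\ forall x y : vertex G, connect (adjacent [set: edge G]) x y,
      forall e : edge G, connect (adjacent ([set: edge G] :\ e)) (source e) (target e) &
      exists n (v : nat -> vertex G) (col : nat -> 'I_L),
      [/\ (2 <= n)%N, v n = v 0%N,
          forall i, (i < n)%N -> v i != v i.+1,
          forall i, (i < n)%N -> connect (adjacent (colour c (col i))) (v i) (v i.+1) &
          forall i, (i.+1 < n)%N -> col i != col i.+1]].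

(** Each colour contributes [N^-m], and [sqrt N] per unit of weight of its cover.  By
    [coloured_cover] the weights add up to at most [2 (L - 1) m], and [N^-m] is left. *)
Lemma proper_injective_bound (F : set K) : graph_bound P A F -> forall m q : nat,
  exists C N0, 0 <= C /\ forall N, (N0 <= N)%N ->
  forall (st : {ffun 'I_q -> 'I_m} * {ffun 'I_q -> 'I_m})
    (lab : 'I_q -> 'I_L * (K * bool)),
  (forall e, F (lab e).2.1) ->
  @proper_graph (Multigraph st.1 st.2) (fun e => (lab e).1) ->
  forall phi : {ffun 'I_m -> 'I_N}, injective phi ->
  normc (cmean (P N) (fun w => \prod_e entry w (lab e) (phi (st.2 e)) (phi (st.1 e))))
    <= C * N%:R^-1 ^+ m.
Proof.
move=> gb m q; have [C [N0 [C0 H]]] := injective_bound hA hAperm gb m q.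
exists (C ^+ L), (maxn N0 1); split; first by rewrite exprn_ge0.
move=> N; rewrite geq_max => /andP[NN0 N1] st lab labF [con br [n [v [col [n2 vn vne vcol colne]]]]] phi ip.
have [w [Sw wsum]] := coloured_cover con br n2 vn vne vcol colne.
rewrite colours_factor normc_prod.
apply: (@le_trans _ _ (\prod_l (C * N%:R^-1 ^+ m * Num.sqrt N%:R ^+ (\sum_x w l x)))).
  apply: ler_prod => l _; rewrite normc_ge0 /=.
  have := H N NN0 l st (colour (G := Multigraph st.1 st.2) (fun e => (lab e).1) l)
     (fun e => (lab e).2) (w l) labF (Sw l) phi ip.
  by apply: le_trans; rewrite le_eqVlt; apply/orP; left.
rewrite big_split/= prodr_const card_ord exprMn -!mulrA.
apply: ler_wpM2l; first by rewrite exprn_ge0.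
rewrite prodrXr -exprM.
have L1 : (0 < L)%N by apply: leq_trans (ltn_ord (col 0%N)).
apply: (@le_trans _ _ (N%:R^-1 ^+ (m * L) * Num.sqrt N%:R ^+ (2 * (L.-1 * m)))).
  apply: ler_wpM2l; first by rewrite exprn_ge0 ?invr_ge0.
  apply: ler_weXn2l; first by rewrite -[leLHS]sqrtr1 ler_sqrt ?ltr0n// ler1n.
  by move: wsum; rewrite /= card_ord.
have -> : Num.sqrt N%:R ^+ (2 * (L.-1 * m)) = N%:R ^+ (L.-1 * m) :> R.
  by rewrite exprM sqr_sqrtr ?ler0n.
have -> : (m * L = m + L.-1 * m)%N by rewrite -{1}(prednK L1) mulnS [(m * _)%N]mulnC.
by rewrite exprD -mulrA -exprMn mulVf ?expr1n ?mulr1// pnatr_eq0 -lt0n.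
Qed.

Lemma connect_neq_edge (G : multigraph) (S : {set edge G}) x y :
  connect (adjacent S) x y -> x != y -> exists e, source e = x \/ target e = x.
Proof.
move=> /connectP[[|z p] /=]; first by move=> _ ->; rewrite eqxx.
move=> /andP[/adjacentP[e _ E] _] _ _; exists e.
by case: E => [[-> _]|[_ ->]]; [left|right].
Qed.

(** The case of an injective map, applied to the graph with merged vertices. *)
Lemma proper_bound (F : set K) : graph_bound P A F -> forall v q : nat,
  exists C N0, 0 <= C /\ forall N, (N0 <= N)%N ->
  forall (V E : finType) (s t : E -> V) (lab : E -> 'I_L * (K * bool))
    (phi : {ffun V -> 'I_N}) (r : V),
  (#|V| <= v)%N -> (#|E| <= q)%N ->
  (forall e, F (lab e).2.1) ->
  (forall x, connect (@adjacent (Multigraph (phi \o s) (phi \o t)) [set: E]) (phi r) (phi x)) ->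
  (forall e, connect (@adjacent (Multigraph (phi \o s) (phi \o t)) ([set: E] :\ e))
     (phi (s e)) (phi (t e))) ->
  (exists n (z : nat -> 'I_N) (col : nat -> 'I_L),
      [/\ (2 <= n)%N, z n = z 0%N,
          forall i, (i < n)%N -> z i != z i.+1,
          forall i, (i < n)%N -> connect (adjacent
             (colour (G := Multigraph (phi \o s) (phi \o t)) (fun e => (lab e).1) (col i))) (z i) (z i.+1) &
          forall i, (i.+1 < n)%N -> col i != col i.+1]) ->
  normc (cmean (P N) (fun w => \prod_e entry w (lab e) (phi (t e)) (phi (s e))))
    <= C * N%:R^-1 ^+ image_size phi.
Proof.
move=> gb v q.
pose Q (mq : 'I_v.+1 * 'I_q.+1) (C : R) (N0 : nat) := forall N, (N0 <= N)%N ->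
  forall (st : {ffun 'I_mq.2 -> 'I_mq.1} * {ffun 'I_mq.2 -> 'I_mq.1})
    (lab : 'I_mq.2 -> 'I_L * (K * bool)),
  (forall e, F (lab e).2.1) ->
  @proper_graph (Multigraph st.1 st.2) (fun e => (lab e).1) ->
  forall phi : {ffun 'I_mq.1 -> 'I_N}, injective phi ->
  normc (cmean (P N) (fun w => \prod_e entry w (lab e) (phi (st.2 e)) (phi (st.1 e))))
    <= C * N%:R^-1 ^+ mq.1.
have [|mq|C [N0 [C0 H]]] := @finite_uniform R _ Q.
- move=> mq C C' n n' CC nn h N Nn st lab lF pr phi ip.
  apply: le_trans (h N (leq_trans nn Nn) st lab lF pr phi ip) _.
  by apply: ler_wpM2r CC; rewrite exprn_ge0 ?invr_ge0.
- exact: proper_injective_bound.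
exists C, N0; split => // N NN V E s t lab phi r Vv Eq labF con br [n [z [col [n2 zn zne zcol colne]]]].
have [k [f [fi ks pE]]] := image_factor phi.
have mv : (image_size phi < v.+1)%N by rewrite ltnS; apply: leq_trans (image_size_le _) Vv.
have phiE x : phi x = f (k x).
  by have := congr1 (fun g : {ffun V -> 'I_N} => g x) pE; rewrite [RHS]ffunE.
pose st : {ffun 'I_#|E| -> 'I_(image_size phi)} * {ffun 'I_#|E| -> 'I_(image_size phi)} :=
  ([ffun e => k (s (enum_val e))], [ffun e => k (t (enum_val e))]).
(* A left inverse of f. *)
pose h (y : 'I_N) : 'I_(image_size phi) := odflt (k r) [pick u | f u == y].
have hf u : h (f u) = u.
  by rewrite /h; case: pickP => [u' /eqP/fi //|/(_ u)]; rewrite eqxx.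
have push (D : {set E}) x y :
    connect (@adjacent (Multigraph (phi \o s) (phi \o t)) D) x y ->
    connect (@adjacent (Multigraph st.1 st.2) [set e | enum_val e \in D]) (h x) (h y).
  apply: connect_homo => {}x {}y /adjacentP[/= e eD E1]; apply: connect1.
  apply/adjacentP; exists (enum_rank e); first by rewrite inE enum_rankK.
  rewrite /= !ffunE enum_rankK.
  by case: E1 => [[<- <-]|[<- <-]]; [left|right]; rewrite !phiE !hf.
pose lab' (e : 'I_#|E|) := lab (enum_val e).
have pr : @proper_graph (Multigraph st.1 st.2) (fun e => (lab' e).1).
  split.
  - move=> x y; have [x' <-] := ks x; have [y' <-] := ks y.
    have cr u : connect (@adjacent (Multigraph st.1 st.2) [set: 'I_#|E|]) (k r) (k u).
      have := push _ _ _ (con u); rewrite !phiE !hf; apply: connectS; exact: finset.subsetT.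
    by apply: connect_trans (cr y'); rewrite (@adjacent_csym (Multigraph st.1 st.2)).
  - move=> e; have := push _ _ _ (br (enum_val e)); rewrite !phiE !hf /= !ffunE.
    apply: (@connectS (Multigraph st.1 st.2)); apply/fintype.subsetP => e'; rewrite !inE !andbT.
    by apply: contra => /eqP ->.
  - exists n, (h \o z), col; split => //.
    + by rewrite /= zn.
    + move=> i ii /=; have zi := zne i ii.
      have im j j' : z j != z j' -> (connect (adjacent
        (colour (G := Multigraph (phi \o s) (phi \o t)) (fun e => (lab e).1) (col i))) (z j) (z j'))
        -> exists u, z j = f u.
        move=> jj cc; have [e /= se] := connect_neq_edge cc jj.
        by case: se => <-; [exists (k (s e))|exists (k (t e))]; rewrite phiE.
      have [u zu] := im _ _ zi (zcol i ii).
      have [u' zu'] : exists u, z i.+1 = f u.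
        apply: (im i.+1 i); first by rewrite eq_sym.
        by rewrite (@adjacent_csym (Multigraph (phi \o s) (phi \o t))); exact: zcol.
      by rewrite zu zu' !hf; apply: contra zi => /eqP e; rewrite zu zu' e.
    + move=> i ii; have := push _ _ _ (zcol i ii); apply: connectS.
      by apply/fintype.subsetP => e; rewrite !inE.
have := H (Ordinal mv, Ordinal (Eq : (#|E| < q.+1)%N)) N NN st lab' (fun e => labF _) pr f fi.
apply: le_trans; rewrite le_eqVlt; apply/orP; left; apply/eqP.
congr (normc (cmean _ _)); apply/funext => w.
rewrite (reindex (enum_val : 'I_#|E| -> E)); last first.
  by exists enum_rank => e _; rewrite ?enum_valK ?enum_rankK.
by apply: eq_bigr => e _; rewrite !ffunE !phiE.
Qed.

End Core.

(** * Expansions of random matrices over graphs *)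

Section Wired.
Variables (N : nat) (E : finType) (s t : E -> 'I_N).
Local Notation G := (Multigraph s t).

Definition wired (D : {set E}) (x y : 'I_N) : rel 'I_N :=
  [rel a b | [|| @adjacent G D a b, (a == x) && (b == y) | (a == y) && (b == x)]].

Lemma wired_sym D x y : symmetric (wired D x y).
Proof.
move=> a b; rewrite /wired /= (@adjacent_sym G) ![(b == _) && _]andbC.
by rewrite [X in _ || X]orbC.
Qed.

Lemma wired_adjacent D x y : subrel (connect (@adjacent G D)) (connect (wired D x y)).
Proof. by apply: connect_sub1 => a b; rewrite /wired /= => ->. Qed.

Lemma wired_wire D x y : connect (wired D x y) x y.
Proof. by apply: connect1; rewrite /wired /= !eqxx orbT. Qed.

Lemma wired_trivial D x : subrel (connect (wired D x x)) (connect (@adjacent G D)).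
Proof.
apply: connect_sub => a b /or3P[|/andP[/eqP -> /eqP ->]|/andP[/eqP -> /eqP ->]];
  by [exact: connect1|].
Qed.

(** Connected, and without bridges once the terminals are joined: a single edge is of
    this kind, and the property is stable under composition in series. *)
Definition two_terminal (V : finType) (phi : V -> 'I_N) (x y : 'I_N) : Prop :=
  (forall u, connect (@adjacent G [set: E]) x (phi u)) /\
  (forall e, connect (wired ([set: E] :\ e) x y) (s e) (t e)).

End Wired.

Lemma connect_embed (N : nat) (E E' : finType) (s t : E -> 'I_N) (s' t' : E' -> 'I_N)
    (i : E -> E') (D : {set E}) (D' : {set E'}) :
  (forall e, s' (i e) = s e) -> (forall e, t' (i e) = t e) ->
  (forall e, e \in D -> i e \in D') ->
  subrel (connect (@adjacent (Multigraph s t) D)) (connect (@adjacent (Multigraph s' t') D')).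
Proof.
move=> si ti DD; apply: connect_sub1 => a b /adjacentP[e eD E1].
by apply/adjacentP; exists (i e); [exact: DD|rewrite /= si ti].
Qed.

Section Expands.
Variables (R : realType) (L : nat) (K : Type) (N : nat) (Om : Type).
Local Notation label := ('I_L * (K * bool))%type.
Variable ent : Om -> label -> 'M[R[i]]_N.
Variable F : set K.
Implicit Types (v q : nat) (C : R) (M : Om -> 'M[R[i]]_N).

Definition property := ('I_L -> rel 'I_N) -> 'I_N -> 'I_N -> Prop.

Definition monotone (Pr : property) : Prop :=
  forall r r' : 'I_L -> rel 'I_N, (forall l, subrel (r l) (r' l)) ->
  forall x y, Pr r x y -> Pr r' x y.

Definition colour_connect (E : finType) (s t : E -> 'I_N) (lab : E -> label) :
    'I_L -> rel 'I_N :=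
  fun l => connect (@adjacent (Multigraph s t)
    (colour (G := Multigraph s t) (fun e => (lab e).1) l)).

(** The random matrix [M] is a sum over the maps of a graph with [v] vertices and [q]
    edges.  The support of the coefficient [a] carries the constraints: two
    vertices are identified by an indicator in [a] rather than by a quotient of the
    graph, so that all combinatorial requirements bear on the image of [phi]. *)
Definition expands v q C (Pr : property) M : Prop :=
  exists (V E : finType) (r1 r2 : V) (s t : E -> V) (lab : E -> label)
    (a : {ffun V -> 'I_N} -> R[i]),
  [/\ (#|V| <= v)%N /\ (#|E| <= q)%N,
      forall e, F (lab e).2.1,
      forall phi, normc (a phi) <= C,
      forall w x y, M w x y = \sum_(phi : {ffun V -> 'I_N} | (phi r1 == x) && (phi r2 == y))
          a phi * \prod_e ent w (lab e) (phi (t e)) (phi (s e)) &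
      forall phi, a phi != 0 ->
        two_terminal (phi \o s) (phi \o t) phi (phi r1) (phi r2) /\
        Pr (colour_connect (phi \o s) (phi \o t) lab) (phi r1) (phi r2)].

Lemma expands_weaken v q C v' q' C' (Pr Pr' : property) M :
  (v <= v')%N -> (q <= q')%N -> C <= C' -> (forall r x y, Pr r x y -> Pr' r x y) ->
  expands v q C Pr M -> expands v' q' C' Pr' M.
Proof.
move=> vv qq CC PP [V [E [r1 [r2 [s [t [lab [a [[Vv Eq] lF aC ME Pa]]]]]]]]].
exists V, E, r1, r2, s, t, lab, a; split => //.
- by split; [exact: leq_trans vv|exact: leq_trans qq].
- by move=> phi; apply: le_trans CC.
- by move=> phi /Pa[h1 /PP h2].
Qed.

Definition comp_property (Pr1 Pr2 : property) : property :=
  fun r x y => exists2 z, Pr1 r x z & Pr2 r z y.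

(** The graphs are put side by side, and the output of one is identified with the
    input of the other.  Deleting an edge of one of them, the other still joins the
    identified point to a terminal. *)
Lemma expands_mul v1 q1 C1 v2 q2 C2 (Pr1 Pr2 : property) M1 M2 :
  monotone Pr1 -> monotone Pr2 ->
  expands v1 q1 C1 Pr1 M1 -> expands v2 q2 C2 Pr2 M2 ->
  expands (v1 + v2) (q1 + q2) (C1 * C2) (comp_property Pr1 Pr2) (fun w => M1 w *m M2 w).
Proof.
move=> mono1 mono2.
move=> [V1 [E1 [i1 [j1 [s1 [t1 [lab1 [a1 [[V1v E1q] lF1 aC1 ME1 Pa1]]]]]]]]].
move=> [V2 [E2 [i2 [j2 [s2 [t2 [lab2 [a2 [[V2v E2q] lF2 aC2 ME2 Pa2]]]]]]]]].
pose V := (V1 + V2)%type; pose E := (E1 + E2)%type.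
pose s (e : E) : V := match e with inl e => inl (s1 e) | inr e => inr (s2 e) end.
pose t (e : E) : V := match e with inl e => inl (t1 e) | inr e => inr (t2 e) end.
pose lab (e : E) : label := match e with inl e => lab1 e | inr e => lab2 e end.
pose fst_part (phi : {ffun V -> 'I_N}) : {ffun V1 -> 'I_N} := [ffun u => phi (inl u)].
pose snd_part (phi : {ffun V -> 'I_N}) : {ffun V2 -> 'I_N} := [ffun u => phi (inr u)].
pose a (phi : {ffun V -> 'I_N}) : R[i] :=
  a1 (fst_part phi) * a2 (snd_part phi) * (phi (inl j1) == phi (inr i2))%:R.
have C10 : 0 <= C1 \/ (forall phi : {ffun V -> 'I_N}, False).
  have [phi _|no] := pickP (fun _ : {ffun V -> 'I_N} => true); last first.
    by right => phi; have := no phi.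
  by left; apply: le_trans (aC1 (fst_part phi)); exact: normc_ge0.
exists V, E, (inl i1), (inr j2), s, t, lab, a; split.
- by rewrite !card_sum; split; exact: leq_add.
- by case.
- move=> phi; rewrite !normcM.
  apply: (@le_trans _ _ (C1 * C2 * 1)); last by rewrite mulr1.
  apply: ler_pM; rewrite ?mulr_ge0 ?normc_ge0//.
    by apply: ler_pM; rewrite ?normc_ge0.
  by case: (_ == _); rewrite ?normc1 ?normc0.
- move=> w x y; rewrite mxE.
  pose glue (p : {ffun V1 -> 'I_N} * {ffun V2 -> 'I_N}) : {ffun V -> 'I_N} :=
    [ffun u => match u with inl u => p.1 u | inr u => p.2 u end].
  have glue1 p : fst_part (glue p) = p.1 by apply/ffunP => u; rewrite !ffunE.
  have glue2 p : snd_part (glue p) = p.2 by apply/ffunP => u; rewrite !ffunE.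
  rewrite (reindex glue); last first.
    exists (fun phi => (fst_part phi, snd_part phi)) => p _.
      by rewrite glue1 glue2; case: p.
    by apply/ffunP => -[u|u]; rewrite !ffunE.
  rewrite (eq_bigl (fun p : {ffun V1 -> 'I_N} * {ffun V2 -> 'I_N} =>
     (p.1 i1 == x) && (p.2 j2 == y))); last by move=> p; rewrite !ffunE.
  pose F1 (p : {ffun V1 -> 'I_N}) := a1 p * \prod_e ent w (lab1 e) (p (t1 e)) (p (s1 e)).
  pose F2 (p : {ffun V2 -> 'I_N}) := a2 p * \prod_e ent w (lab2 e) (p (t2 e)) (p (s2 e)).
  rewrite (eq_bigr (fun p => F1 p.1 * F2 p.2 * (p.1 j1 == p.2 i2)%:R)); last first.
    move=> p _; rewrite /a glue1 glue2 !ffunE big_sumType/=.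
    rewrite (eq_bigr (fun e => ent w (lab1 e) (p.1 (t1 e)) (p.1 (s1 e)))); last first.
      by move=> e _; rewrite !ffunE.
    rewrite [X in _ * (_ * X)](eq_bigr (fun e => ent w (lab2 e) (p.2 (t2 e)) (p.2 (s2 e)))); last first.
      by move=> e _; rewrite !ffunE.
    by rewrite /F1 /F2; ring.
  rewrite -(pair_big (fun p : {ffun V1 -> 'I_N} => p i1 == x)
     (fun p : {ffun V2 -> 'I_N} => p j2 == y)
     (fun p p' => F1 p * F2 p' * (p j1 == p' i2)%:R))/=.
  under eq_bigr do rewrite ME1 ME2 big_distrlr/=.
  under [RHS]eq_bigr => p _ do rewrite (partition_big (fun p' : {ffun V2 -> 'I_N} => p' i2) predT)//=.
  rewrite [RHS]exchange_big/=; apply: eq_bigr => z _.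
  rewrite (eq_bigl (fun p : {ffun V1 -> 'I_N} => (p i1 == x) && (p j1 == z)))//.
  rewrite big_mkcondr/=; apply: eq_bigr => p _.
  case: ifP => [/eqP oz|oz].
    rewrite (eq_bigl (fun p' : {ffun V2 -> 'I_N} => (p' j2 == y) && (p' i2 == z))); last first.
      by move=> p'; rewrite andbC.
    by apply: eq_bigr => p' /andP[_ /eqP iz]; rewrite oz iz eqxx mulr1.
  by rewrite big1// => p' /andP[_ /eqP iz]; rewrite iz oz mulr0.
- move=> phi; rewrite /a !mulf_eq0 !negb_or => /andP[/andP[a10 a20] oi0].
  have oi : phi (inl j1) = phi (inr i2).
    by apply: contraNeq oi0 => /negbTE ->.
  have [[con1 br1] Pr1a] := Pa1 _ a10; have [[con2 br2] Pr2a] := Pa2 _ a20.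
  set x := phi (inl i1); set y := phi (inr j2); set z := phi (inl j1).
  rewrite !ffunE -/x -/z in con1 br1 Pr1a; rewrite !ffunE -oi -/y -/z in con2 br2 Pr2a.
  have emb1 (D : {set E1}) (D' : {set E}) : (forall e, e \in D -> inl e \in D') ->
     subrel (connect (@adjacent (Multigraph (fst_part phi \o s1) (fst_part phi \o t1)) D))
       (connect (@adjacent (Multigraph (phi \o s) (phi \o t)) D')).
    by move=> DD; apply: (@connect_embed _ _ _ _ _ _ _ (inl : E1 -> E)) => // e; rewrite /= ffunE.
  have emb2 (D : {set E2}) (D' : {set E}) : (forall e, e \in D -> inr e \in D') ->
     subrel (connect (@adjacent (Multigraph (snd_part phi \o s2) (snd_part phi \o t2)) D))
       (connect (@adjacent (Multigraph (phi \o s) (phi \o t)) D')).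
    by move=> DD; apply: (@connect_embed _ _ _ _ _ _ _ (inr : E2 -> E)) => // e; rewrite /= ffunE.
  have c1 u (D' : {set E}) : (forall e, inl e \in D') ->
      connect (@adjacent (Multigraph (phi \o s) (phi \o t)) D') x (phi (inl u)).
    by move=> DD; have := con1 u; rewrite ffunE; apply: emb1.
  have c2 u (D' : {set E}) : (forall e, inr e \in D') ->
      connect (@adjacent (Multigraph (phi \o s) (phi \o t)) D') z (phi (inr u)).
    by move=> DD; have := con2 u; rewrite ffunE; apply: emb2.
  split; first split.
  + case=> u; first by apply: c1 => e; rewrite inE.
    by apply: connect_trans (c1 j1 _ _) (c2 u _ _) => e; rewrite inE.
  + have wc D := sym_connect_sym (@wired_sym N E (phi \o s) (phi \o t) D x y).
    case=> e.
      have := br1 e; rewrite /= !ffunE; apply: connect_sub => b b' /or3P[bb|/andP[/eqP -> /eqP ->]|/andP[/eqP -> /eqP ->]].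
      - apply: wired_adjacent; apply: emb1 (connect1 bb) => e'.
        by rewrite !inE !andbT; apply: contra => /eqP[->].
      - apply: connect_trans (wired_wire _ _ _ _ _) _; rewrite wc.
        by apply: wired_adjacent; apply: c2 => e'; rewrite !inE.
      - rewrite wc; apply: connect_trans (wired_wire _ _ _ _ _) _; rewrite wc.
        by apply: wired_adjacent; apply: c2 => e'; rewrite !inE.
    have := br2 e; rewrite /= !ffunE; apply: connect_sub => b b' /or3P[bb|/andP[/eqP -> /eqP ->]|/andP[/eqP -> /eqP ->]].
    - apply: wired_adjacent; apply: emb2 (connect1 bb) => e'.
      by rewrite !inE !andbT; apply: contra => /eqP[->].
    - apply: connect_trans (wired_wire _ _ _ _ _); rewrite wc.
      by apply: wired_adjacent; apply: c1 => e'; rewrite !inE.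
    - rewrite wc; apply: connect_trans (wired_wire _ _ _ _ _); rewrite wc.
      by apply: wired_adjacent; apply: c1 => e'; rewrite !inE.
  + exists z.
      apply: mono1 Pr1a => l; apply: emb1 => e; by rewrite !inE.
    by apply: mono2 Pr2a => l; apply: emb2 => e; rewrite !inE.
Qed.

Lemma expands_restrict v q C (Pr : property) M (b : bool) :
  expands v q C Pr M ->
  expands v q C (fun r x y => Pr r x y /\ (x == y) = b)
    (fun w => \matrix_(x, y) (M w x y * ((x == y) == b)%:R)).
Proof.
move=> [V [E [r1 [r2 [s [t [lab [a [[Vv Eq] lF aC ME Pa]]]]]]]]].
exists V, E, r1, r2, s, t, lab, (fun phi : {ffun V -> 'I_N} => a phi * ((phi r1 == phi r2) == b)%:R); split => //.
- move=> phi; rewrite normcM; apply: le_trans (aC phi); rewrite -[leRHS]mulr1.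
  apply: ler_wpM2l; first exact: normc_ge0.
  by case: (_ == b); rewrite ?normc1 ?normc0.
- move=> w x y; rewrite mxE ME big_distrl/=; apply: eq_bigr => phi /andP[/eqP -> /eqP ->].
  by rewrite mulrAC.
- move=> phi; rewrite mulf_eq0 negb_or => /andP[/Pa[h1 h2] h3]; split => //; split => //.
  by move: h3; case: (@eqP _ (phi r1 == phi r2) b) => // _; rewrite eqxx.
Qed.

Lemma expands_Delta v q C (Pr : property) M :
  expands v q C Pr M ->
  expands v q C (fun r x y => Pr r x y /\ x = y) (fun w => Delta (M w)).
Proof.
move=> /(@expands_restrict _ _ _ _ _ true) h.
have -> : (fun w => Delta (M w)) = (fun w => \matrix_(x, y) (M w x y * ((x == y) == true)%:R)).
  apply/funext => w; apply/matrixP => x y; rewrite !mxE eqb_id.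
  by case: (x == y); rewrite ?mulr1 ?mulr0.
by apply: expands_weaken h => // r x y [h /eqP].
Qed.

Lemma expands_offdiag v q C (Pr : property) M :
  expands v q C Pr M ->
  expands v q C (fun r x y => Pr r x y /\ x != y) (fun w => M w - Delta (M w)).
Proof.
move=> /(@expands_restrict _ _ _ _ _ false) h.
have -> : (fun w => M w - Delta (M w)) =
    (fun w => \matrix_(x, y) (M w x y * ((x == y) == false)%:R)).
  apply/funext => w; apply/matrixP => x y; rewrite !mxE.
  by case: (x == y); rewrite ?mulr1n ?subrr ?mulr0n ?mulr0 ?subr0 ?mulr1.
by apply: expands_weaken h => // r x y [h ->].
Qed.

Hypothesis entC : forall w l k b x y, ent w (l, (k, ~~ b)) y x = (ent w (l, (k, b)) x y)^*%C.

(** The edges are reversed and labelled by the adjoints. *)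
Lemma expands_adjoint v q C (Pr : property) M : monotone Pr ->
  expands v q C Pr M ->
  expands v q C (fun r x y => Pr r y x) (fun w => \matrix_(x, y) (M w y x)^*%C).
Proof.
move=> mono [V [E [r1 [r2 [s [t [lab [a [[Vv Eq] lF aC ME Pa]]]]]]]]].
exists V, E, r2, r1, t, s, (fun e => ((lab e).1, ((lab e).2.1, ~~ (lab e).2.2))),
  (fun phi => (a phi)^*%C); split => //.
- by move=> phi; rewrite normc_conj.
- move=> w x y; rewrite mxE ME rmorph_sum/=; apply: eq_big => [phi|phi _]; first by rewrite andbC.
  rewrite rmorphM rmorph_prod/=; congr (_ * _); apply: eq_bigr => e _.
  by rewrite entC; case: (lab e) => l [k b].
- move=> phi; rewrite conjc_eq0 => /Pa[[con br] PrP].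
  have swap (D : {set E}) : subrel (connect (@adjacent (Multigraph (phi \o s) (phi \o t)) D))
      (connect (@adjacent (Multigraph (phi \o t) (phi \o s)) D)).
    apply: connect_sub1 => b b' /adjacentP[e eD E1]; apply/adjacentP; exists e => //.
    by case: E1 => [[? ?]|[? ?]]; [right|left].
  split; first split.
  + move=> u; apply: connect_trans (swap _ _ _ (con u)).
    by rewrite (@adjacent_csym (Multigraph (phi \o t) (phi \o s))); apply: swap; exact: con.
  + move=> e; have wc D := sym_connect_sym (@wired_sym N E (phi \o t) (phi \o s) D (phi r2) (phi r1)).
    rewrite wc; have := br e; apply: connect_sub => b b' /or3P[bb|/andP[/eqP -> /eqP ->]|/andP[/eqP -> /eqP ->]].
    * by apply: wired_adjacent; apply: swap; exact: connect1.
    * by rewrite wc; exact: wired_wire.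
    * exact: wired_wire.
  + by apply: mono PrP => l; exact: swap.
Qed.

Lemma expands_letter k l : F k ->
  expands 2 1 1 (fun r x y => r l x y) (fun w => ent w (l, (k, false))).
Proof.
move=> Fk.
exists bool, unit, true, false, (fun=> false), (fun=> true), (fun=> (l, (k, false))), (fun=> 1).
split => //.
- by rewrite card_bool card_unit.
- by move=> phi; rewrite normc1.
- move=> w x y; rewrite (big_pred1 [ffun b : bool => if b then x else y]).
    by rewrite mul1r (big_pred1 tt) ?ffunE// => -[].
  move=> phi; apply/andP/eqP => [[/eqP h1 /eqP h2]|->]; last by rewrite !ffunE !eqxx.
  by apply/ffunP => -[]; rewrite ffunE.
- move=> phi _.
  have st (D : {set unit}) : tt \in D ->
      connect (@adjacent (Multigraph (phi \o (fun=> false)) (phi \o (fun=> true))) D)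
        (phi true) (phi false).
    by move=> tD; apply: connect1; apply/adjacentP; exists tt => //; right.
  split; first split.
  + by case; [exact: connect0|apply: st; rewrite inE].
  + move=> e; rewrite (sym_connect_sym (@wired_sym _ _ _ _ _ _ _)); exact: wired_wire.
  + by apply: st; rewrite inE.
Qed.

Lemma expands_diag C (b : 'M[R[i]]_N) : is_diag_mx b -> (forall x, normc (b x x) <= C) ->
  expands 1 0 C (fun r x y => x = y) (fun=> b).
Proof.
move=> /is_diag_mxP bd bC.
exists unit, void, tt, tt, (@of_void _), (@of_void _), (@of_void _), (fun phi : {ffun unit -> 'I_N} => b (phi tt) (phi tt)).
split => //.
- by rewrite card_unit card_void.
- move=> w x y; have [->|xy] := eqVneq x y; last first.
    rewrite bd// big_pred0// => phi; apply/negP => /andP[/eqP h /eqP h'].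
    by move: xy; rewrite -h -h' eqxx.
  rewrite (big_pred1 [ffun=> y]).
    by rewrite !ffunE big_pred0 ?mulr1// => -[].
  move=> phi; rewrite /= andbb; apply/eqP/eqP => [h|->]; last by rewrite ffunE.
  by apply/ffunP => -[]; rewrite ffunE.
- move=> phi _; split => //; split; last by case.
  by case; exact: connect0.
Qed.

End Expands.

(** * Expansions of centred products *)

Local Open Scope sesquilinear_scope.

(** The rest of the cycle joins the ends of [e]. *)
Lemma cycle_bridgeless (G : multigraph) (c : seq (edge G * bool)) e :
  simple_cycle c -> e \in cycle_edges c ->
  connect (adjacent ([set: edge G] :\ e)) (source e) (target e).
Proof.
move=> /and4P[_ uc _ cyc]; rewrite inE => /mapP[s sc eE].
have [i c' cE] := rot_to sc.
have uc' : uniq (map fst (s :: c')) by rewrite -cE map_rot rot_uniq.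
have : path (fun s t => step_to s == step_from t) s (rcons c' s).
  by move: cyc; rewrite -(rot_cycle i) cE.
have walk s0 p s1 : path (fun s t => @step_to G s == step_from t) s0 (rcons p s1) ->
    e \notin map fst p ->
    connect (adjacent ([set: edge G] :\ e)) (step_to s0) (step_from s1).
  elim: p s0 => [|a p ih] s0 /=; first by rewrite andbT => /eqP ->; rewrite connect0.
  rewrite inE negb_or => /andP[/eqP -> pp] /andP[ea ep].
  apply: connect_trans (ih _ pp ep); apply: connect1; apply/adjacentP; exists a.1.
    by rewrite !inE andbT eq_sym.
  by rewrite /step_from /step_to; case: (a.2); [left|right].
move=> /walk; rewrite eE; move: uc' => /= /andP[sn _] /(_ sn).
rewrite /step_to /step_from; case: (s.2) => //.
by rewrite (@adjacent_csym G).
Qed.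

Lemma cactus_bridgeless (G : multigraph) : cactus G -> forall e : edge G,
  connect (adjacent ([set: edge G] :\ e)) (source e) (target e).
Proof.
move=> [_ cac] e; have [S [[eS [c cc cS]] _]] := cac e.
by apply: (cycle_bridgeless cc); rewrite cS.
Qed.

Section Patterns.
Variables (R : realType) (L : nat) (K : Type) (N : nat) (Om : Type).
Variable ent : Om -> 'I_L * (K * bool) -> 'M[R[i]]_N.
Variable F : set K.
Implicit Types (v q : nat) (C : R) (M : Om -> 'M[R[i]]_N).

Local Notation expands := (expands ent F).

(** The terminals coincide, and each edge lies on a cycle. *)
Lemma expands_cactus (g : graph_monomial ('I_L * K)) :
  cactus_type g -> (forall e : edge (graph g), F (label e).2) ->
  expands #|vertex (graph g)| #|edge (graph g)| 1 (fun r x y => x = y)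
    (fun w => graph_eval (fun lk => ent w (lk.1, (lk.2, false))) g).
Proof.
move=> [[cac _] io] gF.
exists (vertex (graph g)), (edge (graph g)), (output g), (input g), (@source _), (@target _),
  (fun e : edge (graph g) => ((label e).1, ((label e).2, false))), (fun=> 1).
split => //.
- by move=> phi; rewrite normc1.
- move=> w x y; rewrite mxE; apply: eq_big => [phi|phi _]; first by rewrite andbC.
  by rewrite mul1r.
- move=> phi _; rewrite io; split => //.
  have push (D : {set edge (graph g)}) a b : connect (adjacent D) a b ->
     connect (@adjacent (Multigraph (phi \o @source _) (phi \o @target _)) D) (phi a) (phi b).
    apply: connect_homo => {}a {}b /adjacentP[e eD E1]; apply: connect1.
    by apply/adjacentP; exists e => //; case: E1 => [[<- <-]|[<- <-]]; [left|right].
  split.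
    move=> u; apply: push; have [_ con] := connectedP (subgraphT _) (graph_connected g).
    by apply: con; rewrite inE.
  by move=> e; apply: wired_adjacent; apply: push; exact: cactus_bridgeless.
Qed.

(** The properties that survive products of any length. *)
Definition multiplicative (Pr : property L N) : Prop :=
  [/\ monotone Pr, forall r x, Pr r x x &
      forall r x y z, Pr r x z -> Pr r z y -> Pr r x y].

Lemma is_diag_mx1 : is_diag_mx (1%:M : 'M[R[i]]_N).
Proof. exact: scalar_mx_is_diag. Qed.

Lemma expands_one : expands 1 0 1 (fun r x y => x = y) (fun=> 1%:M).
Proof.
by apply: expands_diag; [exact: is_diag_mx1|move=> x; rewrite mxE eqxx normc1].
Qed.

Lemma expands_prod n v q C (Pr : property L N) (M : 'I_n -> Om -> 'M[R[i]]_N) :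
  multiplicative Pr -> (forall j, expands v q C Pr (M j)) ->
  expands (n * v).+1 (n * q) (C ^+ n) Pr (fun w => \big[mulmx/1%:M]_(j < n) M j w).
Proof.
move=> [mono rf tr]; elim: n M => [|n ih] M MP.
  have -> : (fun w => \big[mulmx/1%:M]_(j < 0) M j w) = (fun=> 1%:M).
    by apply/funext => w; rewrite big_ord0.
  by apply: expands_weaken expands_one => // r x y ->.
have -> : (fun w => \big[mulmx/1%:M]_(j < n.+1) M j w) =
    (fun w => M ord0 w *m \big[mulmx/1%:M]_(j < n) M (lift ord0 j) w).
  by apply/funext => w; rewrite big_ord_recl.
apply: expands_weaken (expands_mul mono mono (MP ord0) (ih _ (fun j => MP (lift ord0 j)))).
- by rewrite mulSn addnS.
- by rewrite mulSn.
- by rewrite exprS.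
- by move=> r x y [z h1 h2]; exact: tr h1 h2.
Qed.

Definition same_component (l : 'I_L) : property L N := fun r x y => connect (r l) x y.

Lemma same_component_mult l : multiplicative (same_component l).
Proof.
split.
- by move=> r r' rr x y; apply: connect_sub1; exact: rr.
- by move=> r x; exact: connect0.
- by move=> r x y z; exact: connect_trans.
Qed.

(** What a product of off-diagonal factors of colours [ls] leaves on the graph drawn by [phi]. *)
Fixpoint chain_property (ls : seq 'I_L) : property L N := fun r x y =>
  if ls is l :: ls' then
    exists2 z, same_component l r x z /\ x != z & chain_property ls' r z y
  else x = y.

Lemma chain_property_mono ls : monotone (chain_property ls).
Proof.
move=> r r' rr; elim: ls => //= l ls ih x y [z [xz ne] zy].
by exists z; [split => //; exact: (connect_sub1 (rr l)) xz|exact: ih].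
Qed.

Lemma offdiag_mono (Pr : property L N) : monotone Pr -> monotone (fun r x y => Pr r x y /\ x != y).
Proof. by move=> mono r r' rr x y [h1 h2]; split => //; exact: mono h1. Qed.

Lemma expands_chain n v q C (M : 'I_n -> Om -> 'M[R[i]]_N) (l : 'I_n -> 'I_L) :
  (forall j, expands v q C (same_component (l j)) (M j)) ->
  expands (n * v).+1 (n * q) (C ^+ n) (chain_property [seq l j | j <- enum 'I_n])
    (fun w => \big[mulmx/1%:M]_(j < n) (M j w - Delta (M j w))).
Proof.
elim: n M l => [|n ih] M l MP.
  have -> : (fun w => \big[mulmx/1%:M]_(j < 0) (M j w - Delta (M j w))) = (fun=> 1%:M).
    by apply/funext => w; rewrite big_ord0.
  by rewrite enum_ord0; apply: expands_weaken expands_one.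
have -> : (fun w => \big[mulmx/1%:M]_(j < n.+1) (M j w - Delta (M j w))) =
    (fun w => (M ord0 w - Delta (M ord0 w)) *m
       \big[mulmx/1%:M]_(j < n) (M (lift ord0 j) w - Delta (M (lift ord0 j) w))).
  by apply/funext => w; rewrite big_ord_recl.
have [mono _ _] := same_component_mult (l ord0).
apply: expands_weaken (expands_mul (offdiag_mono mono) (@chain_property_mono _)
  (expands_offdiag (MP ord0)) (ih _ (fun j => l (lift ord0 j)) (fun j => MP (lift ord0 j)))).
- by rewrite mulSn addnS.
- by rewrite mulSn.
- by rewrite exprS.
- by move=> r x y [z h1 h2]; rewrite enum_ordSl /= -map_comp; exists z.
Qed.

(** The closed walk may be anywhere in the graph, so that a product inherits it from any of its
    factors. *)
Definition circuit (ls : seq 'I_L) : property L N := fun r _ _ =>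
  exists z, chain_property ls r z z.

(** Off-diagonal factors make the steps of the walk non stationary, and the outer
    [Delta] closes the walk. *)
Lemma expands_centered n v q C (M : Om -> 'I_n -> 'M[R[i]]_N) (l : 'I_n -> 'I_L) :
  (forall j, expands v q C (same_component (l j)) (fun w => M w j)) ->
  expands (n * v).+1 (n * q) (C ^+ n) (circuit [seq l j | j <- enum 'I_n])
    (fun w => centered_product (M w)).
Proof.
move=> h; apply: expands_weaken (expands_Delta (expands_chain h)) => // r x y [hc xy].
by exists y; rewrite -{1}xy.
Qed.

End Patterns.

Section Monomials.
Variables (R : realType) (L : nat) (K : Type) (N : nat) (Om : Type).
Variable ent : Om -> 'I_L * (K * bool) -> 'M[R[i]]_N.
Variable F : set K.
Implicit Types (v q : nat) (C : R) (M : Om -> 'M[R[i]]_N).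

Local Notation expands := (expands ent F).

(** Within one factor all letters have the same colour and the coefficients are diagonal,
    so that the walk stays in one component. *)
Lemma expands_monomial v q C (l : 'I_L) (B : Type) (ev : Om -> B -> 'M[R[i]]_N)
    (Q : monomial B K) (D : nat) :
  1 <= C -> (degree Q <= D)%N -> (forall j, F (letter Q j)) ->
  (forall j, expands v q C (fun r x y => x = y) (fun w => ev w (coef Q j))) ->
  expands (v + (D * (2 + v)).+1) (q + D * (1 + q)) (C * C ^+ D) (@same_component L N l)
    (fun w => monomial_eval (ev w) (fun k => ent w (l, (k, false))) Q).
Proof.
move=> C1 degD lF cof; have [mono rf tr] := @same_component_mult L N l.
have C0 : 0 <= C by apply: le_trans C1.
have cof' j : expands v q C (@same_component L N l) (fun w => ev w (coef Q j)).
  by apply: expands_weaken (cof j) => // r x y ->.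
have let' j : expands 2 1 1 (@same_component L N l) (fun w => ent w (l, (letter Q j, false))).
  by apply: expands_weaken (expands_letter ent l (lF j)) => // r x y; exact: connect1.
have step j : expands (2 + v) (1 + q) C (@same_component L N l)
    (fun w => ent w (l, (letter Q j, false)) *m ev w (coef Q (lift ord0 j))).
  apply: expands_weaken (expands_mul mono mono (let' j) (cof' _)) => //.
    by rewrite mul1r.
  by move=> r x y [z]; exact: tr.
have := expands_mul mono mono (cof' ord0) (expands_prod (@same_component_mult L N l) step).
apply: expands_weaken.
- by rewrite leq_add2l ltnS leq_mul2r degD orbT.
- by rewrite leq_add2l leq_mul2r degD orbT.
- by apply: ler_wpM2l => //; exact: ler_weXn2l.
- by move=> r x y [z]; exact: tr.
Qed.

Hypothesis entC : forall w l k b x y, ent w (l, (k, ~~ b)) y x = (ent w (l, (k, b)) x y)^*%C.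

Lemma circuit_monotone ls : monotone (@circuit L N ls).
Proof. by move=> r r' rr x y [z h]; exists z; exact: chain_property_mono h. Qed.

(** One factor is enough to provide the circuit. *)
Lemma expands_power v q C (ls : seq 'I_L) M m :
  expands v q C (@circuit L N ls) M ->
  expands ((v + v) + (m * (v + v)).+1) ((q + q) + m * (q + q)) (C * C * (C * C) ^+ m)
    (@circuit L N ls) (fun w => \big[mulmx/1%:M]_(j < m.+1) (M w *m (M w)^t*)).
Proof.
move=> MP; have mono := @circuit_monotone ls.
have adj : expands v q C (@circuit L N ls) (fun w => (M w)^t*).
  have -> : (fun w => (M w)^t*) = (fun w => \matrix_(x, y) (M w y x)^*%C).
    by apply/funext => w; apply/matrixP => x y; rewrite !mxE.
  by apply: expands_weaken (expands_adjoint entC mono MP).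
have sq : expands (v + v) (q + q) (C * C) (@circuit L N ls) (fun w => M w *m (M w)^t*).
  by apply: expands_weaken (expands_mul mono mono MP adj) => // r x y [z].
have triv : multiplicative (fun _ _ _ => True : Prop) by split.
have sq' (j : 'I_m) : expands (v + v) (q + q) (C * C) (fun _ _ _ => True) (fun w => M w *m (M w)^t*).
  exact: expands_weaken sq.
have -> : (fun w => \big[mulmx/1%:M]_(j < m.+1) (M w *m (M w)^t*)) =
    (fun w => (M w *m (M w)^t*) *m \big[mulmx/1%:M]_(j < m) (M w *m (M w)^t*)).
  by apply/funext => w; rewrite big_ord_recl.
have mt : monotone (fun _ _ _ => True : Prop) by [].
by apply: expands_weaken (expands_mul mono (mt L N) sq (expands_prod (triv L N) sq')) => // r x y [z [u h] _]; exists u.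
Qed.

End Monomials.

(** * Boundedness of the traces *)

Lemma cmeanZ d (T : measurableType d) (R : realType) (P : probability T R) (c : R[i]) (X : T -> R[i]) :
  bounded_crv P X -> cmean P (fun w => c * X w) = c * cmean P X.
Proof.
move=> bX; have b1 := bounded_crv_Re bX; have b2 := bounded_crv_Im bX.
have bZ (a : R) Y : bounded_rv P Y -> bounded_rv P (fun w => a * Y w).
  by move=> bY; apply: bounded_rvM => //; exact: bounded_rv_cst.
apply/eqP; rewrite eq_complex Re_mul Im_mul /=; apply/andP; split; apply/eqP.
  rewrite -!rmeanZ// -rmeanB; [|exact: bZ..].
  by congr rmean; apply/funext => w; rewrite Re_mul.
rewrite -!rmeanZ// -rmeanD; [|exact: bZ..].
by congr rmean; apply/funext => w; rewrite Im_mul.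
Qed.

Lemma chain_walk (L N : nat) (r : 'I_L -> rel 'I_N) (l0 : 'I_L) (ls : seq 'I_L) x y :
  chain_property ls r x y ->
  exists z : nat -> 'I_N, [/\ z 0%N = x, z (size ls) = y,
    forall i, (i < size ls)%N -> z i != z i.+1 &
    forall i, (i < size ls)%N -> connect (r (nth l0 ls i)) (z i) (z i.+1)].
Proof.
elim: ls x => [|l ls ih] x /=; first by move=> ->; exists (fun=> y).
move=> [x' [xx' ne] /ih[z [z0 zn zne zc]]].
exists (fun i => if i is i'.+1 then z i' else x); split => //.
  by case=> [|i] ii; [rewrite z0|exact: zne].
by case=> [|i] ii; [rewrite z0|exact: zc].
Qed.

Section TraceBound.
Context (R : realType) (L : nat) (K : Type)
  (d : nat -> measure_display) (T : forall N, measurableType (d N))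
  (P : forall N, probability (T N) R)
  (A Gamma : forall N, 'I_L -> K -> T N -> 'M[R[i]]_N).
Arguments A : clear implicits.
Arguments Gamma : clear implicits.
Hypothesis hA : forall N l k, Linfty_mx (P N) (A N l k).
Hypothesis hAindep : forall N, independent_families (P N) (fun l w k => A N l k w).
Hypothesis hAperm : forall N l, permutation_invariant (P N) (A N l).
Hypothesis hGamma : forall N l k, random_mx (Gamma N l k).
Variable G : R.
Hypothesis G1 : 1 <= G.
Hypothesis hGbound : forall N l k i j, {ae P N, forall w, normc (Gamma N l k w i j) <= G}.
Arguments hGbound : clear implicits.
Hypothesis hAGamma : forall N, independent2 (P N)
     (fun w (lk : 'I_L * K) => A N lk.1 lk.2 w)
     (fun w (lk : 'I_L * K) => Gamma N lk.1 lk.2 w).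

Local Notation At := (entrywise_product A Gamma).

Lemma Gamma_Linfty N l k : Linfty_mx (P N) (Gamma N l k).
Proof. by split; [exact: hGamma|move=> i j; exists G; exact: hGbound]. Qed.

Lemma entry_product N (w : T N) lk i j :
  entry At w lk i j = entry A w lk i j * entry Gamma w lk i j.
Proof.
case: lk => l [k b]; rewrite /entry /coloured_family /= !with_adjointsE.
by case: b; rewrite !mxE// rmorphM.
Qed.

Lemma entry_adjoint N (w : T N) l k b x y :
  entry At w (l, (k, ~~ b)) y x = (entry At w (l, (k, b)) x y)^*%C.
Proof. by rewrite /entry /coloured_family /= !with_adjointsE; case: b => //=; rewrite conjcK. Qed.

Lemma entry_bounded N lk i j : bounded_crv (P N) (fun w => entry At w lk i j).
Proof.
have -> : (fun w : T N => entry At w lk i j) = (fun w => entry A w lk i j * entry Gamma w lk i j).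
  by apply/funext => w; exact: entry_product.
by apply: bounded_crvM; apply: coloured_family_bounded => // *; exact: Gamma_Linfty.
Qed.

Lemma labelled_entry_cmeasurable N (lk : 'I_L * (K * bool)) i j :
  cmeasurable (fun M : family_space R N ('I_L * K)%type =>
    with_adjoints (fun k => M (lk.1, k)) lk.2 i j).
Proof.
case: lk => l [k b] /=; rewrite (_ : (fun M => _) =
   (fun M : family_space R N ('I_L * K)%type => if b then (M (l, k) j i)^*%C else M (l, k) i j)).
  by case: b; [apply: cmeasurable_conj|]; exact: entry_cmeasurable.
by apply/funext => M; rewrite with_adjointsE.
Qed.

(** The entrywise product separates the two independent families. *)
Lemma product_mean N (E : finType) (lab : E -> 'I_L * (K * bool)) (x y : E -> 'I_N) :
  cmean (P N) (fun w => \prod_e entry At w (lab e) (x e) (y e)) =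
  cmean (P N) (fun w => \prod_e entry A w (lab e) (x e) (y e)) *
  cmean (P N) (fun w => \prod_e entry Gamma w (lab e) (x e) (y e)).
Proof.
pose f (M : family_space R N ('I_L * K)%type) : R[i] :=
  \prod_e with_adjoints (fun k => M ((lab e).1, k)) (lab e).2 (x e) (y e).
have mf : cmeasurable f.
  by apply: cmeasurable_prod => e _; exact: labelled_entry_cmeasurable.
transitivity (cmean (P N) (fun w => f (fun lk => A N lk.1 lk.2 w) * f (fun lk => Gamma N lk.1 lk.2 w))).
  congr cmean; apply/funext => w; rewrite -big_split/=.
  by apply: eq_bigr => e _; rewrite entry_product.
rewrite (cmean_independent2 (hAGamma (N := N)))//.
- by apply: random_family_measurable => lk; have [] := hA N lk.1 lk.2.
- by apply: random_family_measurable => lk; exact: hGamma.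
- by apply: bounded_crv_prod => e _; exact: coloured_family_bounded.
- by apply: bounded_crv_prod => e _; apply: coloured_family_bounded => *; exact: Gamma_Linfty.
Qed.

Lemma Gamma_mean_bound N (E : finType) (lab : E -> 'I_L * (K * bool)) (x y : E -> 'I_N) q :
  (#|E| <= q)%N ->
  normc (cmean (P N) (fun w => \prod_e entry Gamma w (lab e) (x e) (y e))) <= 2 * G ^+ q.
Proof.
move=> Eq; have G0 : 0 <= G by apply: le_trans G1.
apply: cmean_bound.
  by apply: bounded_crv_prod => e _; apply: coloured_family_bounded => *; exact: Gamma_Linfty.
have h : {ae P N, forall w, forall e : E, normc (entry Gamma w (lab e) (x e) (y e)) <= G}.
  apply: filter_forall => e; case: (lab e) => l [k b].
  have := hGbound N l k; rewrite /entry /coloured_family /=.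
  case: b => h; [move: (h (y e) (x e))|move: (h (x e) (y e))]; apply: filterS => w;
    by rewrite with_adjointsE ?normc_conj.
move: h; apply: filterS => w h.
rewrite normc_prod; apply: (@le_trans _ _ (\prod_(e : E) G)).
  by apply: ler_prod => e _; rewrite normc_ge0 h.
by rewrite prodr_const; exact: ler_weXn2l.
Qed.

Lemma expands_bounded F N v q C Pr (M : T N -> 'M[R[i]]_N) i j :
  expands (@entry _ _ _ _ _ At N) F v q C Pr M -> bounded_crv (P N) (fun w => M w i j).
Proof.
move=> [V [E [r1 [r2 [s [t [lab [a [_ _ _ ME _]]]]]]]]].
have -> : (fun w => M w i j) = (fun w => \sum_(phi : {ffun V -> 'I_N} | (phi r1 == i) && (phi r2 == j))
          a phi * \prod_e entry At w (lab e) (phi (t e)) (phi (s e))).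
  by apply/funext => w; exact: ME.
apply: bounded_crv_sum => phi _; apply: bounded_crvM; first exact: bounded_crv_cst.
by apply: bounded_crv_prod => e _; exact: entry_bounded.
Qed.

(** In a trace the two terminals coincide, and the graph of [phi] has no bridges.  The
    bound [N^-k] for an image of size [k] balances the number of such maps. *)
Lemma circuit_trace_bound (F : set K) (ls : seq 'I_L) : graph_bound P A F ->
  (1 < size ls)%N -> (forall l0 i, (i.+1 < size ls)%N -> nth l0 ls i != nth l0 ls i.+1) ->
  forall v q C, exists D N0, 0 <= D /\ forall N, (N0 <= N)%N -> forall M : T N -> 'M[R[i]]_N,
    expands (@entry _ _ _ _ _ At N) F v q C (@circuit L N ls) M ->
    normc (cmean (P N) (fun w => \tr (M w))) <= D.
Proof.
move=> gb ls2 lsne v q C.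
have l0 : 'I_L by move: (ls) ls2 => [].

have G0 : 0 <= G by apply: le_trans G1.
have [C0 [N0 [C00 H]]] := proper_bound hA hAindep hAperm gb v q.
pose W : R := (\sum_(m < v.+1) m.+1 ^ v)%N%:R.
pose c : R := `|C| * (C0 * (2 * G ^+ q)).
have Gq0 : 0 <= 2 * G ^+ q by rewrite mulr_ge0// exprn_ge0.
have c0 : 0 <= c by rewrite /c; apply: mulr_ge0 => //; exact: mulr_ge0.
exists (c * W), (maxn N0 1); split; first by rewrite mulr_ge0.
move=> N; rewrite geq_max => /andP[NN0 N1] M.
move=> [V [E [r1 [r2 [s [t [lab [a [[Vv Eq] lF aC ME Pa]]]]]]]]].
pose X (phi : {ffun V -> 'I_N}) (w : T N) := \prod_e entry At w (lab e) (phi (t e)) (phi (s e)).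
have bX phi : bounded_crv (P N) (X phi).
  by apply: bounded_crv_prod => e _; exact: entry_bounded.
have trE w : \tr (M w) = \sum_(phi : {ffun V -> 'I_N} | phi r1 == phi r2) a phi * X phi w.
  rewrite /mxtrace (partition_big (fun phi : {ffun V -> 'I_N} => phi r2) predT)//=.
  apply: eq_bigr => x _; rewrite ME; apply: eq_bigl => phi.
  by apply/andP/andP => -[/eqP -> /eqP ->].
have -> : (fun w => \tr (M w)) = (fun w => \sum_(phi : {ffun V -> 'I_N} | phi r1 == phi r2) a phi * X phi w).
  by apply/funext.
rewrite cmean_sum; last first.
  by move=> phi _; apply: bounded_crvM => //; exact: bounded_crv_cst.
apply: le_trans (normc_sum _ _ _) _.
have term (phi : {ffun V -> 'I_N}) : phi r1 == phi r2 ->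
    normc (cmean (P N) (fun w => a phi * X phi w)) <= c * N%:R^-1 ^+ image_size phi.
  move=> /eqP rr; have iN0 : 0 <= (N%:R^-1 : R) ^+ image_size phi by rewrite exprn_ge0// invr_ge0.
  rewrite cmeanZ// normcM.
  have [->|/Pa[[con br] [z0 /(chain_walk l0)[z [zs zn zne zc]]]]] := eqVneq (a phi) 0.
    by rewrite normc0 mul0r mulr_ge0.
  rewrite -mulrA; apply: ler_pM; rewrite ?normc_ge0//.
    exact: le_trans (aC phi) (ler_norm _).
  rewrite product_mean normcM mulrAC; apply: ler_pM; rewrite ?normc_ge0//; last first.
    exact: Gamma_mean_bound.
  apply: (H N NN0 V E s t lab phi r1) => //.
    by move=> e; have := br e; rewrite rr; exact: wired_trivial.
  exists (size ls), z, (nth l0 ls); split => //; first by rewrite zs zn.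
  - by move=> i ii; apply: connect_sub (zc i ii).
  - by move=> i ii; exact: lsne.
apply: le_trans (ler_sum _ term) _; rewrite -big_distrr/=; apply: ler_wpM2l => //.
apply: le_trans (_ : \sum_(phi : {ffun V -> 'I_N}) (N%:R^-1 : R) ^+ image_size phi <= _).
  rewrite [leRHS](bigID (fun phi : {ffun V -> 'I_N} => phi r1 == phi r2))/= lerDl.
  by apply: sumr_ge0 => phi _; rewrite exprn_ge0// invr_ge0.
apply: le_trans (image_weight_sum _ _ N1) _; rewrite ler_nat.
rewrite (big_ord_widen v.+1 (fun m => m ^ #|V|)%N) ?ltnS//.
rewrite [leqRHS](bigID (fun m : 'I_v.+1 => m < #|V|.+1)%N)/=.
apply: leq_trans (leq_addr _ _); apply: leq_sum => m _.
apply: (@leq_trans (m.+1 ^ #|V|)); first by rewrite leq_exp2r//; apply/card_gt0P; exists r1.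
exact: leq_pexp2l.
Qed.

End TraceBound.

(** * Powers of diagonal matrices *)

(** The spectral decomposition is not unique.  But the unitary [U] intertwines
    the spectral diagonal with the given one, hence links only equal eigenvalues,
    and intertwines their powers as well. *)
Lemma psd_pow_diag (R : realType) N (e : 'rV[R]_N) (p : R) :
  psd_pow (diag_mx (map_mx (real_complex R) e)) p =
  diag_mx (map_mx (fun x => (x `^ p)%:C) e).
Proof.
set M := diag_mx _; rewrite /psd_pow; set U := spectralmx M; set D := spectral_diag M.
have MH : M^t* = M.
  apply/matrixP => i j; rewrite !mxE eq_sym; case: eqVneq => [->|_].
    by rewrite !mulr1n; apply/eqP; rewrite eq_complex /= oppr0 !eqxx.
  by rewrite !mulr0n rmorph0.
have /orthomx_spectralP ME : M \is normalmx by apply/normalmxP; rewrite MH.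
have Uu : U \in unitmx := spectral_unit M.
have UM : diag_mx D *m U = U *m M by rewrite [in RHS]ME !mulmxA mulmxV// mul1mx.
rewrite -mulmxA; apply: (canLR (mulKmx Uu)); apply/matrixP => i j.
have := congr1 (fun X : 'M[R[i]]_N => X i j) UM.
rewrite !mul_diag_mx !mul_mx_diag !mxE mulrC => /eqP.
rewrite -subr_eq0 -mulrBr mulf_eq0 => /orP[/eqP ->|]; first by rewrite mulr0 mul0r.
by rewrite subr_eq0 => /eqP ->; rewrite mulrC.
Qed.

Lemma powR_le_interpolate (R : realType) (x p : R) (k : nat) :
  0 <= x -> 1 <= p -> p <= k.+1%:R -> x `^ p <= x + x ^+ k.+1.
Proof.
move=> x0 p1 pk.
have [->|xn] := eqVneq x 0.
  by rewrite powR0 ?gt_eqF ?(lt_le_trans ltr01)// expr0n addr0.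
have xp : 0 < x by rewrite lt_neqAle eq_sym xn x0.
have [x1|x1] := leP x 1.
  apply: le_trans (_ : x <= _); last by rewrite lerDl exprn_ge0.
  by rewrite -[leRHS]powRr1//; apply: ger_powR => //; rewrite xp x1.
apply: le_trans (_ : x ^+ k.+1 <= _); last by rewrite lerDr.
by rewrite -powR_mulrn//; apply: ler_powR => //; exact: ltW.
Qed.

Section Diagonal.
Variables (R : realType) (N : nat) (M : 'M[R[i]]_N).
Hypothesis diagM : Delta M = M.

(** The eigenvalues of [M M^*] for a diagonal [M]. *)
Definition diag_sqr (i : 'I_N) : R := normc (M i i) ^+ 2.

Lemma diag_square : M *m M^t* = diag_mx (map_mx (real_complex R) (\row_i diag_sqr i)).
Proof.
have off i j : i != j -> M i j = 0 by move=> ij; rewrite -diagM mxE (negbTE ij).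
apply/matrixP => i j; rewrite !mxE (bigD1 i)//= big1 ?addr0; last first.
  by move=> k ki; rewrite (off i k) ?mul0r// eq_sym.
rewrite !mxE; case: eqVneq => [->|ij]; first by rewrite mulr1n mulc_conj.
by rewrite (off j i) ?rmorph0 ?mulr0// eq_sym.
Qed.

Lemma trace_psd_pow p :
  complex.Re (\tr (psd_pow (M *m M^t*) p)) = \sum_i diag_sqr i `^ p.
Proof.
rewrite diag_square psd_pow_diag mxtrace_diag raddf_sum/=.
by apply: eq_bigr => i _; rewrite !mxE.
Qed.

Lemma trace_mul_pow m :
  \tr (\big[mulmx/1%:M]_(j < m) (M *m M^t*)) = (\sum_i diag_sqr i ^+ m)%:C.
Proof.
have -> : \big[mulmx/1%:M]_(j < m) (M *m M^t*) =
    diag_mx (map_mx (real_complex R) (\row_i diag_sqr i ^+ m)).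
  elim: m => [|m ih].
    rewrite big_ord0; apply/matrixP => i j; rewrite !mxE expr0.
    by case: (i == j); rewrite ?mulr1n ?mulr0n.
  rewrite big_ord_recl ih diag_square; apply/matrixP => i j.
  rewrite mul_diag_mx !mxE exprS; case: (i == j); rewrite ?mulr0n ?mulr0//.
  by rewrite !mulr1n -rmorphM.
by rewrite mxtrace_diag rmorph_sum; apply: eq_bigr => i _; rewrite !mxE.
Qed.

End Diagonal.

(** * From moments to Schatten norms *)

Local Open Scope classical_set_scope.
Local Open Scope ring_scope.
Local Open Scope complex_scope.

Section Schatten.
Context (R : realType) (d : nat -> measure_display) (T : forall N, measurableType (d N))
  (P : forall N, probability (T N) R) (eps : forall N, T N -> 'M[R[i]]_N).
Arguments eps : clear implicits.
Hypothesis diag_eps : forall N w, Delta (eps N w) = eps N w.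
Hypothesis eps_bounded : forall N i j, bounded_crv (P N) (fun w => eps N w i j).

Let e N (w : T N) (i : 'I_N) : R := diag_sqr (eps N w) i.

Lemma diag_sqr_bounded N i : bounded_rv (P N) (fun w => e w i).
Proof.
have h := eps_bounded i i.
have -> : (fun w : T N => e w i) = (fun w => complex.Re (eps N w i i) * complex.Re (eps N w i i)
    + complex.Im (eps N w i i) * complex.Im (eps N w i i)).
  by apply/funext => w; rewrite /e /diag_sqr normc_sqr !expr2.
by apply: bounded_rvD; apply: bounded_rvM; do ?[exact: bounded_crv_Re h|exact: bounded_crv_Im h].
Qed.

Lemma bounded_rvX N (X : T N -> R) m : bounded_rv (P N) X -> bounded_rv (P N) (fun w => X w ^+ m).
Proof.
move=> bX; elim: m => [|m ih].
  by under eq_fun do rewrite expr0; exact: bounded_rv_cst.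
by under eq_fun do rewrite exprS; exact: bounded_rvM.
Qed.

Lemma bounded_rv_powR N (X : T N -> R) p : 1 <= p -> (forall w, 0 <= X w) ->
  bounded_rv (P N) X -> bounded_rv (P N) (fun w => X w `^ p).
Proof.
move=> p1 X0 [mX [c cX]]; split.
  exact: (measurableT_comp (@measurable_powR R p) mX).
exists (c `^ p); move: cX; apply: filterS => w.
rewrite !ger0_norm ?powR_ge0// => Xc.
by apply: ge0_ler_powR; rewrite ?nnegrE ?(le_trans _ Xc)// (le_trans _ p1).
Qed.

(** The first moment and a moment of integer order above [p] are bounded without
    normalisation, and they dominate the moment of order [p] up to the factor [1/N]. *)
Lemma schatten_from_moments :
  (forall m : nat, exists D N0, forall N, (N0 <= N)%N ->
     normc (cmean (P N) (fun w =>
       \tr (\big[mulmx/1%:M]_(j < m.+1) (eps N w *m (eps N w)^t*)))) <= D) ->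
  schatten_cvg0 P eps.
Proof.
move=> mom p p1.
pose k := Num.truncn p.
have pk : p <= k.+1%:R by apply: ltW; rewrite /k; apply: Num.Theory.truncnS_gt.
have e0 N (w : T N) i : 0 <= e w i by exact: sqr_ge0.
pose S m N (w : T N) := \sum_i e w i ^+ m.
have bS m N : bounded_rv (P N) (S m N).
  by apply: bounded_rv_sum => i _; apply: bounded_rvX; exact: diag_sqr_bounded.
have S0 m N w : 0 <= S m N w by apply: sumr_ge0 => i _; exact: exprn_ge0.
have SD m : exists D N0, forall N, (N0 <= N)%N -> rmean (P N) (S m.+1 N) <= D.
  have [D [N0 h]] := mom m; exists D, N0 => N NN.
  apply: le_trans (h N NN); apply: le_trans (Re_le_normc _).
  apply: le_trans (ler_norm _) _.
  rewrite /cmean /= le_eqVlt; apply/orP; left; apply/eqP; congr (`|rmean _ _|).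
  by apply/funext => w; rewrite (trace_mul_pow (diag_eps w)).
have [D1 [N1 h1]] := SD 0%N; have [D2 [N2 h2]] := SD k.
pose Y N (w : T N) : R := N%:R^-1 * \sum_i e w i `^ p.
have bY N : bounded_rv (P N) (Y N).
  apply: bounded_rvM; first exact: bounded_rv_cst.
  by apply: bounded_rv_sum => i _; apply: bounded_rv_powR => //; exact: diag_sqr_bounded.
have YE N : 'E_(P N)[fun w => (N%:R^-1 *
        complex.Re (\tr (psd_pow (eps N w *m (eps N w)^t*) p)))%R]%E = (rmean (P N) (Y N))%:E.
  have -> : (fun w => N%:R^-1 * complex.Re (\tr (psd_pow (eps N w *m (eps N w)^t*) p))) = Y N.
    by apply/funext => w; rewrite (trace_psd_pow (diag_eps w)).
  rewrite rmeanE fineK// unlock.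
  exact: integrable_fin_num (bounded_rv_integrable (bY N)).
under eq_fun do rewrite YE.
apply: cvg_EFin; first by near=> N.
apply/cvgr0Pnorm_lt => ep ep0; near=> N => /=.
have Npos : (0 < N)%N by near: N; exists 1%N.
have NN1 : (N1 <= N)%N by near: N; exists N1.
have NN2 : (N2 <= N)%N by near: N; exists N2.
have Y0 : 0 <= rmean (P N) (Y N).
  apply: Rintegral_ge0 => w _; rewrite mulr_ge0 ?invr_ge0// sumr_ge0// => i _; exact: powR_ge0.
rewrite ger0_norm//.
have YS : rmean (P N) (Y N) <= N%:R^-1 * (rmean (P N) (S 1%N N) + rmean (P N) (S k.+1 N)).
  rewrite -rmeanD// -rmeanZ; last exact: bounded_rvD.
  apply: le_Rintegral => //; try apply: bounded_rv_integrable => //.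
    by apply: bounded_rvM; [exact: bounded_rv_cst|exact: bounded_rvD].
  move=> w _; apply: ler_wpM2l; first by rewrite invr_ge0.
  rewrite -big_split/=; apply: ler_sum => i _; rewrite expr1.
  exact: powR_le_interpolate.
apply: le_lt_trans YS _.
rewrite mulrC ltr_pdivrMr ?ltr0n//.
apply: le_lt_trans (lerD (h1 N NN1) (h2 N NN2)) _.
rewrite mulrC -ltr_pdivrMr//.
near: N; exact: nbhs_infty_gtr.
Unshelve. all: by end_near.
Qed.

End Schatten.

(** * Asymptotic freeness *)

Section Freeness.
Context (R : realType) (L : nat) (K : Type)
  (d : nat -> measure_display) (T : forall N, measurableType (d N))
  (P : forall N, probability (T N) R)
  (A Gamma : forall N, 'I_L -> K -> T N -> 'M[R[i]]_N).
Arguments A : clear implicits.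
Arguments Gamma : clear implicits.
Hypothesis hA : forall N l k, Linfty_mx (P N) (A N l k).
Hypothesis hAindep : forall N, independent_families (P N) (fun l w k => A N l k w).
Hypothesis hAperm : forall N l, permutation_invariant (P N) (A N l).
Hypothesis hGamma : forall N l k, random_mx (Gamma N l k).
Hypothesis hGammabound : bounded_entries P Gamma.
Hypothesis hAGamma : forall N, independent2 (P N)
     (fun w (lk : 'I_L * K) => A N lk.1 lk.2 w)
     (fun w (lk : 'I_L * K) => Gamma N lk.1 lk.2 w).
Variables (n : nat) (l : 'I_n -> 'I_L).
Hypothesis hn : (2 <= n)%N.
Hypothesis hl : forall i j : 'I_n, j = i.+1 :> nat -> l i <> l j.

Local Notation At := (entrywise_product A Gamma).

(** The expansions have a size that does not depend on [N], and so has the bound on the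
    trace of each power. *)
Lemma centered_schatten_cvg0 (F : set K) (v q : nat) (C : R)
    (M : forall N, T N -> 'I_n -> 'M[R[i]]_N) :
  graph_bound P A F ->
  (forall N j, expands (@entry _ _ _ _ _ At N) F v q C (@same_component L N (l j))
     (fun w => M N w j)) ->
  schatten_cvg0 P (fun N w => centered_product (M N w)).
Proof.
move=> gb MP; have [c hc] := hGammabound.
pose G := `|c| + 1.
have G1 : 1 <= G by rewrite lerDr.
have hG N k l' i j : {ae P N, forall w, normc (Gamma N k l' w i j) <= G}.
  apply: filterS (hc N k l' i j) => w /le_trans; apply.
  by rewrite (le_trans (ler_norm _))// lerDl.
set ls := [seq l j | j <- enum 'I_n].
have szls : size ls = n by rewrite size_map size_enum_ord.
have lsne l0 i : (i.+1 < size ls)%N -> nth l0 ls i != nth l0 ls i.+1.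
  rewrite szls => ii; have ii' := ltnW ii.
  have lsE k (kn : (k < n)%N) : nth l0 ls k = l (Ordinal kn).
    by rewrite /ls (@nth_map _ (Ordinal ii) _ l0 l _ (enum 'I_n)) ?size_enum_ord// (nth_ord_enum _ (Ordinal kn)).
  by rewrite (lsE _ ii) (lsE _ ii'); apply/eqP; exact: hl.
have epsP N := expands_centered (MP N).
apply: schatten_from_moments.
- by move=> N w; apply/matrixP => i j; rewrite !mxE; case: (i == j); rewrite ?mulr1n ?mulr0n.
- move=> N i j; exact: (expands_bounded hA hGamma hG _ _ (epsP N)).
- move=> m.
  have ls2 : (1 < size ls)%N by rewrite szls.
  have bound v' q' C' (X : forall N, T N -> 'M[R[i]]_N) :
      (forall N, expands (@entry _ _ _ _ _ At N) F v' q' C' (@circuit L N ls) (X N)) ->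
      exists D N0, forall N, (N0 <= N)%N -> normc (cmean (P N) (fun w => \tr (X N w))) <= D.
    move=> XP; have [D [N0 [_ h]]] := circuit_trace_bound hA hAindep hAperm hGamma G1 hG
      hAGamma gb ls2 lsne v' q' C'.
    by exists D, N0 => N NN; exact: h NN _ (XP N).
  apply: bound => N.
  exact: (expands_power (@entry_adjoint _ _ _ _ _ A Gamma N) m (epsP N)).
Qed.

Lemma diagonal_coefficients (Q : forall N, 'I_n -> monomial 'M[R[i]]_N K) (F : set K) :
  graph_bound P A F ->
  (forall N i j, is_diag_mx (coef (Q N i) j)) ->
  (exists D : nat, forall N i, (degree (Q N i) <= D)%N) ->
  (exists C : R, forall N i j, opnorm (coef (Q N i) j) <= C) ->
  (forall N i j, F (letter (Q N i) j)) ->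
  schatten_cvg0 P (fun N w =>
    centered_product (fun i : 'I_n =>
      monomial_eval id (fun k => At (l i) k w) (Q N i))).
Proof.
move=> gb Qd [D QD] [C QC] QF.
have C0 : 0 <= `|C| + 1 by rewrite addr_ge0.
apply: (@centered_schatten_cvg0 F _ _ _ (fun N w (i : 'I_n) =>
  monomial_eval id (fun k => At (l i) k w) (Q N i)) gb) => N i.
apply: (@expands_monomial _ _ _ _ _ _ F 1 0 (`|C| + 1) (l i) _ (fun=> id) (Q N i) D) => //.
  by rewrite lerDr.
move=> j; apply: expands_diag => // x.
rewrite -(@ler_pXn2r _ 2) ?nnegrE ?normc_ge0//.
apply: (contraction_entry x x (opnorm_contraction (le_trans (QC N i j) _))).
by rewrite (le_trans (ler_norm _))// lerDl.
Qed.

Definition cactus_letters (Q : 'I_n -> monomial (graph_monomial ('I_L * K)) K) : set K :=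
  (\bigcup_i (range (letter (Q i)))) `|`
  (\bigcup_i \bigcup_j (range (fun e : edge (graph (coef (Q i) j)) => (label e).2))).

Lemma finite_cactus_letters Q : finite_set (cactus_letters Q).
Proof.
rewrite /cactus_letters finite_setU; split; apply: bigcup_finite => // i _.
  exact: finite_image.
by apply: bigcup_finite => // j _; exact: finite_image.
Qed.

Lemma cactus_coefficients (Q : 'I_n -> monomial (graph_monomial ('I_L * K)) K) (F : set K) :
  graph_bound P A F -> cactus_letters Q `<=` F ->
  (forall i j, cactus_type (coef (Q i) j)) ->
  schatten_cvg0 P (fun N w =>
    centered_product (fun i : 'I_n =>
      monomial_eval (graph_eval (fun lk : 'I_L * K => At lk.1 lk.2 w))
        (fun k => At (l i) k w) (Q i))).
Proof.
move=> gb QF Qc.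
pose v := (\sum_i \sum_j #|vertex (graph (coef (Q i) j))|)%N.
pose q := (\sum_i \sum_j #|edge (graph (coef (Q i) j))|)%N.
pose D := (\sum_i degree (Q i))%N.
have sumle (X : finType) (f : X -> nat) x : (f x <= \sum_y f y)%N.
  by rewrite (bigD1 x)//= leq_addr.
apply: (@centered_schatten_cvg0 F _ _ _ (fun N w (i : 'I_n) =>
  monomial_eval (graph_eval (fun lk : 'I_L * K => At lk.1 lk.2 w))
        (fun k => At (l i) k w) (Q i)) gb) => N i.
apply: (@expands_monomial _ _ _ _ _ _ F v q 1 (l i) _
  (fun w => graph_eval (fun lk : 'I_L * K => At lk.1 lk.2 w)) (Q i) D) => //.
- exact: sumle.
- by move=> j; apply: QF; left; exists i => //; exists j.
- move=> j; apply: (expands_weaken _ _ _ _ (expands_cactus _ (Qc i j) _)) => //.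
  + exact: leq_trans (sumle _ (fun j => #|vertex (graph (coef (Q i) j))|) j)
      (sumle _ (fun i => \sum_j #|vertex (graph (coef (Q i) j))|)%N i).
  + exact: leq_trans (sumle _ (fun j => #|edge (graph (coef (Q i) j))|) j)
      (sumle _ (fun i => \sum_j #|edge (graph (coef (Q i) j))|)%N i).
  + by move=> e; apply: QF; right; exists i => //; exists j => //; exists e.
Qed.

End Freeness.

Unset Implicit Arguments.

Theorem proposition2p4
  (R : realType) (L : nat) (K : Type)
  (d : nat -> measure_display) (T : forall N, measurableType (d N))
  (P : forall N, probability (T N) R)
  (A Gamma : forall N, 'I_L -> K -> T N -> 'M[R[i]]_N)
  (hL : (1 <= L)%N)
  (hA : forall N l k, Linfty_mx (P N) (A N l k))
  (hAindep : forall N, independent_families (P N) (fun l w k => A N l k w))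
  (hAperm : forall N l, permutation_invariant (P N) (A N l))
  (hAbound : bounded_opnorm P A \/ graph_moments_bounded P A)
  (hGamma : forall N l k, random_mx (Gamma N l k))
  (hGammabound : bounded_entries P Gamma)
  (hAGamma : forall N, independent2 (P N)
     (fun w (lk : 'I_L * K) => A N lk.1 lk.2 w)
     (fun w (lk : 'I_L * K) => Gamma N lk.1 lk.2 w))
  (n : nat) (hn : (2 <= n)%N) (l : 'I_n -> 'I_L)
  (hl : forall i j : 'I_n, j = i.+1 :> nat -> l i <> l j) :
  let At := entrywise_product A Gamma in
  (* (a) *)
  (forall Q : forall N, 'I_n -> monomial 'M[R[i]]_N K,
     (forall N i j, is_diag_mx (coef (Q N i) j)) ->
     (exists D : nat, forall N i, (degree (Q N i) <= D)%N) ->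
     (exists C : R, forall N i j, opnorm (coef (Q N i) j) <= C) ->
     (* automatic when K is finite *)
     (bounded_opnorm P A \/
      exists F : set K, finite_set F /\ forall N i j, F (letter (Q N i) j)) ->
     schatten_cvg0 P (fun N w =>
       centered_product (fun i : 'I_n =>
         monomial_eval id (fun k => At N (l i) k w) (Q N i))))
  /\
  (* (b) *)
  (forall Q : 'I_n -> monomial (graph_monomial ('I_L * K)) K,
     (forall i j, cactus_type (coef (Q i) j)) ->
     schatten_cvg0 P (fun N w =>
       centered_product (fun i : 'I_n =>
         monomial_eval
           (graph_eval (fun lk : 'I_L * K => At N lk.1 lk.2 w))
           (fun k => At N (l i) k w) (Q i)))).
Proof.
split.
  move=> Q Qd QD QC finQ.
  have [F gb QF] : exists2 F : set K, graph_bound P A F & forall N i j, F (letter (Q N i) j).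
    case: hAbound => [/(opnorm_graph_bound hA)|mom]; first by exists setT.
    case: finQ => [/(opnorm_graph_bound hA)|[F [finF QF]]]; first by exists setT.
    by exists F => //; exact: moments_graph_bound.
  exact: (diagonal_coefficients hA hAindep hAperm hGamma hGammabound hAGamma hn hl gb).
move=> Q Qc.
have [F gb QF] : exists2 F : set K, graph_bound P A F & cactus_letters Q `<=` F.
  case: hAbound => [/(opnorm_graph_bound hA)|mom]; first by exists setT.
  by exists (cactus_letters Q) => //; apply: moments_graph_bound => //; exact: finite_cactus_letters.
exact: (cactus_coefficients hA hAindep hAperm hGamma hGammabound hAGamma hn hl gb QF Qc).
Qed.
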